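(* Let $g^{ij}(u)$ be a flat nondegenerate (pseudo-Riemannian) contravariant metric in local coordinates $u=(u^1,\dots,u^n)$ with Levi-Civita connection $\nabla$ and Christoffel symbols $\Gamma^j_{sk}$, let $$J^{ij}=g^{ij}\frac{d}{dx}-g^{is}\Gamma^j_{sk}u^k_x,$$ and consider the Hamiltonian system $$u^i_t=\upsilon^i_j(u)u^j_x=J^{ij}\frac{\partial h}{\partial u^j},\qquad \upsilon^i_j=\nabla^i\nabla_jh .$$ Let $B\,dx+A\,dt$ and $N\,dx+M\,dt$ be two conservation laws of this system, with $BM-AN\neq0$ and $ME-N\upsilon$ invertible ($E$ the identity matrix). Perform the reciprocal transformation $$d\tilde x=B(u)\,dx+A(u)\,dt,\qquad d\tilde t=N(u)\,dx+M(u)\,dt,$$ under which the system becomes $$u^i_{\tilde t}=\tilde\upsilon^i_j(u)u^j_{\tilde x},\qquad \tilde\upsilon=(B\upsilon-AE)(ME-N\upsilon)^{-1}.$$ Let $P,Q,R,S$ be the fluxes of $B$ and $N$ along the two flows $$u^i_\tau=(\nabla^i\nabla_jN)u^j_x,\qquad u^i_\zeta=(\nabla^i\nabla_jB)u^j_x,$$ i.e. functions of $u$ such that the 1-forms $B\,dx+A\,dt+P\,d\tau+Q\,d\zeta$ and $N\,dx+M\,dt+R\,d\tau+S\,d\zeta$ are closed by virtue of the $t$-, $\tau$- and $\zeta$-flows, normalized by $$Q=\tfrac12 g^{ij}\partial_iB\,\partial_jB,\qquad R=\tfrac12 g^{ij}\partial_iN\,\partial_jN,\qquad P+S=g^{ij}\partial_iB\,\partial_jN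 .$$ Put $$\mu^i_j=B\nabla^i\nabla_jN-P\delta^i_j+N\tilde\upsilon^k_j\nabla^i\nabla_kN-R\tilde\upsilon^i_j,$$ $$\lambda^i_j=B\nabla^i\nabla_jB-Q\delta^i_j+N\tilde\upsilon^k_j\nabla^i\nabla_kB-S\tilde\upsilon^i_j,$$ and let $\tilde g$ be the metric with covariant components $$\tilde g_{ij}=\frac{(M\delta^s_i-N\upsilon^s_i)(M\delta^r_j-N\upsilon^r_j)}{(BM-AN)^2}\,g_{sr},$$ with Levi-Civita Christoffel symbols $\tilde\Gamma$. Then after the reciprocal transformation the local Hamiltonian operator $J$ becomes the nonlocal Hamiltonian operator $$\tilde J^{ij}=\tilde g^{ij}\frac{d}{d\tilde x}-\tilde g^{is}\tilde\Gamma^j_{sk}u^k_{\tilde x}+\lambda^i_ku^k_{\tilde x}\Big(\frac{d}{d\tilde x}\Big)^{-1}u^j_{\tilde x}+u^i_{\tilde x}\Big(\frac{d}{d\tilde x}\Big)^{-1}\lambda^j_ku^k_{\tilde x}+\mu^i_ku^k_{\tilde x}\Big(\frac{d}{d\tilde x}\Big)^{-1}\tilde\upsilon^j_su^s_{\tilde x}+\tilde\upsilon^i_su^s_{\tilde x}\Big(\frac{d}{d\tilde x}\Big)^{-1}\mu^j_ku^k_{\tilde x};$$ that is, $\tilde J$ is a Hamiltonian operator, and the transformed system is Hamiltonian with respect to it, $u^i_{\tilde t}=\tilde J^{ij}\,\partial\tilde h/\partial u^j$ for some density $\tilde h(u)$. In particular, the curvature tensor of $\tilde g$ is $$\tilde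 R^{ij}_{kl}=\lambda^i_k\delta^j_l+\lambda^j_l\delta^i_k-\lambda^j_k\delta^i_l-\lambda^i_l\delta^j_k+\mu^i_k\tilde\upsilon^j_l+\mu^j_l\tilde\upsilon^i_k-\mu^j_k\tilde\upsilon^i_l-\mu^i_l\tilde\upsilon^j_k .$$
   Context: Summation over repeated indices is understood; everything is local and smooth; $\partial_i=\partial/\partial u^i$ and $\nabla^i=g^{ij}\nabla_j$. Conservation laws and fluxes. $B\,dx+A\,dt$ is a conservation law of $u^i_t=\upsilon^i_ju^j_x$ if this 1-form is closed on solutions, i.e. $\partial_jA=(\partial_iB)\upsilon^i_j$. Likewise the fluxes satisfy $\partial_jP=(\partial_iB)\nabla^i\nabla_jN$, $\partial_jQ=(\partial_iB)\nabla^i\nabla_jB$, $\partial_jR=(\partial_iN)\nabla^i\nabla_jN$, $\partial_jS=(\partial_iN)\nabla^i\nabla_jB$. The $t$-, $\tau$- and $\zeta$-flows commute. The matrices $\mu,\lambda$ are those of the $\tau$- and $\zeta$-flows rewritten in the variables $\tilde x,\tilde t,\tau,\zeta$: $u^i_\tau=\mu^i_ju^j_{\tilde x}$, $u^i_\zeta=\lambda^i_ju^j_{\tilde x}$. Curvature convention. The sign of $R^{ij}_{kl}$ is such that a metric of constant curvature $c$ has $R^{ij}_{kl}=c(\delta^i_k\delta^j_l-\delta^i_l\delta^j_k)$; the index is raised with the metric in question. Inverse derivative. $(d/d\tilde x)^{-1}$ is the formal inverse of the total derivative; $(d/d\tilde x)^{-1}$ of $\frac{d}{d\tilde x}F(u)$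 is $F$, defined up to an additive constant, and Hamiltonian representations of systems are understood for an appropriate choice of these integration constants. Hamiltonian operator. An operator is Hamiltonian if the bracket $\{F,G\}=\int \frac{\delta F}{\delta u^i}J^{ij}\frac{\delta G}{\delta u^j}\,dx$ is skew-symmetric and satisfies the Jacobi identity. The following known criterion is used for nonlocal operators of hydrodynamic type $$J^{ij}=g^{ij}\frac{d}{dx}-g^{is}\Gamma^j_{sk}u^k_x+\sum_\alpha\varepsilon^\alpha w^i_{(\alpha)k}u^k_x\Big(\frac{d}{dx}\Big)^{-1}w^j_{(\alpha)s}u^s_x,\qquad \varepsilon^\alpha=\pm1,$$ with $\Gamma$ the Levi-Civita connection of the nondegenerate metric $g$: it is Hamiltonian if and only if $g_{ik}w^k_{(\alpha)j}=g_{jk}w^k_{(\alpha)i}$, $\nabla_kw^i_{(\alpha)j}=\nabla_jw^i_{(\alpha)k}$ (with $\nabla$ the connection of this $g$), $R^{ij}_{kl}=\sum_\alpha\varepsilon^\alpha\big(w^i_{(\alpha)k}w^j_{(\alpha)l}-w^i_{(\alpha)l}w^j_{(\alpha)k}\big)$, and the affinors $w_{(\alpha)}$ pairwise commute. A symmetric pair of tail terms $a^i_ku^k_x(d/dx)^{-1}b^j_su^s_x+b^i_su^s_x(d/dx)^{-1}a^j_ku^k_x$ is brought to this form by polarization, and contributes $a^i_kb^j_l+a^j_lb^i_k-a^j_kb^i_l-a^i_lb^j_k$ to the curvature expansion. *)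

(* Defs.v *)
From HB Require Import structures.
From mathcomp Require Import all_boot all_order all_algebra.
From mathcomp Require Import all_classical all_reals all_analysis.

Set Implicit Arguments.
Unset Strict Implicit.
Unset Printing Implicit Defensive.

Import Order.TTheory GRing.Theory Num.Theory.
Import numFieldNormedType.Exports.

Local Open Scope classical_set_scope.
Local Open Scope ring_scope.

Section Smooth.
Context {R : realType} {V W : normedModType R}.

Fixpoint Ck (k : nat) (D : set V) (f : V -> W) : Prop :=
  match k with
  | 0 => forall x, D x -> {for x, continuous f}
  | k'.+1 => (forall x, D x -> differentiable f x) /\
             (forall v, Ck k' D (fun x => 'D_v f x))
  end.

(* C^infinity at the points of D, which is open in all uses below (V is finite
   dimensional there, so directional derivatives give all partial ones). *)
Definition smooth (D : set V) (f : V -> W) : Prop := forall k, Ck k D f.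

End Smooth.

(* A point u = (u^1, ..., u^n) is a row vector.  An affinor a^i_j is the matrix
   with i (upper index) as row and j (lower index) as column.  A metric is
   always given by its contravariant components g^{ij}; invmx gives g_{ij}. *)
Section Geometry.
Context {R : realType} {n : nat}.
Notation point := 'rV[R]_n.
Notation affinor := (point -> 'M[R]_n).

Definition pd (i : 'I_n) (f : point -> R) (u : point) : R :=
  'D_(delta_mx 0 i) f u.

Definition grad (f : point -> R) (u : point) : 'rV[R]_n := \row_j pd j f u.

Definition metric (U : set point) (g : affinor) : Prop :=
  [/\ forall i j, smooth U (fun u => g u i j),
      forall u, U u -> (g u)^T = g u &
      forall u, U u -> g u \in unitmx].

(* christoffel g u j s k = Gamma^j_{sk} *)
Definition christoffel (g : affinor) (u : point) (j s k : 'I_n) : R :=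
  2^-1 * \sum_m g u j m *
    (pd s (fun v => invmx (g v) m k) u + pd k (fun v => invmx (g v) m s) u
     - pd m (fun v => invmx (g v) s k) u).

(* riemann g u i j k l = R^i_{jkl}, with R(d_k, d_l) d_j = R^i_{jkl} d_i and
   R(X, Y) = [nabla_X, nabla_Y] - nabla_[X, Y] *)
Definition riemann (g : affinor) (u : point) (i j k l : 'I_n) : R :=
  pd k (fun v => christoffel g v i l j) u
  - pd l (fun v => christoffel g v i k j) u
  + \sum_m (christoffel g u i k m * christoffel g u m l j
            - christoffel g u i l m * christoffel g u m k j).

(* R^{ij}_{kl} = g^{jm} R^i_{mkl}; with this sign, a metric of constant
   curvature c has R^{ij}_{kl} = c (delta^i_k delta^j_l - delta^i_l delta^j_k) *)
Definition curvature (g : affinor) (u : point) (i j k l : 'I_n) : R :=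
  \sum_m g u j m * riemann g u i m k l.

Definition flat (U : set point) (g : affinor) : Prop :=
  forall u, U u -> forall i j k l, riemann g u i j k l = 0.

(* the affinor nabla^i nabla_j f *)
Definition hess (g : affinor) (f : point -> R) : affinor := fun u =>
  \matrix_(i, j) \sum_s g u i s *
    (pd s (fun v => pd j f v) u - \sum_k christoffel g u k s j * pd k f u).

(* g^{ij} (d_i f1) (d_j f2) *)
Definition grad_prod (g : affinor) (f1 f2 : point -> R) (u : point) : R :=
  \sum_i \sum_j g u i j * pd i f1 u * pd j f2 u.

(* B dx + A dt is closed by virtue of u_t = V(u) u_x *)
Definition conservation_law (U : set point) (V : affinor) (B A : point -> R)
    : Prop :=
  forall u, U u -> forall j, pd j A u = \sum_i pd i B u * V u i j.

(* (a v)^i = a^i_k v^k *)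
Definition act (a : 'M[R]_n) (v : 'rV[R]_n) : 'rV[R]_n :=
  \row_i \sum_k a i k * v 0 k.

(* u_t = V(u) u_x at the points (x, t) of O *)
Definition solution (V : affinor) (O : set (R * R)) (u : R * R -> point)
    : Prop :=
  forall p, O p -> differentiable u p /\
    'D_((0, 1) : R * R) u p = act (V (u p)) ('D_((1, 0) : R * R) u p).

(* dX = B dx + A dt and dT = N dx + M dt along u : (x, t) |-> u(x, t) *)
Definition reciprocal_variables (B A N M : point -> R) (O : set (R * R))
    (u : R * R -> point) (X T : R * R -> R) : Prop :=
  forall p, O p ->
  [/\ differentiable X p, differentiable T p,
      'D_((1, 0) : R * R) X p = B (u p) /\ 'D_((0, 1) : R * R) X p = A (u p) &
      'D_((1, 0) : R * R) T p = N (u p) /\ 'D_((0, 1) : R * R) T p = M (u p)].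

(* Every solution u(x, t) of u_t = V u_x, when rewritten as a function w of the
   new variables (X, T), satisfies w_T = W w_X. *)
Definition reciprocal_transform (U : set point) (B A N M : point -> R)
    (V W : affinor) : Prop :=
  forall (O : set (R * R)) (u w : R * R -> point) (X T : R * R -> R),
  open O -> (forall p, O p -> U (u p)) -> solution V O u ->
  reciprocal_variables B A N M O u X T ->
  (forall p, O p -> u p = w (X p, T p)) ->
  (forall p, O p -> differentiable w (X p, T p)) ->
  solution W [set (X p, T p) | p in O] w.

End Geometry.

Section Operators.
Context {R : realType} {n : nat}.
Notation point := 'rV[R]_n.
Notation affinor := (point -> 'M[R]_n).
Notation mu := (@lebesgue_measure R).

(* The skew-symmetric inverse of d/dx; the integrands to which it is applied
   below are continuous with compact support. *)
Definition Dinv (f : R -> R) (x : R) : R :=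
  2^-1 * (Rintegral mu [set` `]-oo, x]] f - Rintegral mu [set` `[x, +oo[] f).

(* b^j_s u^s_x xi_j, the argument of (d/dx)^{-1} in a tail term *)
Definition tail_density (b : affinor) (u xi : R -> point) (x : R) : R :=
  \sum_j \sum_s b (u x) j s * (derive1 u x) 0 s * xi x 0 j.

(* The value at x of
     g^{ij} d/dx xi_j - g^{is} Gamma^j_{sk} u^k_x xi_j
       + \sum_al a_al^i_k u^k_x (d/dx)^{-1} (b_al^j_s u^s_x xi_j),
   where p al stands for the chosen (d/dx)^{-1} (b_al^j_s u^s_x xi_j). *)
Definition hydro_op (g : affinor) (m : nat) (a : 'I_m -> affinor)
    (p : 'I_m -> R -> R) (u xi : R -> point) (x : R) : 'rV[R]_n :=
  \row_i (\sum_j g (u x) i j * (derive1 xi x) 0 j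
          - \sum_j \sum_s \sum_k g (u x) i s * christoffel g (u x) j s k
              * (derive1 u x) 0 k * xi x 0 j)
  + \sum_(al < m) p al x *: act (a al (u x)) (derive1 u x).

(* The operator J[u] applied to a covector field xi along u. *)
Definition nonlocal_op (g : affinor) (m : nat) (a b : 'I_m -> affinor)
    (u xi : R -> point) : R -> 'rV[R]_n :=
  hydro_op g a (fun al => Dinv (tail_density (b al) u xi)) u xi.

(* V(u) u_x = J dh/du, where (d/dx)^{-1} of d/dx F(u) is F(u), each tail
   having its own integration constant (absorbed in F al). *)
Definition hamiltonian_system (U : set point) (g : affinor) (m : nat)
    (a b : 'I_m -> affinor) (V : affinor) (h : point -> R) : Prop :=
  exists F : 'I_m -> point -> R,
    (forall al, smooth U (F al)) /\
    forall u : R -> point, smooth setT u -> (forall x, U (u x)) -> forall x,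
      (forall al, is_derive x (1 : R) (fun y => F al (u y))
         (tail_density (b al) u (fun y => grad h (u y)) x)) /\
      act (V (u x)) (derive1 u x) =
      hydro_op g a (fun al y => F al (u y)) u (fun y => grad h (u y)) x.

Definition const_outside (L : R) (c : point) (f : R -> point) : Prop :=
  forall x, L <= `|x| -> f x = c.

(* Phase space: smooth x |-> u(x) in U equal to one constant off a compact. *)
Definition field (U : set point) (u : R -> point) : Prop :=
  [/\ smooth setT u, forall x, U (u x) & exists L c, const_outside L c u].

Definition smooth_family (O : set (R * R)) (phi : R * R -> R -> point)
    : Prop :=
  smooth [set q : R * R * R | O q.1] (fun q => phi q.1 q.2).

(* Two-parameter families of fields; their variations have compact support,
   locally uniformly in the parameters. *)
Definition field_family (U : set point) (O : set (R * R))
    (phi : R * R -> R -> point) : Prop :=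
  [/\ smooth_family O phi, forall p x, O p -> U (phi p x) &
      forall p0, O p0 -> exists L c,
        \forall p \near p0, const_outside L c (phi p)].

Definition covector_family (O : set (R * R)) (psi : R * R -> R -> point)
    : Prop :=
  smooth_family O psi /\
  forall p0, O p0 -> exists L,
    \forall p \near p0, exists c, const_outside L c (psi p).

Definition pairing (xi v : R -> point) : R :=
  Rintegral mu setT (fun x => \sum_i xi x 0 i * v x 0 i).

(* F is a smooth functional with variational derivative dF u = delta F/delta u:
   along every smooth family of fields, dF is a smooth family of covector
   fields and the variation of F is \int (delta F/delta u^i) (delta u^i) dx.
   E.g. F u = \int (f(u, u_x, ...) - f(c, 0, ...)) dx, c the constant value of
   u near infinity, and F u = \int xi_i u^i dx with xi of compact support. *)
Definition functional (U : set point) (F : (R -> point) -> R)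
    (dF : (R -> point) -> (R -> point)) : Prop :=
  forall (O : set (R * R)) (phi : R * R -> R -> point),
  open O -> field_family U O phi ->
  covector_family O (fun p => dF (phi p)) /\
  forall p e, O p ->
    is_derive p e (fun q => F (phi q))
      (pairing (dF (phi p)) (fun x => 'D_e (fun q => phi q x) p)).

(* {F, G} = \int (delta F/delta u^i) J^{ij} (delta G/delta u^j) dx *)
Definition bracket (J : (R -> point) -> (R -> point) -> (R -> point))
    (dF dG : (R -> point) -> (R -> point)) (u : R -> point) : R :=
  pairing (dF u) (J u (dG u)).

(* bracket3 J dF dG dH u r says that {{F, G}, H} exists at u and equals r:
   {K, H} = \int (delta K/delta u^i) J^{ij} (delta H/delta u^j) dx is the
   first variation of K = {F, G} along J (delta H/delta u). *)
Definition bracket3 (J : (R -> point) -> (R -> point) -> (R -> point))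
    (dF dG dH : (R -> point) -> (R -> point)) (u : R -> point) (r : R)
    : Prop :=
  is_derive (0 : R) (1 : R)
    (fun s : R => bracket J dF dG (fun x => u x + s *: J u (dH u) x)) r.

Definition hamiltonian_operator (U : set point)
    (J : (R -> point) -> (R -> point) -> (R -> point)) : Prop :=
  (forall F dF G dG, functional U F dF -> functional U G dG ->
     forall u, field U u -> bracket J dF dG u = - bracket J dG dF u) /\
  (forall F dF G dG H dH,
     functional U F dF -> functional U G dG -> functional U H dH ->
     forall u, field U u -> exists r1 r2 r3 : R,
       [/\ bracket3 J dF dG dH u r1, bracket3 J dG dH dF u r2,
           bracket3 J dH dF dG u r3 & r1 + r2 + r3 = 0]).

End Operators.

(* Main.v *)
(* In the frame k = (M - N v) / (B M - A N) the reciprocal metric has the matrix of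
   g, and its Levi-Civita connection becomes nabla + b ^ k + nu ^ (k vt), where b
   and nu are the gradients of B and N.  Flatness of g, the equations of the fluxes
   and their normalization then give the curvature and the Codazzi equations for
   la and mu.

   For the Jacobi identity, the derivative of {F, G} in the direction V = J dH is
   F''(V, J dG) - G''(V, J dF) plus the integral of xi . (J'(u) V) eta, with
   xi = dF and eta = dG.  The second variations cancel in the cyclic sum by Young's
   theorem applied to F(u + s V + t W).  By the Gauss and Codazzi equations,
   xi . (J'(u) V) eta is, up to a total derivative, a combination of Christoffel
   symbols and tails whose cyclic sum vanishes pointwise.

   The density h and its flux f = g(dh, dh) / 2 become the density
   (h M - f N) / (B M - A N) of the transformed system. *)
Require Import Defs.
From HB Require Import structures.
From mathcomp Require Import all_boot all_order all_algebra.
From mathcomp Require Import all_classical all_reals all_analysis.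
From mathcomp Require Import ring lra.
Set Implicit Arguments.
Unset Strict Implicit.
Unset Printing Implicit Defensive.
Import Order.TTheory GRing.Theory Num.Theory.
Import numFieldNormedType.Exports.
Local Open Scope classical_set_scope.
Local Open Scope ring_scope.

(** * Smooth functions *)

(** The tails are kept in pairs: an involution of the indices matches the left affinor of a tail
    with its right one, and the Gauss equation is used in that paired form, so polarization and
    signs never occur. The obstacle is that (d/dx)^{-1} of a compactly supported function is not
    compactly supported: it ends at plus and minus half the integral. Skew-symmetry survives because
    a product of two such functions takes the same value at both ends, and J dH is still a variation
    of compact support because every tail carries a factor u_x. Skew-symmetry also moves (d/dx)^{-1}
    off a varied tail density, which leaves tails of unvaried fields only and makes the remaining
    identity pointwise. Commutation of the affinors comes from the fluxes: equality of the mixed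
    second derivatives of a flux forces two Hessians to commute once third covariant derivatives are
    symmetric, which is flatness. The normalization of Q, R and P + S enters twice: it cancels the
    curvature terms quadratic in the gradients of B and N, and it makes the tail densities of the
    transformed system exact. *)

Section LocalDiff.
Context {R : realType} {V W : normedModType R}.
Implicit Types f g : V -> W.

Lemma near0_differentiable f x : (\forall y \near x, f y = 0) -> differentiable f x.
Proof.
move=> f0; have fx0 : f x = 0 := nbhs_singleton f0.
apply/diffP => /=.
apply: (@getPex _ (fun (df : {linear V -> W}) => continuous df /\
  forall y, f y = f (lim (nbhs x)) + df (y - lim (nbhs x))
                  +o_(y \near x) (y - lim (nbhs x)))).
(* The differential is the zero map, and the remainder is [f] itself. *)
exists (\0%R : {linear V -> W}); split => [y|]; first exact: cvg_cst.
have E : f = [o_x (center x) of f].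
  apply/eqoP => e e0; near=> z.
  suff -> : f z = 0 by rewrite normr0 mulr_ge0// ltW.
  by near: z.
apply: eqaddoEx => y; rewrite lim_id// fx0 add0r /= add0r.
by rewrite {1}E.
Unshelve. all: by end_near. Qed.

Lemma near_eq_differentiable f g x :
  (\forall y \near x, f y = g y) -> differentiable f x -> differentiable g x.
Proof.
move=> fg df; have -> : g = f + (g - f) by rewrite addrC subrK.
apply: differentiableD => //; apply: near0_differentiable.
by apply: filterS fg => y /= fgy; change (g y - f y = 0); rewrite fgy subrr.
Qed.

Lemma open_near (D : set V) f g x : open D -> D x ->
  (forall y, D y -> f y = g y) -> \forall y \near x, f y = g y.
Proof. by move=> oD Dx fg; apply: filterS (open_nbhs_nbhs (conj oD Dx)). Qed.

Lemma Ck_eq k (D : set V) f g : open D -> (forall y, D y -> f y = g y) ->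
  Ck k D f -> Ck k D g.
Proof.
move=> oD; elim: k f g => [|k IH] f g fg /=.
  move=> cf x Dx; have h := open_near oD Dx fg.
  have gx : g x = f x by rewrite (fg x Dx).
  change (g y @[y --> x] --> g x); rewrite gx; apply: cvg_trans (cf x Dx).
  by apply: near_eq_cvg; apply: filterS h => y ->.
move=> [df Df]; split=> [x Dx|v].
  exact: near_eq_differentiable (open_near oD Dx fg) (df x Dx).
apply: IH (Df v) => x Dx; apply: near_eq_derive.
exact: open_near oD Dx fg.
Qed.

Lemma smooth_eq (D : set V) f g : open D -> (forall y, D y -> f y = g y) ->
  smooth D f -> smooth D g.
Proof. by move=> oD fg sf k; apply: Ck_eq oD fg (sf k). Qed.

Lemma Ck_S k (D : set V) f : Ck k.+1 D f -> Ck k D f.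
Proof.
elim: k f => [|k IH] f /=; first by move=> [df _] x /df/differentiable_continuous.
by move=> [df Df]; split=> // v; apply: IH; apply: Df.
Qed.

Lemma smooth_diff (D : set V) f x : smooth D f -> D x -> differentiable f x.
Proof. by move=> /(_ 1%N) [df _]; apply: df. Qed.

Lemma smooth_derivable (D : set V) f x v : smooth D f -> D x -> derivable f x v.
Proof. by move=> sf Dx; apply: diff_derivable; apply: smooth_diff sf Dx. Qed.

Lemma smooth_cont (D : set V) f x : smooth D f -> D x -> {for x, continuous f}.
Proof. by move=> /(_ 0%N); apply. Qed.

Lemma smooth_derive (D : set V) f v : smooth D f -> smooth D (fun x => 'D_v f x).
Proof. by move=> sf k; have [_] := sf k.+1; apply. Qed.

Lemma CkD k (D : set V) f g : open D -> Ck k D f -> Ck k D g ->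
  Ck k D (fun x => f x + g x).
Proof.
move=> oD; elim: k f g => [|k IH] f g /=.
  by move=> cf cg x Dx; apply: continuousD; [exact: cf|exact: cg].
move=> [df Df] [dg Dg]; split=> [x Dx|v].
  by apply: differentiableD; [exact: df|exact: dg].
apply: Ck_eq oD _ (IH _ _ (Df v) (Dg v)) => x Dx.
by rewrite -deriveD//; apply: diff_derivable; [exact: df|exact: dg].
Qed.

Lemma smoothD (D : set V) f g : open D -> smooth D f -> smooth D g ->
  smooth D (fun x => f x + g x).
Proof. by move=> oD sf sg k; apply: CkD. Qed.

Lemma smooth_cst (D : set V) (c : W) : smooth D (fun=> c).
Proof.
move=> k; elim: k c => [|k IH] c /=; first by move=> x _; apply: cst_continuous.
split=> [x _|v]; first exact: differentiable_cst.
have -> : (fun x : V => 'D_v (fun=> c) x) = (fun=> 0) by apply/funext => x; rewrite derive_cst.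
exact: IH.
Qed.

Lemma smooth_sum (I : Type) (r : seq I) (P : pred I) (D : set V) (F : I -> V -> W) :
  open D -> (forall i, P i -> smooth D (F i)) ->
  smooth D (fun x => \sum_(i <- r | P i) F i x).
Proof.
move=> oD sF; elim: r => [|a r IH].
  have -> : (fun x => \sum_(i <- [::] | P i) F i x) = (fun=> 0).
    by apply/funext => x; rewrite big_nil.
  exact: smooth_cst.
have [Pa|Pa] := boolP (P a); last first.
  suff -> : (fun x => \sum_(i <- a :: r | P i) F i x) = (fun x => \sum_(i <- r | P i) F i x) by [].
  by apply/funext => x; rewrite big_cons (negbTE Pa).
have -> : (fun x => \sum_(i <- a :: r | P i) F i x) =
  (fun x => F a x + \sum_(i <- r | P i) F i x).
  by apply/funext => x; rewrite big_cons Pa.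
by apply: smoothD => //; apply: sF.
Qed.

End LocalDiff.

Section SmoothScalar.
Context {R : realType} {V : normedModType R}.
Implicit Types f g : V -> R.

Lemma CkM k (D : set V) f g : open D -> Ck k D f -> Ck k D g ->
  Ck k D (fun x => f x * g x).
Proof.
move=> oD; elim: k f g => [|k IH] f g.
  by move=> cf cg x Dx; apply: continuousM; [exact: cf|exact: cg].
move=> sf sg; have [df Df] := sf; have [dg Dg] := sg; split=> [x Dx|v].
  by apply: differentiableM; [exact: df|exact: dg].
(* The derivative of the product contains [f] and [g] undifferentiated, so both are lowered by one
   order to meet the induction hypothesis. *)
have h := CkD oD (IH _ _ (Ck_S sf) (Dg v)) (IH _ _ (Ck_S sg) (Df v)).
apply: Ck_eq oD _ h => x Dx.
by rewrite [RHS]deriveM//; apply: diff_derivable; [exact: df|exact: dg].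
Qed.

Lemma smoothM (D : set V) f g : open D -> smooth D f -> smooth D g ->
  smooth D (fun x => f x * g x).
Proof. by move=> oD sf sg k; apply: CkM. Qed.

Lemma smoothN (D : set V) f : open D -> smooth D f -> smooth D (fun x => - f x).
Proof.
move=> oD sf; have := smoothM oD (@smooth_cst R V R D (-1)) sf.
by apply: smooth_eq => // x _; rewrite mulN1r.
Qed.

Lemma smoothB (D : set V) f g : open D -> smooth D f -> smooth D g ->
  smooth D (fun x => f x - g x).
Proof. by move=> oD sf sg; apply: smoothD => //; apply: smoothN. Qed.

Lemma smooth_prod (I : Type) (r : seq I) (P : pred I) (D : set V) (F : I -> V -> R) :
  open D -> (forall i, P i -> smooth D (F i)) ->
  smooth D (fun x => \prod_(i <- r | P i) F i x).
Proof.
move=> oD sF; elim: r => [|a r IH].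
  have -> : (fun x => \prod_(i <- [::] | P i) F i x) = (fun=> 1).
    by apply/funext => x; rewrite big_nil.
  exact: smooth_cst.
have [Pa|Pa] := boolP (P a); last first.
  suff -> : (fun x => \prod_(i <- a :: r | P i) F i x) = (fun x => \prod_(i <- r | P i) F i x) by [].
  by apply/funext => x; rewrite big_cons (negbTE Pa).
have -> : (fun x => \prod_(i <- a :: r | P i) F i x) =
  (fun x => F a x * \prod_(i <- r | P i) F i x).
  by apply/funext => x; rewrite big_cons Pa.
by apply: smoothM => //; apply: sF.
Qed.

Lemma CkV k (D : set V) f : open D -> (forall x, D x -> f x != 0) ->
  Ck k D f -> Ck k D (fun x => (f x)^-1).
Proof.
move=> oD nz; elim: k f nz => [|k IH] f nz.
  by move=> cf x Dx; apply: continuousV; [exact: nz|exact: cf].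
move=> sf; have [df Df] := sf; split=> [x Dx|v].
  by apply: differentiableV; [exact: df|exact: nz].
have h1 := IH f nz (Ck_S sf).
(* The derivative is - f' / f^2, in which the inverse of [f] is needed only at order [k]. *)
have h := CkM oD (CkM oD h1 h1) (CkM oD (@smooth_cst R V R D (-1) k) (Df v)).
apply: Ck_eq oD _ h => x Dx.
rewrite deriveV; [|exact: nz|exact/diff_derivable/df].
by rewrite mulN1r mulrN scaleNr -invfM -expr2.
Qed.

Lemma smoothV (D : set V) f : open D -> (forall x, D x -> f x != 0) ->
  smooth D f -> smooth D (fun x => (f x)^-1).
Proof. by move=> oD nz sf k; apply: CkV. Qed.

End SmoothScalar.

(** * Symmetry of second derivatives *)

Section Young.
Context {R : realType}.

(* Young's form of the symmetry of second derivatives, which needs no second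
   derivative away from the origin. *)
Lemma young_half (Phi Phi1 : R -> R -> R) (a b r : R) : 0 < r ->
  (forall s t, `|s| < r -> `|t| < r -> is_derive s (1 : R) (Phi ^~ t) (Phi1 s t)) ->
  (forall e, 0 < e -> exists2 d, 0 < d & forall s t, `|s| < d -> `|t| < d ->
     `|Phi1 s t - Phi1 0 0 - s * a - t * b| <= e * (`|s| + `|t|)) ->
  forall e, 0 < e -> exists2 d, 0 < d & forall h, 0 < h -> h < d ->
    `|Phi h h - Phi 0 h - Phi h 0 + Phi 0 0 - h ^+ 2 * b| <= e * h ^+ 2.
Proof.
move=> r0 D1 T1 e e0.
(* The two expansion errors add up to e/3 times (c + h) + c with c < h, hence at most e h. *)
have [d d0 Hd] := T1 (e / 3%:R) (divr_gt0 e0 (ltr0n _ 3)).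
exists (Num.min d r); first by rewrite lt_min d0.
move=> h h0; rewrite lt_min => /andP[hd hr].
have habs : `|h| = h by rewrite gtr0_norm.
have dd : forall s, s \in `]0, h[ -> is_derive s (1 : R)
    (fun s => Phi s h - Phi s 0) (Phi1 s h - Phi1 s 0).
  move=> s; rewrite in_itv/= => /andP[s0 sh].
  have sr : `|s| < r by rewrite gtr0_norm// (lt_trans sh).
  have hD1 : is_derive s (1 : R) (Phi ^~ h) (Phi1 s h) by apply: D1; rewrite ?habs.
  have hD2 : is_derive s (1 : R) (Phi ^~ 0) (Phi1 s 0) by apply: D1; rewrite ?normr0.
  exact: is_deriveB hD1 hD2.
have cc : {within `[0, h], continuous (fun s => Phi s h - Phi s 0)}.
  apply: derivable_within_continuous => s; rewrite in_itv/= => /andP[s0 sh].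
  have sr : `|s| < r by rewrite ger0_norm// (le_lt_trans sh).
  have hD1 : is_derive s (1 : R) (Phi ^~ h) (Phi1 s h) by apply: D1; rewrite ?habs.
  have hD2 : is_derive s (1 : R) (Phi ^~ 0) (Phi1 s 0) by apply: D1; rewrite ?normr0.
  by have [] := is_deriveB hD1 hD2.
have [c /=] := MVT h0 dd cc.
rewrite in_itv/= => /andP[c0 ch] E; rewrite subr0 in E.
have cabs : `|c| = c by rewrite gtr0_norm.
have cd : `|c| < d by rewrite cabs (lt_trans ch).
have H1 := Hd c h cd; rewrite habs in H1; have {}H1 := H1 hd.
have H2 := Hd c 0 cd; rewrite normr0 in H2; have {}H2 := H2 d0.
rewrite cabs in H1 H2.
(* At the mean value point [c] the expansions of [Phi1] at (c, h) and (c, 0) share all terms but h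
   b. *)
have -> : Phi h h - Phi 0 h - Phi h 0 + Phi 0 0 - h ^+ 2 * b =
   ((Phi1 c h - Phi1 0 0 - c * a - h * b)
     - (Phi1 c 0 - Phi1 0 0 - c * a - 0 * b)) * h.
  have -> : Phi h h - Phi 0 h - Phi h 0 + Phi 0 0 =
    Phi h h - Phi h 0 - (Phi 0 h - Phi 0 0) by ring.
  by rewrite E; ring.
rewrite normrM habs expr2 mulrA ler_wpM2r ?(ltW h0)//.
apply: (le_trans (ler_normB _ _)); apply: (le_trans (lerD H1 H2)).
have e3 : 0 < e / 3%:R by rewrite divr_gt0.
have : e / 3%:R * (c + h) + e / 3%:R * (c + 0) <= e / 3%:R * (h + h + h).
  by rewrite -mulrDr ler_wpM2l ?(ltW e3)//; lra.
move=> /le_trans; apply; lra.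
Qed.

(** The second difference of [Phi] over the square of side h is symmetric in the two variables;
    [young_half] reads its h^2 coefficient as [a12] in one order and as [a21] in the other. *)
Lemma young (Phi Phi1 Phi2 : R -> R -> R) (a11 a12 a21 a22 r : R) : 0 < r ->
  (forall s t, `|s| < r -> `|t| < r -> is_derive s (1 : R) (Phi ^~ t) (Phi1 s t)) ->
  (forall s t, `|s| < r -> `|t| < r -> is_derive t (1 : R) (Phi s) (Phi2 s t)) ->
  (forall e, 0 < e -> exists2 d, 0 < d & forall s t, `|s| < d -> `|t| < d ->
     `|Phi1 s t - Phi1 0 0 - s * a11 - t * a12| <= e * (`|s| + `|t|)) ->
  (forall e, 0 < e -> exists2 d, 0 < d & forall s t, `|s| < d -> `|t| < d ->
     `|Phi2 s t - Phi2 0 0 - s * a21 - t * a22| <= e * (`|s| + `|t|)) ->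
  a12 = a21.
Proof.
move=> r0 D1 D2 T1 T2.
have H1 := young_half r0 D1 T1.
have H2 : forall e, 0 < e -> exists2 d, 0 < d & forall h, 0 < h -> h < d ->
    `|Phi h h - Phi h 0 - Phi 0 h + Phi 0 0 - h ^+ 2 * a21| <= e * h ^+ 2.
  apply: (@young_half (fun s t => Phi t s) (fun s t => Phi2 t s) a22 a21 r r0).
    by move=> s t sr tr; apply: D2.
  move=> e e0; have [d d0 Hd] := T2 e e0; exists d => // s t sd td.
  by rewrite -addrA [_ + `|t|]addrC -addrA [- (s * _) - _]addrC !addrA Hd.
apply/eqP; rewrite -subr_eq0 -normr_eq0 eq_le normr_ge0 andbT.
apply/ler_addgt0Pr => e e0; rewrite add0r.
have e2 : 0 < e / 2 by rewrite divr_gt0.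
have [d d0 Hd] := H1 _ e2; have [d' d'0 Hd'] := H2 _ e2.
pose h := Num.min d d' / 2.
have m0 : 0 < Num.min d d' by rewrite lt_min d0.
have h0 : 0 < h by rewrite divr_gt0.
have hm : h < Num.min d d' by rewrite /h; lra.
move: (hm); rewrite lt_min => /andP[hd hd'].
have {}Hd := Hd h h0 hd; have {}Hd' := Hd' h h0 hd'.
have h20 : 0 < h ^+ 2 by rewrite exprn_gt0.
rewrite -(ler_pM2r h20) -(gtr0_norm h20) -normrM (gtr0_norm h20).
have -> : (a12 - a21) * h ^+ 2 =
  (Phi h h - Phi h 0 - Phi 0 h + Phi 0 0 - h ^+ 2 * a21) -
  (Phi h h - Phi 0 h - Phi h 0 + Phi 0 0 - h ^+ 2 * a12) by ring.
apply: (le_trans (ler_normB _ _)); apply: (le_trans (lerD Hd' Hd)).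
lra.
Qed.

End Young.

Section Calculus.
Context {R : realType} {V : normedModType R}.

Lemma differentiable_expand (f : V -> R) x : differentiable f x ->
  forall e, 0 < e -> exists2 d, 0 < d & forall h : V, `|h| < d ->
    `|f (h + x) - f x - 'D_h f x| <= e * `|h|.
Proof.
move=> df e e0; have /diff_locallyP[_ /eqaddoP/(_ e e0)] := df.
move=> /nbhs_ballP[d /= d0 Hd]; exists d => // h hd.
have := Hd h; rewrite -ball_normE /= sub0r normrN => /(_ hd).
by rewrite (deriveE _ df) -[_ - _ - _]addrA -opprD.
Qed.

Lemma deriveDl (f : V -> R) x v w : differentiable f x ->
  'D_(v + w) f x = 'D_v f x + 'D_w f x.
Proof. by move=> df; rewrite !deriveE// linearD. Qed.

Lemma deriveZdir (f : V -> R) x c v : differentiable f x ->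
  'D_(c *: v) f x = c * 'D_v f x.
Proof. by move=> df; rewrite !deriveE// linearZ. Qed.

Lemma derive_line (f : V -> R) (a v : V) (s : R) :
  differentiable f (a + s *: v) ->
  is_derive s (1 : R) (fun t => f (a + t *: v)) ('D_v f (a + s *: v)).
Proof.
move=> df; have dl : is_diff s ((cst a : R -> V) + ( *:%R^~ v)) ((0 : R -> V) + ( *:%R^~ v)) by exact: is_diffD.
have dfs : is_diff (a + s *: v) f ('d f (a + s *: v)) by exact: differentiableP.
have dc := is_diff_comp dl dfs.
have dd : differentiable (f \o (fun t : R => a + t *: v)) s by have [] := dc.
apply: DeriveDef; first exact/diff_derivable/dd.
rewrite deriveE//; have [_ ->] := dc.
by rewrite /= add0r scale1r deriveE.
Qed.

(** Restrict [f] to the plane x + s v + t w and apply [young]; its expansion hypotheses are the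
    differentiability of the two first derivatives at the single point [x]. *)
Lemma derive_comm (D : set V) (f : V -> R) x v w : open D -> smooth D f -> D x ->
  'D_v (fun y => 'D_w f y) x = 'D_w (fun y => 'D_v f y) x.
Proof.
move=> oD sf Dx.
have [r r0 Hr] : exists2 r : R, 0 < r &
    forall s t, `|s| < r -> `|t| < r -> D (x + s *: v + t *: w).
  have /nbhs_ballP[e /= e0 He] : nbhs x D by apply: open_nbhs_nbhs.
  have p0 : 0 < `|v| + `|w| + 1 by rewrite ltr_wpDl// addr_ge0.
  exists (e / (`|v| + `|w| + 1)); first by rewrite divr_gt0.
  move=> s t; rewrite !ltr_pdivlMr// => sv tw; apply: He.
  rewrite -ball_normE /= -addrA opprD addNKr normrN.
  apply: (le_lt_trans (ler_normD _ _)); rewrite !normrZ.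
  have [st|ts] := leP `|s| `|t|.
    apply: le_lt_trans tw; rewrite -subr_ge0.
    have -> : `|t| * (`|v| + `|w| + 1) - (`|s| * `|v| + `|t| * `|w|) =
      (`|t| - `|s|) * `|v| + `|t| by ring.
    by rewrite addr_ge0// mulr_ge0// subr_ge0.
  apply: le_lt_trans sv; rewrite -subr_ge0.
  have -> : `|s| * (`|v| + `|w| + 1) - (`|s| * `|v| + `|t| * `|w|) =
      (`|s| - `|t|) * `|w| + `|s| by ring.
  by rewrite addr_ge0// mulr_ge0// subr_ge0 ltW.
have dline (h : V -> R) (s t : R) : smooth D h -> `|s| < r -> `|t| < r ->
    is_derive s (1 : R) (fun s => h (x + s *: v + t *: w)) ('D_v h (x + s *: v + t *: w)).
  move=> sh sr tr; have e s' : x + s' *: v + t *: w = x + t *: w + s' *: v by rewrite addrAC.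
  under eq_fun do rewrite e.
  by rewrite e; apply: derive_line; rewrite -e; apply: smooth_diff sh (Hr _ _ sr tr).
have expand (h : V -> R) : smooth D h -> forall e, 0 < e -> exists2 d, 0 < d &
    forall s t, `|s| < d -> `|t| < d ->
     `|h (x + s *: v + t *: w) - h (x + 0 *: v + 0 *: w) - s * 'D_v h x - t * 'D_w h x|
      <= e * (`|s| + `|t|).
  move=> sh e e0; have dh := smooth_diff sh Dx.
  pose C := `|v| + `|w| + 1.
  have C0 : 0 < C by rewrite ltr_wpDl// addr_ge0.
  have [d d0 Hd] := differentiable_expand dh (divr_gt0 e0 C0).
  exists (d / C); first exact: divr_gt0.
  move=> s t; rewrite !ltr_pdivlMr// => sv tw.
  have bnd : `|s *: v + t *: w| <= C * (`|s| + `|t|).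
    apply: (le_trans (ler_normD _ _)); rewrite !normrZ -subr_ge0.
    have -> : C * (`|s| + `|t|) - (`|s| * `|v| + `|t| * `|w|) =
      `|s| * (`|w| + 1) + `|t| * (`|v| + 1) by rewrite /C; ring.
    by rewrite addr_ge0// mulr_ge0// addr_ge0.
  have hd : `|s *: v + t *: w| < d.
    apply: (le_lt_trans (ler_normD _ _)); rewrite !normrZ.
    have [st|ts] := leP `|s| `|t|.
      apply: le_lt_trans tw; rewrite -subr_ge0.
      have -> : `|t| * C - (`|s| * `|v| + `|t| * `|w|) =
        (`|t| - `|s|) * `|v| + `|t| by rewrite /C; ring.
      by rewrite addr_ge0// mulr_ge0// subr_ge0.
    apply: le_lt_trans sv; rewrite -subr_ge0.
    have -> : `|s| * C - (`|s| * `|v| + `|t| * `|w|) =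
        (`|s| - `|t|) * `|w| + `|s| by rewrite /C; ring.
    by rewrite addr_ge0// mulr_ge0// subr_ge0 ltW.
  have H := Hd _ hd; rewrite deriveDl// !deriveZdir// in H.
  have -> : x + s *: v + t *: w = s *: v + t *: w + x by rewrite -addrA addrC.
  rewrite !scale0r !addr0; apply: (le_trans (y := e / C * `|s *: v + t *: w|)).
    by move: H; rewrite opprD addrA.
  by rewrite -mulrA ler_pM2l// mulrC ler_pdivrMr// mulrC.
pose Phi s t := f (x + s *: v + t *: w).
pose Phi1 s t := 'D_v f (x + s *: v + t *: w).
pose Phi2 s t := 'D_w f (x + s *: v + t *: w).
apply/esym; apply: (@young R Phi Phi1 Phi2 _ _ _ _ r r0).
- by move=> s t sr tr; apply: dline.
- by move=> s t sr tr; apply: derive_line; apply: smooth_diff sf (Hr _ _ sr tr).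
- exact: (expand _ (smooth_derive v sf)).
- exact: (expand _ (smooth_derive w sf)).
Qed.

End Calculus.

(** * Chain rule and smoothness of compositions *)

Section Composition.
Context {R : realType} {V : normedModType R}.

Lemma derive_comp {W : normedModType R} (f : W -> R) (u : V -> W) x v :
  differentiable u x -> differentiable f (u x) ->
  'D_v (fun y => f (u y)) x = 'D_('D_v u x) f (u x).
Proof.
move=> du df; rewrite [RHS]deriveE// (deriveE _ du) deriveE; last exact: differentiable_comp.
by rewrite -[fun y => f (u y)]/(f \o u) diff_comp.
Qed.

Lemma derive_rV n (f : 'rV[R]_n -> R) p w : differentiable f p ->
  'D_w f p = \sum_i w 0 i * 'D_(delta_mx 0 i) f p.
Proof.
move=> df; rewrite deriveE// {1}[w]row_sum_delta linear_sum.
by apply: eq_bigr => i _; rewrite linearZ deriveE.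
Qed.

Lemma differentiable_mx m n (A : V -> 'M[R]_(m, n)) x :
  (forall i j, differentiable (fun y => A y i j) x) -> differentiable A x.
Proof.
move=> dA; have -> : A = \sum_i \sum_j (fun y => A y i j *: delta_mx i j).
  apply/funext => y; rewrite fct_sumE [LHS]matrix_sum_delta.
  by apply: eq_bigr => i _; rewrite fct_sumE.
apply: differentiable_sum => i; apply: differentiable_sum => j.
exact: differentiableZl.
Qed.

Lemma derive_mxE m n (A : V -> 'M[R]_(m, n)) x v i j :
  differentiable A x -> ('D_v A x) i j = 'D_v (fun y => A y i j) x.
Proof. by move=> dA; rewrite derive_mx ?mxE//; apply: diff_derivable. Qed.

Lemma differentiable_mx_coord m n (A : V -> 'M[R]_(m, n)) x i j :
  differentiable A x -> differentiable (fun y => A y i j) x.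
Proof.
move=> dA; apply: (@differentiable_comp _ _ _ _ A (fun M : 'M[R]_(m, n) => M i j)) => //.
exact: differentiable_coord.
Qed.

Lemma Ck_coord k (D : set V) m n (A : V -> 'M[R]_(m, n)) i j : open D ->
  Ck k D A -> Ck k D (fun x => A x i j).
Proof.
move=> oD; elim: k A => [|k IH] A.
  move=> cA x Dx; apply: (@continuous_comp _ _ _ A (fun M : 'M[R]_(m, n) => M i j)).
    exact: cA.
  exact: coord_continuous.
move=> [dA DA]; split=> [x Dx|v]; first exact/differentiable_mx_coord/dA.
apply: Ck_eq oD _ (IH _ (DA v)) => x Dx.
by rewrite derive_mxE//; apply: dA.
Qed.

Lemma Ck_mx k (D : set V) m n (A : V -> 'M[R]_(m, n)) : open D ->
  (forall i j, smooth D (fun x => A x i j)) -> Ck k D A.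
Proof.
move=> oD; elim: k A => [|k IH] A sA.
  move=> x Dx; apply/differentiable_continuous/differentiable_mx => i j.
  exact: smooth_diff (sA i j) Dx.
have dA x : D x -> differentiable A x.
  by move=> Dx; apply: differentiable_mx => i j; exact: smooth_diff (sA i j) Dx.
split=> // v; apply: IH => i j.
apply: smooth_eq oD _ (smooth_derive v (sA i j)) => x Dx.
by rewrite derive_mxE//; apply: dA.
Qed.

Lemma smooth_mxP (D : set V) m n (A : V -> 'M[R]_(m, n)) : open D ->
  smooth D A <-> (forall i j, smooth D (fun x => A x i j)).
Proof.
move=> oD; split=> [sA i j k|sA k]; first exact: Ck_coord.
exact: Ck_mx.
Qed.

Lemma smooth_comp n (D : set V) (E : set 'rV[R]_n) (f : 'rV[R]_n -> R) (u : V -> 'rV[R]_n) :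
  open D -> (forall x, D x -> E (u x)) -> smooth E f ->
  (forall j, smooth D (fun x => u x 0 j)) -> smooth D (fun x => f (u x)).
Proof.
move=> oD DE sf su k; elim: k f sf => [|k IH] f sf.
  move=> x Dx; apply: (@continuous_comp _ _ _ u f).
    have cu : Ck 0 D u by apply: Ck_mx => // i j; rewrite (ord1 i); apply: su.
    exact: cu.
  exact: (sf 0%N _ (DE _ Dx)).
have du x : D x -> differentiable u x.
  move=> Dx; apply: differentiable_mx => i j; rewrite (ord1 i).
  exact: smooth_diff (su j) Dx.
have df x : D x -> differentiable f (u x).
  by move=> Dx; apply: smooth_diff sf (DE _ Dx).
split=> [x Dx|v].
  by apply: (@differentiable_comp _ _ _ _ u f); [exact: du|exact: df].
have h : Ck k D (fun x => \sum_i 'D_v (fun y => u y 0 i) x * 'D_(delta_mx 0 i) f (u x)).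
  have -> : (fun x => \sum_i 'D_v (fun y => u y 0 i) x * 'D_(delta_mx 0 i) f (u x))
    = \sum_i (fun x => 'D_v (fun y => u y 0 i) x * 'D_(delta_mx 0 i) f (u x)).
    by apply/funext => x; rewrite fct_sumE.
  elim/big_ind: _ => [|F G hF hG|i _]; first exact: smooth_cst.
    exact: CkD oD hF hG.
  exact: (CkM oD (smooth_derive v (su i) k) (IH _ (smooth_derive _ sf))).
apply: Ck_eq oD _ h => x Dx.
rewrite (@derive_comp _ f u)//; [|exact: du|exact: df].
rewrite derive_rV; last exact: df.
by apply: eq_bigr => i _; rewrite derive_mxE//; apply: du.
Qed.

(* the derivatives of an affine map do not depend on the point *)
Lemma smooth_affine {W : normedModType R} (D : set V) (E : set W) (f : W -> R)
    (a : V -> W) (L : V -> W) : open D ->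
  (forall x, differentiable a x) -> (forall v x, 'D_v a x = L v) ->
  (forall x, D x -> E (a x)) -> smooth E f -> smooth D (fun x => f (a x)).
Proof.
move=> oD da Da DE sf k; elim: k f sf => [|k IH] f sf.
  move=> x Dx; apply: (@continuous_comp _ _ _ a f).
    exact/differentiable_continuous.
  exact: (sf 0%N _ (DE _ Dx)).
have df x : D x -> differentiable f (a x).
  by move=> Dx; apply: smooth_diff sf (DE _ Dx).
split=> [x Dx|v]; first by apply: (@differentiable_comp _ _ _ _ a f) => //; exact: df.
apply: Ck_eq oD _ (IH _ (smooth_derive (L v) sf)) => x Dx.
by rewrite (@derive_comp _ f a)// ?Da//; apply: df.
Qed.

End Composition.

(** * Matrix-valued functions *)

(** Locked so that matrix computations never unfold into entrywise derivatives; [dmxE] is the way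
    in. *)
HB.lock Definition dmx {R : realType} {V : normedModType R} {m n} (v : V)
    (A : V -> 'M[R]_(m, n)) (x : V) : 'M[R]_(m, n) :=
  \matrix_(i, j) 'D_v (fun y => A y i j) x.

Section MatrixCalculus.
Context {R : realType} {V : normedModType R} (D : set V) (oD : open D).

Lemma dmxE m n v (A : V -> 'M[R]_(m, n)) x i j :
  dmx v A x i j = 'D_v (fun y => A y i j) x.
Proof. by rewrite dmx.unlock mxE. Qed.

(** Entrywise smoothness reduces matrix algebra to scalar functions; [smooth_mxP] identifies it with
    [smooth]. *)
Definition msmooth {m n} (A : V -> 'M[R]_(m, n)) : Prop :=
  forall i j, smooth D (fun x => A x i j).

Lemma msmooth_eq m n (A B : V -> 'M[R]_(m, n)) :
  (forall x, D x -> A x = B x) -> msmooth A -> msmooth B.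
Proof. by move=> AB sA i j; apply: smooth_eq oD _ (sA i j) => x Dx; rewrite AB. Qed.

Lemma msmooth_cst m n (A : 'M[R]_(m, n)) : msmooth (fun=> A).
Proof. by move=> i j; apply: smooth_cst. Qed.

Lemma msmoothD m n (A B : V -> 'M[R]_(m, n)) :
  msmooth A -> msmooth B -> msmooth (fun x => A x + B x).
Proof.
move=> sA sB i j; apply: smooth_eq oD _ (smoothD oD (sA i j) (sB i j)).
by move=> x _; rewrite mxE.
Qed.

Lemma msmoothN m n (A : V -> 'M[R]_(m, n)) : msmooth A -> msmooth (fun x => - A x).
Proof.
move=> sA i j; apply: smooth_eq oD _ (smoothN oD (sA i j)).
by move=> x _; rewrite mxE.
Qed.

Lemma msmoothB m n (A B : V -> 'M[R]_(m, n)) :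
  msmooth A -> msmooth B -> msmooth (fun x => A x - B x).
Proof. by move=> sA sB; apply: msmoothD => //; apply: msmoothN. Qed.

Lemma msmoothZ m n (f : V -> R) (A : V -> 'M[R]_(m, n)) :
  smooth D f -> msmooth A -> msmooth (fun x => f x *: A x).
Proof.
move=> sf sA i j; apply: smooth_eq oD _ (smoothM oD sf (sA i j)).
by move=> x _; rewrite mxE.
Qed.

Lemma msmoothM m n p (A : V -> 'M[R]_(m, n)) (B : V -> 'M[R]_(n, p)) :
  msmooth A -> msmooth B -> msmooth (fun x => A x *m B x).
Proof.
move=> sA sB i j; have : smooth D (fun x => \sum_k A x i k * B x k j).
  by apply: smooth_sum => // k _; apply: smoothM.
by apply: smooth_eq => // x _; rewrite mxE.
Qed.

Lemma msmooth_tr m n (A : V -> 'M[R]_(m, n)) : msmooth A -> msmooth (fun x => (A x)^T).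
Proof.
by move=> sA i j; apply: smooth_eq oD _ (sA j i) => x _; rewrite mxE.
Qed.

Lemma msmooth_sum m n (I : Type) (r : seq I) (P : pred I) (F : I -> V -> 'M[R]_(m, n)) :
  (forall i, msmooth (F i)) -> msmooth (fun x => \sum_(i <- r | P i) F i x).
Proof.
move=> sF i j; have : smooth D (fun x => \sum_(k <- r | P k) F k x i j).
  by apply: smooth_sum => // k _; apply: sF.
by apply: smooth_eq => // x _; rewrite summxE.
Qed.

Lemma smooth_det n (A : V -> 'M[R]_n) : msmooth A -> smooth D (fun x => \det (A x)).
Proof.
move=> sA; apply: smooth_sum => // s _; apply: smoothM => //; first exact: smooth_cst.
by apply: smooth_prod.
Qed.

Lemma msmooth_adj n (A : V -> 'M[R]_n) : msmooth A -> msmooth (fun x => \adj (A x)).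
Proof.
move=> sA i j; have : smooth D (fun x => (-1) ^+ (j + i) * \det (row' j (col' i (A x)))).
  apply: smoothM => //; first exact: smooth_cst.
  apply: smooth_det => a b.
  by apply: smooth_eq oD _ (sA (lift j a) (lift i b)) => x _; rewrite !mxE.
by apply: smooth_eq => // x _; rewrite mxE.
Qed.

Lemma msmooth_inv n (A : V -> 'M[R]_n) : (forall x, D x -> A x \in unitmx) ->
  msmooth A -> msmooth (fun x => invmx (A x)).
Proof.
move=> uA sA.
have nz x : D x -> \det (A x) != 0 by move=> /uA; rewrite unitmxE unitfE.
have := msmoothZ (smoothV oD nz (smooth_det sA)) (msmooth_adj sA).
by apply: msmooth_eq => x /uA Ax; rewrite /invmx Ax.
Qed.

Lemma msmooth_dmx m n v (A : V -> 'M[R]_(m, n)) : msmooth A -> msmooth (dmx v A).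
Proof.
move=> sA i j; apply: smooth_eq oD _ (smooth_derive v (sA i j)).
by move=> y _; rewrite dmxE.
Qed.

Variables (x : V) (Dx : D x).

Lemma mderivable m n (A : V -> 'M[R]_(m, n)) v i j : msmooth A ->
  derivable (fun y => A y i j) x v.
Proof. by move=> sA; apply: smooth_derivable (sA i j) Dx. Qed.

Lemma dmx_eq m n v (A B : V -> 'M[R]_(m, n)) :
  (forall y, D y -> A y = B y) -> dmx v A x = dmx v B x.
Proof.
move=> AB; apply/matrixP => i j; rewrite ?dmxE ?mxE ?dmxE; apply: near_eq_derive.
by apply: open_near oD Dx _ => y Dy; rewrite AB.
Qed.

Lemma dmx_cst m n v (A : 'M[R]_(m, n)) : dmx v (fun=> A) x = 0.
Proof. by apply/matrixP => i j; rewrite ?dmxE ?mxE ?dmxE derive_cst. Qed.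

Lemma dmxD m n v (A B : V -> 'M[R]_(m, n)) : msmooth A -> msmooth B ->
  dmx v (fun y => A y + B y) x = dmx v A x + dmx v B x.
Proof.
move=> sA sB; apply/matrixP => i j; rewrite ?dmxE ?mxE ?dmxE.
under eq_fun do rewrite mxE.
by rewrite deriveD//; exact: mderivable.
Qed.

Lemma dmxN m n v (A : V -> 'M[R]_(m, n)) : msmooth A ->
  dmx v (fun y => - A y) x = - dmx v A x.
Proof.
move=> sA; apply/matrixP => i j; rewrite ?dmxE ?mxE ?dmxE.
under eq_fun do rewrite mxE.
by rewrite deriveN//; exact: mderivable.
Qed.

Lemma dmxB m n v (A B : V -> 'M[R]_(m, n)) : msmooth A -> msmooth B ->
  dmx v (fun y => A y - B y) x = dmx v A x - dmx v B x.
Proof. by move=> sA sB; rewrite dmxD ?dmxN//; apply: msmoothN. Qed.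

Lemma deriveMs v (f g : V -> R) : smooth D f -> smooth D g ->
  'D_v (fun y => f y * g y) x = 'D_v f x * g x + f x * 'D_v g x.
Proof.
move=> sf sg; rewrite [LHS](@deriveM _ _ f g x v); last 2 first.
- exact: smooth_derivable sf Dx.
- exact: smooth_derivable sg Dx.
by rewrite addrC [_ * g x]mulrC.
Qed.

Lemma derive_sums v (I : Type) (r : seq I) (P : pred I) (F : I -> V -> R) :
  (forall i, smooth D (F i)) ->
  'D_v (fun y => \sum_(i <- r | P i) F i y) x = \sum_(i <- r | P i) 'D_v (F i) x.
Proof.
move=> sF; elim: r => [|a r IH].
  by under eq_fun do rewrite big_nil; rewrite big_nil derive_cst.
under eq_fun do rewrite big_cons; rewrite big_cons; case: (P a) => //.
rewrite -IH deriveD//; first exact: smooth_derivable (sF a) Dx.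
by apply: smooth_derivable Dx; apply: smooth_sum.
Qed.

Lemma dmxZ m n v (f : V -> R) (A : V -> 'M[R]_(m, n)) : smooth D f -> msmooth A ->
  dmx v (fun y => f y *: A y) x = 'D_v f x *: A x + f x *: dmx v A x.
Proof.
move=> sf sA; apply/matrixP => i j; rewrite ?dmxE ?mxE ?dmxE.
by under eq_fun do rewrite mxE; rewrite deriveMs.
Qed.

Lemma dmxM m n p v (A : V -> 'M[R]_(m, n)) (B : V -> 'M[R]_(n, p)) :
  msmooth A -> msmooth B ->
  dmx v (fun y => A y *m B y) x = dmx v A x *m B x + A x *m dmx v B x.
Proof.
move=> sA sB; apply/matrixP => i j; rewrite ?dmxE ?mxE ?dmxE.
under eq_fun do rewrite mxE.
rewrite derive_sums => [|k]; last exact: smoothM.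
rewrite -big_split; apply: eq_bigr => k _ /=.
by rewrite deriveMs// !dmxE.
Qed.

Lemma dmx_tr m n v (A : V -> 'M[R]_(m, n)) : dmx v (fun y => (A y)^T) x = (dmx v A x)^T.
Proof. by apply/matrixP => i j; rewrite ?dmxE ?mxE ?dmxE; under eq_fun do rewrite mxE. Qed.

Lemma dmx_sum m n v (I : Type) (r : seq I) (P : pred I) (F : I -> V -> 'M[R]_(m, n)) :
  (forall i, msmooth (F i)) ->
  dmx v (fun y => \sum_(i <- r | P i) F i y) x = \sum_(i <- r | P i) dmx v (F i) x.
Proof.
move=> sF; apply/matrixP => i j; rewrite summxE dmxE.
under eq_fun do rewrite summxE.
by rewrite derive_sums => [|k]; [apply: eq_bigr => k _; rewrite dmxE|exact: sF].
Qed.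

Lemma dmx_inv n v (A : V -> 'M[R]_n) : (forall y, D y -> A y \in unitmx) -> msmooth A ->
  dmx v (fun y => invmx (A y)) x = - (invmx (A x) *m dmx v A x *m invmx (A x)).
Proof.
move=> uA sA; have sI := msmooth_inv uA sA.
have : dmx v (fun y => A y *m invmx (A y)) x = 0.
  rewrite -[RHS](dmx_cst v (1%:M : 'M[R]_n)); apply: dmx_eq => y Dy.
  by rewrite mulmxV ?uA.
rewrite dmxM// => /(congr1 (mulmx (invmx (A x)))).
rewrite mulmx0 mulmxDr !mulmxA mulVmx ?uA// mul1mx => /eqP.
by rewrite addr_eq0 => /eqP ->; rewrite opprK.
Qed.

Lemma dmx_comm m n v w (A : V -> 'M[R]_(m, n)) : msmooth A ->
  dmx v (dmx w A) x = dmx w (dmx v A) x.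
Proof.
move=> sA; apply/matrixP => i j; rewrite [LHS]dmxE [RHS]dmxE.
under eq_fun do rewrite dmxE.
under [in RHS]eq_fun do rewrite dmxE.
exact: derive_comm oD (sA i j) Dx.
Qed.

End MatrixCalculus.

Lemma dmx_comp {R : realType} {V : normedModType R} n m p (D : set V)
    (U : set 'rV[R]_n) (A : 'rV[R]_n -> 'M[R]_(m, p)) (u : V -> 'rV[R]_n) x v :
  open D -> (forall y, D y -> U (u y)) -> msmooth U A -> msmooth D u -> D x ->
  dmx v (fun y => A (u y)) x = dmx (dmx v u x) A (u x).
Proof.
move=> oD DU sA su Dx.
have du : differentiable u x.
  by apply: differentiable_mx => i j; apply: smooth_diff (su i j) Dx.
apply/matrixP => i j; rewrite ?dmxE ?mxE ?dmxE.
rewrite (@derive_comp _ _ _ (fun q => A q i j) u)//; last exact: smooth_diff (sA i j) (DU _ Dx).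
congr ('D_ _ _ _); apply/matrixP => a b; rewrite dmxE derive_mxE//.
Qed.

Local Notation dm k A := (dmx (delta_mx 0 k) A).

Lemma trmx_add (R : nmodType) m n (A B : 'M[R]_(m, n)) : (A + B)^T = A^T + B^T.
Proof. by apply/matrixP => i j; rewrite !mxE. Qed.

Lemma trmx_scale (R : pzSemiRingType) m n (c : R) (A : 'M[R]_(m, n)) : (c *: A)^T = c *: A^T.
Proof. by apply/matrixP => i j; rewrite !mxE. Qed.
Lemma trmx_opp (R : zmodType) m n (A : 'M[R]_(m, n)) : (- A)^T = - A^T.
Proof. by apply/matrixP => i j; rewrite !mxE. Qed.

(** * Connections and Hessians *)

Section Connection.
Context {R : realType} {n : nat} (U : set 'rV[R]_n) (oU : open U).
Notation point := 'rV[R]_n.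
Implicit Types (g : point -> 'M[R]_n) (Gm : 'I_n -> point -> 'M[R]_n).

Lemma pd_comm (f : point -> R) k l u : U u -> smooth U f ->
  pd k (fun p => pd l f p) u = pd l (fun p => pd k f p) u.
Proof. by move=> Uu sf; apply: derive_comm oU sf Uu. Qed.

Definition ecol (k : 'I_n) : 'cV[R]_n := delta_mx k 0.

Lemma mul_ecol m (A : 'M[R]_(m, n)) k i : (A *m ecol k) i 0 = A i k.
Proof. by rewrite /ecol -colE mxE. Qed.

Lemma eq_ecol m (A B : 'M[R]_(m, n)) : (forall k, A *m ecol k = B *m ecol k) -> A = B.
Proof.
by move=> AB; apply/matrixP => i k; rewrite -!mul_ecol AB.
Qed.

(** Every column of [Z] is differentiated as a vector field, with no correction for lower indices. A
    Codazzi equation for an affinor is therefore stated on its columns: for a torsion-free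
    connection the missing Christoffel term is symmetric in the two lower indices and cancels. *)
Definition cov {m} Gm (k : 'I_n) (Z : point -> 'M[R]_(n, m)) u : 'M[R]_(n, m) :=
  dm k Z u + Gm k u *m Z u.

Definition conn_curv Gm (k l : 'I_n) u : 'M[R]_n :=
  dm k (Gm l) u - dm l (Gm k) u + Gm k u *m Gm l u - Gm l u *m Gm k u.

Lemma msmooth_cov m Gm k (Z : point -> 'M[R]_(n, m)) :
  msmooth U (Gm k) -> msmooth U Z -> msmooth U (cov Gm k Z).
Proof.
move=> sG sZ; apply: msmoothD => //; last exact: msmoothM.
exact: msmooth_dmx.
Qed.

Lemma cov_eq m Gm k (Y Z : point -> 'M[R]_(n, m)) u : U u ->
  (forall p, U p -> Y p = Z p) -> cov Gm k Y u = cov Gm k Z u.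
Proof. by move=> Uu YZ; rewrite /cov (dmx_eq oU Uu _ YZ) YZ. Qed.

Lemma covB m Gm k (Y Z : point -> 'M[R]_(n, m)) u : U u -> msmooth U Y -> msmooth U Z ->
  cov Gm k (fun p => Y p - Z p) u = cov Gm k Y u - cov Gm k Z u.
Proof. by move=> Uu sY sZ; rewrite /cov (dmxB oU Uu)// mulmxBr opprD addrACA. Qed.

Lemma covZ m Gm k (f : point -> R) (Z : point -> 'M[R]_(n, m)) u : U u ->
  smooth U f -> msmooth U Z ->
  cov Gm k (fun p => f p *: Z p) u = pd k f u *: Z u + f u *: cov Gm k Z u.
Proof.
by move=> Uu sf sZ; rewrite /cov (dmxZ Uu)// -scalemxAr scalerDr addrA.
Qed.

Lemma cov_mulr m p Gm k (Z : point -> 'M[R]_(n, m)) (C : 'M[R]_(m, p)) u : U u ->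
  msmooth U Z -> cov Gm k (fun q => Z q *m C) u = cov Gm k Z u *m C.
Proof.
move=> Uu sZ; rewrite /cov (dmxM oU Uu)//; last exact: msmooth_cst.
by rewrite (dmx_cst _ _ C) mulmx0 addr0 mulmxDl mulmxA.
Qed.

(** The Ricci identity, for an arbitrary connection matrix. *)
Lemma cov_comm m Gm k l (Z : point -> 'M[R]_(n, m)) u : U u ->
  (forall j, msmooth U (Gm j)) -> msmooth U Z ->
  cov Gm k (cov Gm l Z) u - cov Gm l (cov Gm k Z) u = conn_curv Gm k l u *m Z u.
Proof.
move=> Uu sG sZ; have sd j : msmooth U (dmx (delta_mx 0 j) Z) by exact: msmooth_dmx.
have sM j : msmooth U (fun p => Gm j p *m Z p) by exact: msmoothM.
rewrite /cov !(dmxD Uu)// !(dmxM oU Uu)// (dmx_comm oU Uu)//.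
rewrite /conn_curv !mulmxDr !mulmxDl !mulNmx !mulmxA.
set a1 := dmx _ (dmx _ Z) u; set a2 := dmx _ (Gm l) u *m Z u.
set a3 := Gm l u *m dmx _ Z u; set a4 := Gm k u *m dmx _ Z u.
set a5 := _ *m _ *m _; set a6 := dmx _ (Gm k) u *m Z u; set a7 := _ *m _ *m _.
move: a1 a2 a3 a4 a5 a6 a7 => a1 a2 a3 a4 a5 a6 a7.
by apply/matrixP => i j; rewrite !mxE; ring.
Qed.

(** Gauge covariance of the curvature. It is read off the Ricci identity for the constant frame 1,
    whose covariant derivatives for [Gm'] are [ki] times those of [kk] for [Gm]; no derivative of
    [ki] has to be expanded. *)
Lemma conn_curvE Gm Gm' k l (kk ki : point -> 'M[R]_n) u : U u ->
  (forall j, msmooth U (Gm j)) -> (forall j, msmooth U (Gm' j)) ->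
  msmooth U kk -> (forall p, U p -> ki p *m kk p = 1%:M) -> msmooth U ki ->
  (forall j p, U p -> Gm' j p = ki p *m cov Gm j kk p) ->
  conn_curv Gm' k l u = ki u *m conn_curv Gm k l u *m kk u.
Proof.
move=> Uu sG sG' sk kik ski Gm'E.
have gauge m (Z : point -> 'M[R]_(n, m)) j p : U p -> msmooth U Z ->
    cov Gm' j Z p = ki p *m cov Gm j (fun q => kk q *m Z q) p.
  move=> Up sZ; rewrite /cov Gm'E// /cov (dmxM oU Up)//.
  rewrite !mulmxDr !mulmxDl !mulmxA kik// mul1mx.
  by rewrite -!addrA addrCA.
have s1 : msmooth U (fun _ : point => 1%:M : 'M[R]_n) by exact: msmooth_cst.
have kki p : U p -> kk p *m ki p = 1%:M by move=> Up; apply: mulmx1C; exact: kik.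
have sc j : msmooth U (cov Gm' j (fun=> 1%:M : 'M[R]_n)) by exact: msmooth_cov.
have twice i j : cov Gm' i (cov Gm' j (fun=> 1%:M : 'M[R]_n)) u =
    ki u *m cov Gm i (cov Gm j kk) u.
  rewrite gauge//; congr (_ *m _); apply: cov_eq => // p Up.
  rewrite gauge// mulmxA kki// mul1mx; apply: cov_eq => // q Uq.
  by rewrite mulmx1.
have := cov_comm k l Uu sG' s1; rewrite mulmx1 => <-.
by rewrite !twice -mulmxBr cov_comm// mulmxA.
Qed.

Lemma cov_gauge m Gm Gm' (kk ki : point -> 'M[R]_n) j (Z : point -> 'M[R]_(n, m)) p : U p ->
  msmooth U kk -> ki p *m kk p = 1%:M -> Gm' j p = ki p *m cov Gm j kk p ->
  msmooth U Z -> cov Gm' j Z p = ki p *m cov Gm j (fun q => kk q *m Z q) p.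
Proof.
move=> Up sk kik Gm'E sZ; rewrite /cov Gm'E// /cov (dmxM oU Up)//.
rewrite !mulmxDr !mulmxDl !mulmxA kik// mul1mx.
by rewrite -!addrA addrCA.
Qed.

End Connection.

Section LeviCivita.
Context {R : realType} {n : nat} (U : set 'rV[R]_n) (oU : open U).
Notation point := 'rV[R]_n.
Context (g : point -> 'M[R]_n) (mg : metric U g).
Notation G := (fun p => invmx (g p)).

Definition Gam (h : point -> 'M[R]_n) (k : 'I_n) u : 'M[R]_n :=
  \matrix_(i, j) christoffel h u i k j.

Lemma metric_msmooth : msmooth U g. Proof. by case: mg. Qed.
Lemma metric_sym u : U u -> (g u)^T = g u. Proof. by case: mg => _ + _; apply. Qed.
Lemma metric_unit u : U u -> g u \in unitmx. Proof. by case: mg => _ _; apply. Qed.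
Lemma metric_inv_msmooth : msmooth U G.
Proof. exact: (msmooth_inv oU (@metric_unit) metric_msmooth). Qed.
Lemma metric_inv_sym u : U u -> (invmx (g u))^T = invmx (g u).
Proof. by move=> Uu; rewrite trmx_inv metric_sym. Qed.

(* the Christoffel symbols of the first kind, [kj, m] *)
Definition lowGam k u : 'M[R]_n := 2^-1 *: \matrix_(m, j)
  (dm k G u m j + dm j G u m k - dm m G u k j).

Lemma lowGamE k u m j : lowGam k u m j =
  2^-1 * (dm k G u m j + dm j G u m k - dm m G u k j).
Proof. by rewrite /lowGam [LHS]mxE [X in _ * X]mxE. Qed.

Lemma Gam_low k u : Gam g k u = g u *m lowGam k u.
Proof.
apply/matrixP => i j; rewrite /lowGam -scalemxAr !mxE /christoffel; congr (_ * _).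
by apply: eq_bigr => m _; rewrite [X in _ = _ * X]mxE !dmxE.
Qed.

Lemma msmooth_Gam k : msmooth U (Gam g k).
Proof.
have s := metric_inv_msmooth.
have sl : msmooth U (lowGam k).
  apply: (@msmoothZ _ _ _ oU _ _ (fun=> 2^-1)); first exact: smooth_cst.
  move=> i j; have sd a b c : smooth U (fun u => dm a G u b c) by exact: msmooth_dmx.
  apply: smooth_eq oU _ (smoothB oU (smoothD oU (sd k i j) (sd j i k)) (sd i k j)).
  by move=> u _; rewrite [RHS]mxE.
apply: (msmooth_eq oU _ (msmoothM oU metric_msmooth sl)) => u _.
by rewrite Gam_low.
Qed.

Lemma dm_inv_sym k u i j : U u -> dm k G u i j = dm k G u j i.
Proof.
move=> Uu; suff E : dm k G u = (dm k G u)^T by rewrite {1}E [LHS]mxE.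
rewrite -dmx_tr; apply: (dmx_eq oU Uu) => p Up.
by rewrite metric_inv_sym.
Qed.

Lemma Gam_sym k l u : U u -> Gam g k u *m ecol l = Gam g l u *m ecol k.
Proof.
move=> Uu; rewrite !Gam_low -!mulmxA; congr (_ *m _).
apply/matrixP => i j; rewrite (ord1 j) !mul_ecol !lowGamE (dm_inv_sym i l k Uu).
by rewrite [dm k _ _ _ _ + _]addrC.
Qed.

Lemma dm_metric_inv k u : U u -> dm k G u = (Gam g k u)^T *m invmx (g u) + invmx (g u) *m Gam g k u.
Proof.
move=> Uu; rewrite Gam_low trmx_mul metric_sym// -mulmxA mulmxV ?metric_unit// mulmx1.
rewrite mulmxA mulVmx ?metric_unit// mul1mx.
apply/matrixP => i j; rewrite [RHS]mxE [X in _ = X + _]mxE !lowGamE.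
rewrite (dm_inv_sym k j i Uu) (dm_inv_sym i j k Uu) (dm_inv_sym j i k Uu).
by field.
Qed.

Lemma dm_metric k u : U u -> dm k g u = - (Gam g k u *m g u + g u *m (Gam g k u)^T).
Proof.
move=> Uu; have := dm_metric_inv k Uu.
rewrite (dmx_inv oU Uu _ (@metric_unit) metric_msmooth).
move=> /(congr1 (fun X => - (g u *m X *m g u))).
rewrite mulmxN mulNmx opprK !mulmxA mulmxV ?metric_unit// mul1mx.
rewrite -mulmxA mulVmx ?metric_unit// mulmx1 => ->.
rewrite mulmxDr mulmxDl !mulmxA mulmxV ?metric_unit// mul1mx.
by rewrite -!mulmxA mulVmx ?metric_unit// mulmx1 addrC.
Qed.

(** The Koszul argument: with the upper index lowered, compatibility writes each derivative of the
    covariant metric as a sum of two symbols, and symmetry collapses the three derivatives in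
    [lowGam] to a single symbol. *)
Lemma Gam_unique (Gm : 'I_n -> 'M[R]_n) u : U u ->
  (forall k l, Gm k *m ecol l = Gm l *m ecol k) ->
  (forall k, dm k G u = (Gm k)^T *m invmx (g u) + invmx (g u) *m Gm k) ->
  forall k, Gam g k u = Gm k.
Proof.
move=> Uu sGm mGm k; rewrite Gam_low.
suff -> : lowGam k u = invmx (g u) *m Gm k by rewrite mulmxA mulmxV ?metric_unit// mul1mx.
pose L k := invmx (g u) *m Gm k.
have LE a b c : dm a G u b c = L a c b + L a b c.
  rewrite mGm mxE; congr (_ + _).
  have -> : (Gm a)^T *m invmx (g u) = (L a)^T by rewrite /L trmx_mul metric_inv_sym.
  by rewrite mxE.
have Ls a b c : L a b c = L c b a.
  rewrite -[LHS]mul_ecol -[RHS]mul_ecol /L -!mulmxA; congr ((_ *m _) _ _).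
  exact: sGm.
rewrite -/(L k); move: (L) LE Ls => {}L LE Ls.
apply/matrixP => i j; rewrite lowGamE !LE.
rewrite (Ls j k i) (Ls i j k) (Ls j i k) (Ls i k j) (Ls k j i).
by field.
Qed.

Lemma riemannE u i j k l : riemann g u i j k l = conn_curv (Gam g) k l u i j.
Proof.
have GamE a b c : (fun p => Gam g a p b c) = (fun p => christoffel g p b a c).
  by apply/funext => p; rewrite mxE.
rewrite /riemann /conn_curv !mxE !dmxE !GamE -!addrA; congr (_ + (_ + _)).
by rewrite -sumrB; apply: eq_bigr => m _; rewrite !mxE.
Qed.

Lemma curvatureE u i j k l : U u ->
  curvature g u i j k l = (conn_curv (Gam g) k l u *m g u) i j.
Proof.
move=> Uu; rewrite /curvature mxE; apply: eq_bigr => m _.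
rewrite riemannE mulrC; congr (_ * _).
by rewrite -[in LHS](metric_sym Uu) mxE.
Qed.

Definition gc (f : point -> R) u : 'cV[R]_n := g u *m (grad f u)^T.

Definition dot u (x y : 'cV[R]_n) : R := (x^T *m invmx (g u) *m y) 0 0.

Lemma msmooth_grad f : smooth U f -> msmooth U (grad f).
Proof.
move=> sf i j; apply: smooth_eq oU _ (smooth_derive (delta_mx 0 j) sf) => p _.
by rewrite mxE.
Qed.

Lemma msmooth_gc f : smooth U f -> msmooth U (gc f).
Proof.
move=> sf; apply: msmoothM => //; first exact: metric_msmooth.
by apply: msmooth_tr => //; exact: msmooth_grad.
Qed.

Lemma dotC u x y : U u -> dot u x y = dot u y x.
Proof.
move=> Uu; rewrite /dot; have -> : x^T *m invmx (g u) *m y = (y^T *m invmx (g u) *m x)^T.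
  by rewrite !trmx_mul trmxK metric_inv_sym// mulmxA.
by rewrite mxE.
Qed.

Lemma dotDl u x y z : dot u (x + y) z = dot u x z + dot u y z.
Proof. by rewrite /dot linearD /= !mulmxDl mxE. Qed.
Lemma dotDr u x y z : dot u x (y + z) = dot u x y + dot u x z.
Proof. by rewrite /dot mulmxDr mxE. Qed.
Lemma dotZl u c x z : dot u (c *: x) z = c * dot u x z.
Proof. by rewrite /dot linearZ /= -!scalemxAl mxE. Qed.
Lemma dotZr u c x z : dot u x (c *: z) = c * dot u x z.
Proof. by rewrite /dot -!scalemxAr mxE. Qed.
Lemma dotNl u x z : dot u (- x) z = - dot u x z.
Proof. by rewrite /dot linearN /= !mulNmx mxE. Qed.
Lemma dotNr u x z : dot u x (- z) = - dot u x z.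
Proof. by rewrite /dot mulmxN mxE. Qed.

Lemma dot_gc u f y : U u -> dot u (gc f u) y = (grad f u *m y) 0 0.
Proof.
move=> Uu; rewrite /dot /gc trmx_mul trmxK metric_sym//.
by rewrite -!mulmxA (mulmxA (g u)) mulmxV ?metric_unit// mul1mx.
Qed.

Lemma pd_dot k f u : U u -> pd k f u = dot u (gc f u) (ecol k).
Proof. by move=> Uu; rewrite dot_gc// mul_ecol mxE. Qed.

Lemma grad_prod_dot f1 f2 u : U u -> grad_prod g f1 f2 u = dot u (gc f1 u) (gc f2 u).
Proof.
move=> Uu; rewrite dot_gc// /gc mulmxA mxE /grad_prod exchange_big /=.
apply: eq_bigr => j _; rewrite !mxE mulr_suml; apply: eq_bigr => i _.
by rewrite !mxE [pd i f1 u * _]mulrC.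
Qed.

Lemma smooth_dot (x y : point -> 'cV[R]_n) : msmooth U x -> msmooth U y ->
  smooth U (fun u => dot u (x u) (y u)).
Proof.
move=> sx sy; have sG := metric_inv_msmooth.
exact: (msmoothM oU (msmoothM oU (msmooth_tr oU sx) sG) sy).
Qed.

Lemma pd_dotE k (x y : point -> 'cV[R]_n) u : U u -> msmooth U x -> msmooth U y ->
  pd k (fun p => dot p (x p) (y p)) u =
  dot u (cov (Gam g) k x u) (y u) + dot u (x u) (cov (Gam g) k y u).
Proof.
move=> Uu sx sy; have sG := metric_inv_msmooth.
have -> : pd k (fun p => dot p (x p) (y p)) u =
    dm k (fun p => (x p)^T *m invmx (g p) *m y p) u 0 0 by rewrite dmxE.
have sxt := msmooth_tr oU sx.
rewrite (dmxM oU Uu)//; last exact: msmoothM.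
rewrite (dmxM oU Uu)// dmx_tr dm_metric_inv//.
rewrite /dot /cov trmx_add trmx_mul !mulmxDl !mulmxDr !mulmxDl !mulmxA.
by rewrite !mxE; ring.
Qed.

Lemma dot_eq u x y : U u -> (forall k, dot u x (ecol k) = dot u y (ecol k)) -> x = y.
Proof.
move=> Uu xy; have : x^T *m invmx (g u) = y^T *m invmx (g u).
  by apply: eq_ecol => k; apply/matrixP => a b; rewrite (ord1 a) (ord1 b); apply: xy.
move=> /(congr1 (mulmx^~ (g u))); rewrite -!mulmxA mulVmx ?metric_unit// !mulmx1.
exact: trmx_inj.
Qed.

(** Differentiating the raised gradient produces [dm_metric]; one of its two terms cancels the
    Christoffel term of [cov], the other is the correction inside the Hessian. *)
Lemma hess_cov f u k : U u -> smooth U f -> hess g f u *m ecol k = cov (Gam g) k (gc f) u.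
Proof.
move=> Uu sf; rewrite /cov /gc (dmxM oU Uu)//; last 2 first.
- exact: metric_msmooth.
- by apply: msmooth_tr => //; exact: msmooth_grad.
rewrite dm_metric// mulNmx mulmxDl !mulmxA opprD -!addrA.
rewrite addrC -!addrA subrr addr0 addrC.
rewrite dmx_tr -!mulmxA -mulmxBr.
apply/matrixP => i j; rewrite (ord1 j) mul_ecol !mxE; apply: eq_bigr => s _.
congr (_ * _); rewrite !mxE; congr (_ - _).
  rewrite dmxE /pd (derive_comm (delta_mx 0 s) (delta_mx 0 k) oU sf Uu).
  by under [in RHS]eq_fun do rewrite mxE.
apply: eq_bigr => m _; rewrite !mxE; congr (_ * _).
by have := Gam_sym s k Uu => /matrixP/(_ m 0); rewrite !mul_ecol !mxE.
Qed.

Lemma msmooth_hess f : smooth U f -> msmooth U (hess g f).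
Proof.
move=> sf i k; have := msmooth_cov oU (msmooth_Gam k) (msmooth_gc sf) i 0.
by apply: smooth_eq => // p Up; rewrite -hess_cov// mul_ecol.
Qed.

(** Equality of mixed partials of [f], written with [pd_dotE]; the Christoffel terms agree because
    the connection is torsion-free. *)
Lemma hess_dot f u k l : U u -> smooth U f ->
  dot u (hess g f u *m ecol k) (ecol l) = dot u (ecol k) (hess g f u *m ecol l).
Proof.
move=> Uu sf; have se j : msmooth U (fun _ : point => ecol j) by exact: msmooth_cst.
have sb := msmooth_gc sf.
have cE i j : cov (Gam g) i (fun _ : point => ecol j) u = Gam g i u *m ecol j.
  by rewrite /cov (dmx_cst _ _ (ecol j)) add0r.
have D i j : pd i (fun p => pd j f p) u =
    dot u (hess g f u *m ecol i) (ecol j) + dot u (gc f u) (Gam g i u *m ecol j).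
  rewrite -(cE i j) hess_cov// -pd_dotE//.
  by apply: near_eq_derive; apply: open_near oU Uu _ => p Up; rewrite -pd_dot.
have := pd_comm oU k l Uu sf; rewrite (D k l) (D l k) (Gam_sym k l Uu).
by move=> /addIr ->; rewrite dotC.
Qed.

Definition selfadj u (a : 'M[R]_n) : Prop := invmx (g u) *m a = a^T *m invmx (g u).

Lemma selfadjP u a : (forall k l, dot u (a *m ecol k) (ecol l) = dot u (ecol k) (a *m ecol l)) ->
  selfadj u a.
Proof.
move=> h; apply/matrixP => k l; have := h k l; rewrite /dot trmx_mul !mulmxA.
have E (X : 'M[R]_n) : ((ecol k)^T *m X *m ecol l) 0 0 = X k l.
  by rewrite mul_ecol /ecol trmx_delta -rowE mxE.
by rewrite -(mulmxA (ecol k)^T a^T) -(mulmxA (ecol k)^T (invmx (g u)) a) !E => ->.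
Qed.

Lemma selfadj_dot u a x y : selfadj u a -> dot u (a *m x) y = dot u x (a *m y).
Proof. by move=> sa; rewrite /dot trmx_mul -!mulmxA (mulmxA _ a) sa -!mulmxA. Qed.

Lemma hess_selfadj f u : U u -> smooth U f -> selfadj u (hess g f u).
Proof. by move=> Uu sf; apply: selfadjP => k l; rewrite hess_dot. Qed.

Lemma selfadj1 u c : selfadj u (c *: 1%:M).
Proof. by rewrite /selfadj trmx_scale trmx1 -scalemxAr -scalemxAl mulmx1 mul1mx. Qed.

Lemma selfadjD u a c : selfadj u a -> selfadj u c -> selfadj u (a + c).
Proof. by rewrite /selfadj mulmxDr trmx_add mulmxDl => -> ->. Qed.

Lemma selfadjZ u a c : selfadj u a -> selfadj u (c *: a).
Proof. by rewrite /selfadj trmx_scale -scalemxAr -scalemxAl => ->. Qed.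

Lemma selfadjN u a : selfadj u a -> selfadj u (- a).
Proof. by rewrite /selfadj trmx_opp mulmxN mulNmx => ->. Qed.

Lemma selfadjM u a c : a *m c = c *m a -> selfadj u a -> selfadj u c -> selfadj u (a *m c).
Proof.
rewrite /selfadj => ac sa sc.
by rewrite mulmxA sa -mulmxA sc mulmxA -trmx_mul ac.
Qed.

Lemma selfadjV u a : a \in unitmx -> selfadj u a -> selfadj u (invmx a).
Proof.
rewrite /selfadj => ua sa; have uaT : a^T \in unitmx by rewrite unitmx_tr.
rewrite trmx_inv; apply: (can_inj (mulKmx uaT)).
by rewrite mulKVmx// mulmxA -sa -mulmxA mulmxV// mulmx1.
Qed.

End LeviCivita.

(** * Hessians in a flat metric: Codazzi equations and commutation *)

Section FlatHessians.
Context {R : realType} {n : nat} (U : set 'rV[R]_n) (oU : open U).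
Notation point := 'rV[R]_n.
Context (g : point -> 'M[R]_n) (mg : metric U g) (fg : flat U g).

Lemma flat_curv k l u : U u -> conn_curv (Gam g) k l u = 0.
Proof. by move=> Uu; apply/matrixP => i j; rewrite -riemannE fg// mxE. Qed.

(** The difference of the two sides is the curvature applied to the gradient of [f]. *)
Lemma hess_closed f k l u : U u -> smooth U f ->
  cov (Gam g) k (fun p => hess g f p *m ecol l) u =
  cov (Gam g) l (fun p => hess g f p *m ecol k) u.
Proof.
move=> Uu sf; have sG j : msmooth U (Gam g j) by exact: msmooth_Gam.
have E i j : cov (Gam g) i (fun p => hess g f p *m ecol j) u =
    cov (Gam g) i (cov (Gam g) j (gc g f)) u.
  by apply: (cov_eq oU _ _ Uu) => p Up; rewrite (hess_cov oU mg).
apply/eqP; rewrite !E -subr_eq0 (cov_comm oU)//; last exact: msmooth_gc.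
by rewrite flat_curv// mul0mx.
Qed.

Lemma law_pd V f A u j : U u -> conservation_law U V f A ->
  pd j A u = dot g u (gc g f u) (V u *m ecol j).
Proof.
move=> Uu /(_ u Uu j) ->; rewrite (dot_gc mg)// mulmxA mul_ecol mxE.
by apply: eq_bigr => i _; rewrite mxE.
Qed.

(** The second derivatives of the flux [A] are the product of the two Hessians, as a bilinear form,
    plus a third-order term that is symmetric by [hess_closed]. So the bilinear form is symmetric,
    and for self-adjoint affinors this is commutation. *)
Lemma law_commute f f' A u : U u -> smooth U f -> smooth U f' -> smooth U A ->
  conservation_law U (hess g f) f' A ->
  hess g f u *m hess g f' u = hess g f' u *m hess g f u.
Proof.
move=> Uu sf sf' sA cl; have sh j : msmooth U (fun p => hess g f p *m ecol j).
  by apply: msmoothM => //; [exact: msmooth_hess|exact: msmooth_cst].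
have D i j : pd i (fun p => pd j A p) u =
    dot g u (hess g f' u *m ecol i) (hess g f u *m ecol j)
    + dot g u (gc g f' u) (cov (Gam g) i (fun p => hess g f p *m ecol j) u).
  rewrite (hess_cov oU mg)// -(pd_dotE oU mg)//; last exact: msmooth_gc.
  by apply: near_eq_derive; apply: open_near oU Uu _ => p Up; rewrite -(law_pd _ Up cl).
have sa := hess_selfadj oU mg Uu sf; have sa' := hess_selfadj oU mg Uu sf'.
apply/esym/eq_ecol => k; apply: (dot_eq mg Uu) => l.
have := pd_comm oU k l Uu sA; rewrite (D k l) (D l k) (hess_closed k l Uu sf).
move=> /addIr h; rewrite -!mulmxA [LHS](selfadj_dot _ _ sa') [RHS](selfadj_dot _ _ sa).
by rewrite h (dotC mg).
Qed.

End FlatHessians.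

Opaque dmx.

(** * The reciprocal metric *)

Section Commuting.
Context {R : realType} {n : nat}.
Implicit Types a c d : 'M[R]_n.

Lemma commD a c d : a *m c = c *m a -> a *m d = d *m a -> a *m (c + d) = (c + d) *m a.
Proof. by rewrite mulmxDr mulmxDl => -> ->. Qed.
Lemma commN a c : a *m c = c *m a -> a *m (- c) = - c *m a.
Proof. by rewrite mulmxN mulNmx => ->. Qed.
Lemma commZ a c x : a *m c = c *m a -> a *m (x *: c) = (x *: c) *m a.
Proof. by rewrite -scalemxAr -scalemxAl => ->. Qed.
Lemma comm1 a x : a *m (x *: 1%:M) = (x *: 1%:M) *m a.
Proof. by apply: commZ; rewrite mulmx1 mul1mx. Qed.
Lemma commM a c d : a *m c = c *m a -> a *m d = d *m a -> a *m (c *m d) = (c *m d) *m a.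
Proof. by move=> ac ad; rewrite mulmxA ac -mulmxA ad mulmxA. Qed.
Lemma commV a c : c \in unitmx -> a *m c = c *m a -> a *m invmx c = invmx c *m a.
Proof.
move=> uc ac; apply: (can_inj (mulKmx uc)).
by rewrite mulKVmx// mulmxA -ac -mulmxA mulmxV// mulmx1.
Qed.

End Commuting.

Section Reciprocal.
Context {R : realType} {n : nat} (U : set 'rV[R]_n) (oU : open U).
Notation point := 'rV[R]_n.
Context (g : point -> 'M[R]_n) (mg : metric U g) (fg : flat U g).
Notation Gg := (Gam g).
Notation dt := (dot g).
Context (B A N M P Q Rf S : point -> R) (v be et : point -> 'M[R]_n) (b nu : point -> 'cV[R]_n).
Hypotheses (sB : smooth U B) (sA : smooth U A) (sN : smooth U N)
  (sM : smooth U M) (sP : smooth U P) (sQ : smooth U Q) (sR : smooth U Rf) (sS : smooth U S).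
Hypotheses (ssv : msmooth U v) (ssbe : msmooth U be) (sset : msmooth U et)
  (sb : msmooth U b) (snu : msmooth U nu).
Hypotheses (sv : forall u, U u -> selfadj g u (v u)) (sbe : forall u, U u -> selfadj g u (be u))
  (set' : forall u, U u -> selfadj g u (et u)).
Hypotheses (cvb : forall u, U u -> v u *m be u = be u *m v u)
  (cve : forall u, U u -> v u *m et u = et u *m v u)
  (ceb : forall u, U u -> et u *m be u = be u *m et u).
Let cl (a : point -> 'M[R]_n) := forall k l u, U u ->
  cov Gg k (fun p => a p *m ecol l) u = cov Gg l (fun p => a p *m ecol k) u.
Hypotheses (clv : cl v) (clbe : cl be) (clet : cl et).
Hypotheses (covb : forall k u, U u -> cov Gg k b u = be u *m ecol k)
  (covnu : forall k u, U u -> cov Gg k nu u = et u *m ecol k).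
Hypotheses (pdB0 : forall k u, U u -> pd k B u = dt u (b u) (ecol k))
  (pdN0 : forall k u, U u -> pd k N u = dt u (nu u) (ecol k))
  (pdA0 : forall k u, U u -> pd k A u = dt u (b u) (v u *m ecol k))
  (pdM0 : forall k u, U u -> pd k M u = dt u (nu u) (v u *m ecol k))
  (pdP0 : forall k u, U u -> pd k P u = dt u (b u) (et u *m ecol k))
  (pdQ0 : forall k u, U u -> pd k Q u = dt u (b u) (be u *m ecol k))
  (pdR0 : forall k u, U u -> pd k Rf u = dt u (nu u) (et u *m ecol k))
  (pdS0 : forall k u, U u -> pd k S u = dt u (nu u) (be u *m ecol k)).
Hypothesis nzD : forall u, U u -> B u * M u - A u * N u != 0.
Definition rK u : 'M[R]_n := M u *: 1%:M - N u *: v u.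
Hypothesis uK : forall u, U u -> rK u \in unitmx.
Definition rD u := B u * M u - A u * N u.
Definition rL u : 'M[R]_n := B u *: v u - A u *: 1%:M.
Definition rvt u : 'M[R]_n := rL u *m invmx (rK u).
(** On solutions [kk] sends u_x to the derivative of u in the new space variable, [k2] sends it to
    the derivative in the new time, and [ki] inverts [kk]. *)
Definition kk u : 'M[R]_n := (rD u)^-1 *: rK u.
Definition k2 u : 'M[R]_n := (rD u)^-1 *: rL u.
Definition ki u : 'M[R]_n := B u *: 1%:M + N u *: rvt u.
Definition rla u : 'M[R]_n :=
  B u *: be u - Q u *: 1%:M + N u *: (be u *m rvt u) - S u *: rvt u.
Definition rmu u : 'M[R]_n :=
  B u *: et u - P u *: 1%:M + N u *: (et u *m rvt u) - Rf u *: rvt u.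

Let nz u : U u -> rD u != 0. Proof. exact: nzD. Qed.

Lemma comm_rK a u : a *m v u = v u *m a -> a *m rK u = rK u *m a.
Proof. by move=> av; apply: commD; [exact: comm1|apply: commN; exact: commZ]. Qed.
Lemma comm_rL a u : a *m v u = v u *m a -> a *m rL u = rL u *m a.
Proof. by move=> av; apply: commD; [exact: commZ|apply: commN; exact: comm1]. Qed.
Lemma comm_vt a u : U u -> a *m v u = v u *m a -> a *m rvt u = rvt u *m a.
Proof.
move=> Uu av; apply: commM; first exact: comm_rL.
by apply: commV; [exact: uK|exact: comm_rK].
Qed.
Lemma comm_kk a u : a *m v u = v u *m a -> a *m kk u = kk u *m a.
Proof. by move=> av; apply/commZ/comm_rK. Qed.
Lemma comm_k2 a u : a *m v u = v u *m a -> a *m k2 u = k2 u *m a.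
Proof. by move=> av; apply/commZ/comm_rL. Qed.
Lemma comm_ki a u : U u -> a *m v u = v u *m a -> a *m ki u = ki u *m a.
Proof. by move=> Uu av; apply: commD; [exact: comm1|apply/commZ/comm_vt]. Qed.
Lemma comm_la a u : U u -> a *m v u = v u *m a -> a *m be u = be u *m a ->
  a *m rla u = rla u *m a.
Proof.
move=> Uu av ab; apply: commD; last by apply/commN/commZ/comm_vt.
apply: commD; last by apply/commZ/commM => //; exact: comm_vt.
by apply: commD; [exact: commZ|apply/commN/comm1].
Qed.
Lemma comm_mu a u : U u -> a *m v u = v u *m a -> a *m et u = et u *m a ->
  a *m rmu u = rmu u *m a.
Proof.
move=> Uu av ab; apply: commD; last by apply/commN/commZ/comm_vt.
apply: commD; last by apply/commZ/commM => //; exact: comm_vt.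
by apply: commD; [exact: commZ|apply/commN/comm1].
Qed.

Lemma vt_v u : U u -> rvt u *m v u = v u *m rvt u.
Proof. by move=> Uu; apply/esym/comm_vt. Qed.
Lemma kk_v u : U u -> kk u *m v u = v u *m kk u.
Proof. by move=> Uu; apply/esym/comm_kk. Qed.
Lemma be_vt u : U u -> be u *m rvt u = rvt u *m be u.
Proof. by move=> Uu; apply: comm_vt => //; exact: esym (cvb Uu). Qed.
Lemma et_vt u : U u -> et u *m rvt u = rvt u *m et u.
Proof. by move=> Uu; apply: comm_vt => //; exact: esym (cve Uu). Qed.
Lemma la_v u : U u -> rla u *m v u = v u *m rla u.
Proof. by move=> Uu; apply/esym/comm_la => //; exact: cvb. Qed.
Lemma mu_v u : U u -> rmu u *m v u = v u *m rmu u.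
Proof. by move=> Uu; apply/esym/comm_mu => //; exact: cve. Qed.
Lemma la_vt u : U u -> rla u *m rvt u = rvt u *m rla u.
Proof. by move=> Uu; apply: comm_vt => //; exact: la_v. Qed.
Lemma mu_vt u : U u -> rmu u *m rvt u = rvt u *m rmu u.
Proof. by move=> Uu; apply: comm_vt => //; exact: mu_v. Qed.
Lemma la_mu u : U u -> rla u *m rmu u = rmu u *m rla u.
Proof.
move=> Uu; apply: comm_mu => //; first exact: la_v.
by apply/esym/comm_la => //; [exact: esym (cve Uu)|exact: ceb].
Qed.

Lemma vt_K u : U u -> rvt u *m rK u = rL u.
Proof. by move=> Uu; rewrite /rvt mulmxKV ?uK. Qed.

Lemma kik u : U u -> ki u *m kk u = 1%:M.
Proof.
move=> Uu; rewrite /kk -scalemxAr /ki mulmxDl -!scalemxAl mul1mx vt_K// /rK /rL.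
apply/matrixP => i j; rewrite !mxE; have := nz Uu; rewrite /rD.
by case: (i == j) => ?; field.
Qed.

Lemma kki u : U u -> kk u *m ki u = 1%:M.
Proof. by move=> Uu; apply/mulmx1C/kik. Qed.

Lemma kk_unit u : U u -> kk u \in unitmx.
Proof. by move=> Uu; case: (mulmx1_unit (kki Uu)). Qed.

Lemma kk_vt u : U u -> kk u *m rvt u = k2 u.
Proof.
move=> Uu; rewrite /kk -scalemxAl -(comm_rK (vt_v Uu)) vt_K//.
Qed.

Lemma ki_k2 u : U u -> ki u *m k2 u = rvt u.
Proof. by move=> Uu; rewrite -kk_vt// mulmxA kik// mul1mx. Qed.

(** Together with [v_kk] this is the chain rule u_x = B u_X + N u_T, u_t = A u_X + M u_T on
    solutions, where X and T are the new variables; [rD] is the determinant of this system. *)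
Lemma one_kk u : U u -> 1%:M = B u *: kk u + N u *: k2 u.
Proof. by move=> Uu; rewrite -kk_vt// -(kki Uu) /ki mulmxDr -!scalemxAr mulmx1. Qed.

Lemma v_kk u : U u -> v u = A u *: kk u + M u *: k2 u.
Proof.
move=> Uu; rewrite /kk /k2 /rK /rL; apply/matrixP => i j; rewrite !mxE.
by have := nz Uu; rewrite /rD; case: (i == j) => ?; field.
Qed.

Lemma la_ki u : U u -> rla u = be u *m ki u - Q u *: 1%:M - S u *: rvt u.
Proof.
move=> Uu; rewrite /rla /ki mulmxDr -!scalemxAr mulmx1.
by congr (_ - _); rewrite addrAC.
Qed.

Lemma mu_ki u : U u -> rmu u = et u *m ki u - P u *: 1%:M - Rf u *: rvt u.
Proof.
move=> Uu; rewrite /rmu /ki mulmxDr -!scalemxAr mulmx1.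
by congr (_ - _); rewrite addrAC.
Qed.

(** Multiplication by [kk] clears the inverse matrix inside [rvt]; in this form the Codazzi
    equations and the tail integrals are checked. *)
Lemma kk_la u : U u -> kk u *m rla u = be u - Q u *: kk u - S u *: k2 u.
Proof.
move=> Uu; have c : be u *m kk u = kk u *m be u by apply: comm_kk; exact: esym (cvb Uu).
have E : kk u *m (be u *m ki u) = be u by rewrite mulmxA -c -mulmxA kki// mulmx1.
by rewrite la_ki// 2!mulmxBr E -!scalemxAr mulmx1 kk_vt.
Qed.

Lemma kk_mu u : U u -> kk u *m rmu u = et u - P u *: kk u - Rf u *: k2 u.
Proof.
move=> Uu; have c : et u *m kk u = kk u *m et u by apply: comm_kk; exact: esym (cve Uu).
have E : kk u *m (et u *m ki u) = et u by rewrite mulmxA -c -mulmxA kki// mulmx1.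
by rewrite mu_ki// 2!mulmxBr E -!scalemxAr mulmx1 kk_vt.
Qed.

Lemma selfadj_rK u : U u -> selfadj g u (rK u).
Proof. by move=> Uu; apply: selfadjD; [exact: selfadj1|apply/selfadjN/selfadjZ/sv]. Qed.
Lemma selfadj_rL u : U u -> selfadj g u (rL u).
Proof. by move=> Uu; apply: selfadjD; [apply/selfadjZ/sv|apply/selfadjN/selfadj1]. Qed.
Lemma selfadj_vt u : U u -> selfadj g u (rvt u).
Proof.
move=> Uu; apply: selfadjM; [|exact: selfadj_rL|apply: selfadjV; [exact: uK|exact: selfadj_rK]].
by apply: commV; [exact: uK|apply/comm_rK/esym/comm_rL].
Qed.
Lemma selfadj_kk u : U u -> selfadj g u (kk u).
Proof. by move=> Uu; apply/selfadjZ/selfadj_rK. Qed.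
Lemma selfadj_k2 u : U u -> selfadj g u (k2 u).
Proof. by move=> Uu; apply/selfadjZ/selfadj_rL. Qed.
Lemma selfadj_la u : U u -> selfadj g u (rla u).
Proof.
move=> Uu; have svt := selfadj_vt Uu; have sx := sbe Uu.
apply: selfadjD; last exact/selfadjN/selfadjZ.
apply: selfadjD; last by apply/selfadjZ/selfadjM => //; exact: be_vt.
by apply: selfadjD; [exact: selfadjZ|apply/selfadjN/selfadj1].
Qed.
Lemma selfadj_mu u : U u -> selfadj g u (rmu u).
Proof.
move=> Uu; have svt := selfadj_vt Uu; have sx := set' Uu.
apply: selfadjD; last exact/selfadjN/selfadjZ.
apply: selfadjD; last by apply/selfadjZ/selfadjM => //; exact: et_vt.
by apply: selfadjD; [exact: selfadjZ|apply/selfadjN/selfadj1].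
Qed.

Lemma smooth_rD : smooth U rD.
Proof. by apply: smoothB => //; apply: smoothM. Qed.
Lemma smooth_rDV : smooth U (fun u => (rD u)^-1).
Proof. by apply: smoothV => //; exact: smooth_rD. Qed.
Let s1 : msmooth U (fun _ : point => 1%:M : 'M[R]_n). Proof. exact: msmooth_cst. Qed.
Lemma msmooth_rK : msmooth U rK.
Proof. by apply: msmoothB => //; exact: msmoothZ. Qed.
Lemma msmooth_rL : msmooth U rL.
Proof. by apply: msmoothB => //; exact: msmoothZ. Qed.
Lemma msmooth_kk : msmooth U kk.
Proof. by apply: msmoothZ => //; [exact: smooth_rDV|exact: msmooth_rK]. Qed.
Lemma msmooth_k2 : msmooth U k2.
Proof. by apply: msmoothZ => //; [exact: smooth_rDV|exact: msmooth_rL]. Qed.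
Lemma msmooth_vt : msmooth U rvt.
Proof.
apply: msmoothM => //; first exact: msmooth_rL.
by apply: msmooth_inv => //; exact: msmooth_rK.
Qed.
Lemma msmooth_ki : msmooth U ki.
Proof. by apply: msmoothD => //; apply: msmoothZ => //; exact: msmooth_vt. Qed.
Lemma msmooth_la : msmooth U rla.
Proof.
have s := msmooth_vt.
apply: msmoothB => //; last exact: msmoothZ.
apply: msmoothD => //; last by apply: msmoothZ => //; exact: msmoothM.
by apply: msmoothB => //; exact: msmoothZ.
Qed.
Lemma msmooth_mu : msmooth U rmu.
Proof.
have s := msmooth_vt.
apply: msmoothB => //; last exact: msmoothZ.
apply: msmoothD => //; last by apply: msmoothZ => //; exact: msmoothM.
by apply: msmoothB => //; exact: msmoothZ.
Qed.

Definition X1 k u : 'cV[R]_n := kk u *m ecol k.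
Definition X2 k u : 'cV[R]_n := k2 u *m ecol k.

Lemma msmooth_X1 k : msmooth U (X1 k).
Proof. by apply: msmoothM => //; [exact: msmooth_kk|exact: msmooth_cst]. Qed.
Lemma msmooth_X2 k : msmooth U (X2 k).
Proof. by apply: msmoothM => //; [exact: msmooth_k2|exact: msmooth_cst]. Qed.
Let eX k u : U u -> ecol k = B u *: X1 k u + N u *: X2 k u.
Proof.
by move=> Uu; rewrite /X1 /X2 !scalemxAl -mulmxDl -one_kk// mul1mx.
Qed.
Let vX k u : U u -> v u *m ecol k = A u *: X1 k u + M u *: X2 k u.
Proof.
by move=> Uu; rewrite /X1 /X2 !scalemxAl -mulmxDl -v_kk.
Qed.

Let pdB k u : U u -> pd k B u = B u * dt u (b u) (X1 k u) + N u * dt u (b u) (X2 k u).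
Proof. by move=> Uu; rewrite pdB0// {1}(eX k Uu) dotDr !dotZr. Qed.
Let pdN k u : U u -> pd k N u = B u * dt u (nu u) (X1 k u) + N u * dt u (nu u) (X2 k u).
Proof. by move=> Uu; rewrite pdN0// {1}(eX k Uu) dotDr !dotZr. Qed.
Let pdA k u : U u -> pd k A u = A u * dt u (b u) (X1 k u) + M u * dt u (b u) (X2 k u).
Proof. by move=> Uu; rewrite pdA0// vX// dotDr !dotZr. Qed.
Let pdM k u : U u -> pd k M u = A u * dt u (nu u) (X1 k u) + M u * dt u (nu u) (X2 k u).
Proof. by move=> Uu; rewrite pdM0// vX// dotDr !dotZr. Qed.

(** The derivatives of the coefficient matrix with rows (B, N), (A, M) are that matrix times the 2
    by 2 matrix of products of [b], [nu] with [X1], [X2], so the logarithmic derivative of the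
    determinant is the trace of the latter. *)
Lemma pd_rD k u : U u ->
  pd k rD u = rD u * (dt u (b u) (X1 k u) + dt u (nu u) (X2 k u)).
Proof.
move=> Uu; rewrite /pd deriveB; last 2 first.
- by apply: smooth_derivable Uu; exact: smoothM.
- by apply: smooth_derivable Uu; exact: smoothM.
rewrite !(deriveMs Uu)// -!/(pd k _ u) pdB// pdM// pdA// pdN// /rD.
by ring.
Qed.

Let se j : msmooth U (fun _ : point => ecol j : 'cV[R]_n). Proof. exact: msmooth_cst. Qed.
Let svj j : msmooth U (fun p => v p *m ecol j). Proof. exact: msmoothM. Qed.
Let cove i j u : cov Gg i (fun _ : point => ecol j) u = Gg i u *m ecol j.
Proof. by rewrite /cov (dmx_cst _ _ (ecol j)) add0r. Qed.

Let covX1 i j u : U u -> pd i rD u *: X1 j u + rD u *: cov Gg i (X1 j) u =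
    pd i M u *: ecol j + M u *: (Gg i u *m ecol j)
    - (pd i N u *: (v u *m ecol j) + N u *: cov Gg i (fun p => v p *m ecol j) u).
Proof.
move=> Uu; have sX := msmooth_X1 j; have sj := svj j; have sej := se j.
rewrite -(covZ Gg i Uu smooth_rD)//.
rewrite (cov_eq oU Gg i Uu (Z := fun p => M p *: ecol j - N p *: (v p *m ecol j))).
  rewrite (covB oU Gg i Uu); [|exact: msmoothZ|exact: msmoothZ].
  by rewrite (covZ Gg i Uu sM)// (covZ Gg i Uu sN)// cove.
move=> p Up; rewrite /X1 /kk -scalemxAl scalerA mulfV ?nz// scale1r /rK.
by rewrite mulmxBl -!scalemxAl mul1mx.
Qed.

Let covX2 i j u : U u -> pd i rD u *: X2 j u + rD u *: cov Gg i (X2 j) u =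
    (pd i B u *: (v u *m ecol j) + B u *: cov Gg i (fun p => v p *m ecol j) u)
    - (pd i A u *: ecol j + A u *: (Gg i u *m ecol j)).
Proof.
move=> Uu; have sX := msmooth_X2 j; have sj := svj j; have sej := se j.
rewrite -(covZ Gg i Uu smooth_rD)//.
rewrite (cov_eq oU Gg i Uu (Z := fun p => B p *: (v p *m ecol j) - A p *: ecol j)).
  rewrite (covB oU Gg i Uu); [|exact: msmoothZ|exact: msmoothZ].
  by rewrite (covZ Gg i Uu sB)// (covZ Gg i Uu sA)// cove.
move=> p Up; rewrite /X2 /k2 -scalemxAl scalerA mulfV ?nz// scale1r /rL.
by rewrite mulmxBl -!scalemxAl mul1mx.
Qed.

(** Differentiate D [X1] = M e - N v e and antisymmetrize: the Christoffel terms and the derivatives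
    of [v] drop out by symmetry, and the rest is expressed in the vectors [X1] and [X2] themselves.
    The identity is checked after multiplication by D. *)
Lemma torsion1 k l u : U u ->
  cov Gg k (X1 l) u - cov Gg l (X1 k) u =
    dt u (b u) (X1 l u) *: X1 k u - dt u (b u) (X1 k u) *: X1 l u
    + dt u (nu u) (X1 l u) *: X2 k u - dt u (nu u) (X1 k u) *: X2 l u.
Proof.
move=> Uu; have := covX1 k l Uu; have := covX1 l k Uu.
rewrite (clv l k Uu) (Gam_sym oU mg l k Uu) !vX// !pd_rD// !pdM// !pdN// (eX k Uu) (eX l Uu).
have D0 := nz Uu.
move: (_ *m (_ + _)) (cov _ k (fun=> _) u) (cov _ k (X1 l) u) (cov _ l (X1 k) u) => ge cv c1 c2.
move: (dt u (b u) (X1 k u)) (dt u (b u) (X1 l u)) (dt u (nu u) (X1 k u)) (dt u (nu u) (X1 l u)).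
move: (dt u (b u) (X2 k u)) (dt u (b u) (X2 l u)) (dt u (nu u) (X2 k u)) (dt u (nu u) (X2 l u)).
move: (X1 k u) (X1 l u) (X2 k u) (X2 l u) => x1k x1l x2k x2l b2k b2l n2k n2l b1k b1l n1k n1l.
move=> /matrixP E1 /matrixP E2; apply/matrixP => i j; move: (E1 i j) (E2 i j).
rewrite !mxE => /(canRL (addKr _)) E1' /(canRL (addKr _)) E2'; apply: (mulfI D0).
rewrite mulrBr E1' E2' /rD; ring.
Qed.

Lemma torsion2 k l u : U u ->
  cov Gg k (X2 l) u - cov Gg l (X2 k) u =
    dt u (b u) (X2 l u) *: X1 k u - dt u (b u) (X2 k u) *: X1 l u
    + dt u (nu u) (X2 l u) *: X2 k u - dt u (nu u) (X2 k u) *: X2 l u.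
Proof.
move=> Uu; have := covX2 k l Uu; have := covX2 l k Uu.
rewrite (clv l k Uu) (Gam_sym oU mg l k Uu) !vX// !pd_rD// !pdA// !pdB// (eX k Uu) (eX l Uu).
have D0 := nz Uu.
move: (_ *m (_ + _)) (cov _ k (fun=> _) u) (cov _ k (X2 l) u) (cov _ l (X2 k) u) => ge cv c1 c2.
move: (dt u (b u) (X1 k u)) (dt u (b u) (X1 l u)) (dt u (nu u) (X1 k u)) (dt u (nu u) (X1 l u)).
move: (dt u (b u) (X2 k u)) (dt u (b u) (X2 l u)) (dt u (nu u) (X2 k u)) (dt u (nu u) (X2 l u)).
move: (X1 k u) (X1 l u) (X2 k u) (X2 l u) => x1k x1l x2k x2l b2k b2l n2k n2l b1k b1l n1k n1l.
move=> /matrixP E1 /matrixP E2; apply/matrixP => i j; move: (E1 i j) (E2 i j).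
rewrite !mxE => /(canRL (addKr _)) E1' /(canRL (addKr _)) E2'; apply: (mulfI D0).
rewrite mulrBr E1' E2' /rD; ring.
Qed.

(* The metric connection Gp = nabla + W, with W_l = b ^ k e_l + nu ^ k vt e_l, has
   the torsion that makes k e_l closed; in the frame k it becomes the Levi-Civita
   connection of the reciprocal metric. *)
Definition rW l u : 'M[R]_n := b u *m (X1 l u)^T - X1 l u *m (b u)^T
  + (nu u *m (X2 l u)^T - X2 l u *m (nu u)^T).
Definition Gp l u : 'M[R]_n := Gg l u + rW l u *m invmx (g u).
Definition Gt l u : 'M[R]_n := ki u *m cov Gp l kk u.
Definition rgt_cov u : 'M[R]_n := (kk u)^T *m invmx (g u) *m kk u.
Definition rgt u : 'M[R]_n := invmx (rgt_cov u).

Let sG k : msmooth U (Gg k). Proof. exact: msmooth_Gam. Qed.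
Let sginv : msmooth U (fun p => invmx (g p)). Proof. exact: metric_inv_msmooth. Qed.

Lemma msmooth_rW l : msmooth U (rW l).
Proof.
have s1' := msmooth_X1 l; have s2' := msmooth_X2 l.
have st1 := msmooth_tr oU s1'; have st2 := msmooth_tr oU s2'.
have stb := msmooth_tr oU sb; have stn := msmooth_tr oU snu.
by apply: msmoothD => //; apply: msmoothB => //; exact: msmoothM.
Qed.

Lemma msmooth_Gp l : msmooth U (Gp l).
Proof. by apply: msmoothD => //; apply: msmoothM => //; exact: msmooth_rW. Qed.

Lemma msmooth_Gt l : msmooth U (Gt l).
Proof.
apply: msmoothM => //; first exact: msmooth_ki.
by apply: msmooth_cov => //; [exact: msmooth_Gp|exact: msmooth_kk].
Qed.

Lemma rW_dot l u y : U u -> rW l u *m invmx (g u) *m y =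
  dt u (X1 l u) y *: b u - dt u (b u) y *: X1 l u
  + dt u (X2 l u) y *: nu u - dt u (nu u) y *: X2 l u.
Proof.
move=> Uu; have E (x z : 'cV[R]_n) : x *m z^T *m invmx (g u) *m y = dt u z y *: x.
  rewrite -!mulmxA [z^T *m _]mx11_scalar mul_mx_scalar /dot.
  by rewrite mulmxA.
by rewrite /rW !mulmxDl !mulNmx !E addrA.
Qed.

Lemma cov_Gp m l (Z : point -> 'M[R]_(n, m)) u :
  cov Gp l Z u = cov Gg l Z u + rW l u *m invmx (g u) *m Z u.
Proof. by rewrite /cov /Gp mulmxDl addrA. Qed.

(** The product of commuting self-adjoint affinors is self-adjoint, so the form is symmetric in its
    indices. *)
Lemma comm_dot a c k l u : U u -> selfadj g u a -> selfadj g u c -> a *m c = c *m a ->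
  dt u (a *m ecol k) (c *m ecol l) = dt u (a *m ecol l) (c *m ecol k).
Proof.
move=> Uu sa sc ac; rewrite (selfadj_dot _ _ sa) mulmxA ac -mulmxA -(selfadj_dot _ _ sc).
exact: dotC mg _ _ _ Uu.
Qed.

Let kk_k2 u : U u -> kk u *m k2 u = k2 u *m kk u.
Proof. by move=> Uu; apply: comm_k2; exact: kk_v. Qed.

(* This makes Gt torsion-free. *)
Lemma closed_kk k l u : U u -> cov Gp k (X1 l) u = cov Gp l (X1 k) u.
Proof.
move=> Uu; rewrite !cov_Gp !rW_dot//.
have h1 := comm_dot k l Uu (selfadj_kk Uu) (selfadj_kk Uu) erefl.
have h2 := comm_dot k l Uu (selfadj_k2 Uu) (selfadj_kk Uu) (esym (kk_k2 Uu)).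
rewrite -!/(X1 _ u) -!/(X2 _ u) in h1 h2; rewrite h1 h2.
have := torsion1 k l Uu.
move: (cov Gg k (X1 l) u) (cov Gg l (X1 k) u) => c1 c2 /eqP; rewrite subr_eq => /eqP ->.
move: (dt u (X1 l u) (X1 k u)) (dt u (X2 l u) (X1 k u)) => d1 d2.
move: (dt u (b u) (X1 k u)) (dt u (b u) (X1 l u)) (dt u (nu u) (X1 k u)) (dt u (nu u) (X1 l u)).
move: (X1 k u) (X1 l u) (X2 k u) (X2 l u) (b u) (nu u) => x1k x1l x2k x2l bb nn ? ? ? ?.
by apply/matrixP => i j; rewrite !mxE; ring.
Qed.

(** Since [k2] is [kk] times [rvt], this is the Codazzi equation of [rvt] read in the frame [kk]. *)
Lemma closed_k2 k l u : U u -> cov Gp k (X2 l) u = cov Gp l (X2 k) u.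
Proof.
move=> Uu; rewrite !cov_Gp !rW_dot//.
have h1 := comm_dot k l Uu (selfadj_kk Uu) (selfadj_k2 Uu) (kk_k2 Uu).
have h2 := comm_dot k l Uu (selfadj_k2 Uu) (selfadj_k2 Uu) erefl.
rewrite -!/(X1 _ u) -!/(X2 _ u) in h1 h2; rewrite h1 h2.
have := torsion2 k l Uu.
move: (cov Gg k (X2 l) u) (cov Gg l (X2 k) u) => c1 c2 /eqP; rewrite subr_eq => /eqP ->.
move: (dt u (X1 l u) (X2 k u)) (dt u (X2 l u) (X2 k u)) => d1 d2.
move: (dt u (b u) (X2 k u)) (dt u (b u) (X2 l u)) (dt u (nu u) (X2 k u)) (dt u (nu u) (X2 l u)).
move: (X1 k u) (X1 l u) (X2 k u) (X2 l u) (b u) (nu u) => x1k x1l x2k x2l bb nn ? ? ? ?.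
by apply/matrixP => i j; rewrite !mxE; ring.
Qed.

(** Common to [rla] and [rmu]. The part of [rW] applied to the columns of [ch] that is proportional
    to [b] and [nu] is symmetric by [comm_dot]; the part along [X1] and [X2] becomes symmetric when
    joined with the derivatives of [f1] and [f2], which is exactly what the flux equations
    provide. *)
Lemma closed_Hk (ch : point -> 'M[R]_n) (f1 f2 : point -> R) k l u : U u ->
  msmooth U ch -> cl ch -> selfadj g u (ch u) -> ch u *m v u = v u *m ch u ->
  smooth U f1 -> smooth U f2 ->
  (forall j, pd j f1 u = dt u (b u) (ch u *m ecol j)) ->
  (forall j, pd j f2 u = dt u (nu u) (ch u *m ecol j)) ->
  let Z i p := ch p *m ecol i - f1 p *: X1 i p - f2 p *: X2 i p in
  cov Gp k (Z l) u = cov Gp l (Z k) u.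
Proof.
move=> Uu sch clch sac cv sf1 sf2 D1 D2 Z.
have sc j : msmooth U (fun p => ch p *m ecol j) by exact: msmoothM.
have sX1 := msmooth_X1; have sX2 := msmooth_X2.
have s1' j : msmooth U (fun p => f1 p *: X1 j p) by exact: msmoothZ.
have s2' j : msmooth U (fun p => f2 p *: X2 j p) by exact: msmoothZ.
have E i j : cov Gp i (Z j) u = cov Gp i (fun p => ch p *m ecol j) u
   - (pd i f1 u *: X1 j u + f1 u *: cov Gp i (X1 j) u)
   - (pd i f2 u *: X2 j u + f2 u *: cov Gp i (X2 j) u).
  rewrite /Z (covB oU Gp i Uu)//; last exact: msmoothB.
  by rewrite (covB oU Gp i Uu)// (covZ Gp i Uu sf1)// (covZ Gp i Uu sf2).
rewrite !E !D1 !D2 (closed_kk k l Uu) (closed_k2 k l Uu).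
move: (cov Gp l (X1 k) u) (cov Gp l (X2 k) u) => y1 y2.
rewrite !cov_Gp (clch l k u Uu) !rW_dot//.
have h1 := comm_dot k l Uu (selfadj_kk Uu) sac (esym (comm_kk cv)).
have h2 := comm_dot k l Uu (selfadj_k2 Uu) sac (esym (comm_k2 cv)).
rewrite -!/(X1 _ u) -!/(X2 _ u) in h1 h2; rewrite h1 h2.
move: (cov Gg k (fun p => ch p *m ecol l) u) => y3.
move: (ch u *m ecol k) (ch u *m ecol l) => ck cc.
move: (dt u (X1 l u) ck) (dt u (X2 l u) ck) (dt u (b u) ck) (dt u (nu u) ck) (dt u (b u) cc) (dt u (nu u) cc).
move: (X1 k u) (X1 l u) (X2 k u) (X2 l u) (b u) (nu u) => x1k x1l x2k x2l bb nn *.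
by apply/matrixP => i j; rewrite !mxE; ring.
Qed.

Lemma closed_la k l u : U u ->
  cov Gp k (fun p => (kk p *m rla p) *m ecol l) u = cov Gp l (fun p => (kk p *m rla p) *m ecol k) u.
Proof.
move=> Uu; have E i j : cov Gp i (fun p => (kk p *m rla p) *m ecol j) u =
   cov Gp i (fun p => be p *m ecol j - Q p *: X1 j p - S p *: X2 j p) u.
  apply: (cov_eq oU _ _ Uu) => p Up.
  by rewrite kk_la// 2!mulmxBl -(scalemxAl (Q p)) -(scalemxAl (S p)).
rewrite !E; exact: (closed_Hk k l Uu ssbe clbe (sbe Uu) (esym (cvb Uu)) sQ sS (fun j => pdQ0 j Uu) (fun j => pdS0 j Uu)).
Qed.

Lemma closed_mu k l u : U u ->
  cov Gp k (fun p => (kk p *m rmu p) *m ecol l) u = cov Gp l (fun p => (kk p *m rmu p) *m ecol k) u.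
Proof.
move=> Uu; have E i j : cov Gp i (fun p => (kk p *m rmu p) *m ecol j) u =
   cov Gp i (fun p => et p *m ecol j - P p *: X1 j p - Rf p *: X2 j p) u.
  apply: (cov_eq oU _ _ Uu) => p Up.
  by rewrite kk_mu// 2!mulmxBl -(scalemxAl (P p)) -(scalemxAl (Rf p)).
rewrite !E; exact: (closed_Hk k l Uu sset clet (set' Uu) (esym (cve Uu)) sP sR (fun j => pdP0 j Uu) (fun j => pdR0 j Uu)).
Qed.

Lemma rgt_cov_unit u : U u -> rgt_cov u \in unitmx.
Proof.
move=> Uu; have kU := kk_unit Uu.
by rewrite /rgt_cov !unitmx_mul unitmx_tr kU unitmx_inv (metric_unit mg).
Qed.

Lemma rgtE u : U u -> rgt u = ki u *m g u *m (ki u)^T.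
Proof.
move=> Uu; have gu := metric_unit mg Uu.
rewrite /rgt; apply: (can_inj (mulKmx (rgt_cov_unit Uu))).
rewrite mulmxV ?rgt_cov_unit// /rgt_cov -!mulmxA (mulmxA (kk u)) kki// mul1mx.
by rewrite (mulmxA (invmx _)) mulVmx// mul1mx -trmx_mul kik// trmx1.
Qed.

Lemma msmooth_rgt_cov : msmooth U rgt_cov.
Proof.
have sk := msmooth_kk; have skt := msmooth_tr oU sk.
by apply: msmoothM => //; apply: msmoothM.
Qed.

Lemma metric_rgt : metric U rgt.
Proof.
split=> [|u Uu|u Uu].
- by apply: msmooth_inv => //; [exact: rgt_cov_unit|exact: msmooth_rgt_cov].
- by rewrite rgtE// !trmx_mul trmxK (metric_sym mg)// mulmxA.
- by rewrite unitmx_inv rgt_cov_unit.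
Qed.

Lemma invmx_rgt u : invmx (rgt u) = rgt_cov u.
Proof. exact: invmxK. Qed.

Lemma Gt_ecol k l u : U u -> Gt k u *m ecol l = ki u *m cov Gp k (X1 l) u.
Proof.
move=> Uu; rewrite /Gt -mulmxA; congr (_ *m _).
by rewrite -(cov_mulr oU _ _ _ Uu)//; exact: msmooth_kk.
Qed.

(** Uniqueness of the Levi-Civita connection: [closed_kk] is the vanishing torsion, and [rW] is
    skew, so [Gp] preserves [g] and its transform by the frame [kk] preserves [rgt]. *)
Lemma Gam_rgt k u : U u -> Gam rgt k u = Gt k u.
Proof.
move=> Uu; move: k; apply: (Gam_unique (Gm := fun k => Gt k u) metric_rgt Uu).
  move=> k l; apply: etrans (Gt_ecol k l Uu) (etrans _ (esym (Gt_ecol l k Uu))).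
  by congr (_ *m _); exact: closed_kk.
move=> k; have -> : dm k (fun p => invmx (rgt p)) u = dm k rgt_cov u.
  by apply: (dmx_eq oU Uu) => p _; rewrite invmx_rgt.
rewrite invmx_rgt /rgt_cov /Gt /cov.
have sk := msmooth_kk; have skt := msmooth_tr oU sk.
rewrite (dmxM oU Uu)//; last exact: msmoothM.
rewrite (dmxM oU Uu)// dmx_tr (dm_metric_inv oU mg)//.
rewrite !(mulmxA _ (ki u)) -!(mulmxA _ (kk u) (ki u)) kki// mulmx1.
rewrite trmx_mul -!mulmxA (mulmxA (ki u)^T) -trmx_mul kki// trmx1 mul1mx.
have anti : (rW k u)^T = - rW k u.
  by rewrite /rW !(trmx_add, trmx_opp, trmx_mul, trmxK) opprD !opprB.
rewrite /Gp; move: anti (metric_inv_sym mg Uu).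
move: (rW k u) (invmx (g u)) (kk u) (dm k kk u) (Gg k u) => W G' q dq Ga anti Gs.
rewrite !trmx_add !trmx_mul !trmx_add !trmx_mul Gs anti !mulmxDl !mulmxDr !mulmxDl.
rewrite !mulmxN !mulNmx !mulmxA.
move: (dq^T *m G' *m q) (q^T *m Ga^T *m G' *m q) (q^T *m G' *m Ga *m q) => x1 x2 x3.
move: (q^T *m G' *m dq) (q^T *m G' *m W *m G' *m q) => x4 x5.
by apply/matrixP => i j; rewrite !mxE; ring.
Qed.

(** * Curvature of the reciprocal metric *)

Definition wedge (x y : 'cV[R]_n) : 'M[R]_n := x *m y^T - y *m x^T.

Lemma wedge_ki u x y : ki u *m wedge x y *m (ki u)^T = wedge (ki u *m x) (ki u *m y).
Proof. by rewrite /wedge mulmxBr mulmxBl !trmx_mul !mulmxA. Qed.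

(** The covariant derivative of the bivector field [rW l] along the k-th coordinate field. *)
Let CW k l u := dm k (rW l) u + Gg k u *m rW l u + rW l u *m (Gg k u)^T.

(** The curvature of a connection plus a tensor is the old curvature, zero here by flatness, plus
    the antisymmetrized derivative and the commutator of the tensor. *)
Lemma curv_Gp_CW k l u : U u -> conn_curv Gp k l u *m g u =
  CW k l u - CW l k u + (rW k u *m invmx (g u) *m rW l u - rW l u *m invmx (g u) *m rW k u).
Proof.
move=> Uu; have sW := msmooth_rW.
have dGp i j : dm i (Gp j) u = dm i (Gg j) u + (dm i (rW j) u *m invmx (g u)
    + rW j u *m ((Gg i u)^T *m invmx (g u) + invmx (g u) *m Gg i u)).
  rewrite (dmxD Uu)//; last exact: msmoothM.
  by rewrite (dmxM oU Uu)// (dm_metric_inv oU mg).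
have F := flat_curv fg k l Uu; rewrite /conn_curv in F.
have -> : conn_curv Gp k l u = (CW k l u - CW l k u
    + (rW k u *m invmx (g u) *m rW l u - rW l u *m invmx (g u) *m rW k u)) *m invmx (g u).
  rewrite -[RHS]add0r -F /conn_curv !dGp /Gp /CW.
  move: (rW k u) (rW l u) (dm k (rW l) u) (dm l (rW k) u) (invmx _) => Wk Wl dk dl G'.
  move: (Gg k u) (Gg l u) (dm k (Gg l) u) (dm l (Gg k) u) => Gk Gl ddk ddl.
  rewrite !mulmxDr !mulmxDl !mulNmx !mulmxDl !mulmxA.
  move: (Gk *m Gl) (Gl *m Gk) (dk *m G') (dl *m G') => x1 x2 x3 x4.
  move: (Gk *m Wl *m G') (Gl *m Wk *m G') (Wl *m Gk^T *m G') (Wk *m Gl^T *m G') => y1 y2 y3 y4.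
  move: (Wl *m G' *m Gk) (Wk *m G' *m Gl) (Wk *m G' *m Wl *m G') (Wl *m G' *m Wk *m G') => z1 z2 z3 z4.
  by apply/matrixP => i j; rewrite !mxE; ring.
by rewrite -mulmxA mulVmx ?mulmx1// (metric_unit mg).
Qed.

Lemma CWE k l u : U u -> CW k l u =
  wedge (be u *m ecol k) (X1 l u) + wedge (b u) (cov Gg k (X1 l) u)
  + (wedge (et u *m ecol k) (X2 l u) + wedge (nu u) (cov Gg k (X2 l) u)).
Proof.
move=> Uu; have sX1 := msmooth_X1 l; have sX2 := msmooth_X2 l.
have outer (x y : point -> 'cV[R]_n) : msmooth U x -> msmooth U y ->
    dm k (fun p => x p *m (y p)^T) u = cov Gg k x u *m (y u)^T + x u *m (cov Gg k y u)^T
     - Gg k u *m (x u *m (y u)^T) - x u *m (y u)^T *m (Gg k u)^T.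
  move=> sx sy; have syt := msmooth_tr oU sy.
  rewrite (dmxM oU Uu)// dmx_tr /cov trmx_add trmx_mul mulmxDl mulmxDr !mulmxA.
  move: (dm k x u *m _) (x u *m (dm k y u)^T) (_ *m _ *m _) (_ *m _ *m _) => x1 x2 x3 x4.
  by apply/matrixP => i j; rewrite !mxE; ring.
have sm (x y : point -> 'cV[R]_n) : msmooth U x -> msmooth U y ->
    msmooth U (fun p => x p *m (y p)^T).
  by move=> sx sy; apply: msmoothM => //; apply: msmooth_tr.
have sm2 (x y : point -> 'cV[R]_n) : msmooth U x -> msmooth U y ->
    msmooth U (fun p => x p *m (y p)^T - y p *m (x p)^T).
  by move=> sx sy; apply: msmoothB => //; apply: sm.
rewrite /CW /rW (dmxD Uu); [|exact: sm2|exact: sm2].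
rewrite (dmxB oU Uu); [|exact: sm|exact: sm].
rewrite (dmxB oU Uu); [|exact: sm|exact: sm].
rewrite !outer// (covb k Uu) (covnu k Uu) /wedge.
move: (cov Gg k (X1 l) u) (cov Gg k (X2 l) u) (be u *m _) (et u *m _) => c1 c2 bk nk.
rewrite !mulmxDr !mulmxDl !mulmxN !mulNmx.
move: (X1 l u) (X2 l u) (b u) (nu u) (Gg k u) => x1 x2 bb nn G'.
move: (G' *m (bb *m x1^T)) (G' *m (x1 *m bb^T)) (G' *m (nn *m x2^T)) (G' *m (x2 *m nn^T)) => y1 y2 y3 y4.
move: (bb *m x1^T *m G'^T) (x1 *m bb^T *m G'^T) (nn *m x2^T *m G'^T) (x2 *m nn^T *m G'^T) => z1 z2 z3 z4.
move: (bk *m _) (bb *m _) (c1 *m _) (x1 *m _) (nk *m _) (nn *m _) (c2 *m _) (x2 *m _) => *.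
by apply/matrixP => i j; rewrite !mxE; ring.
Qed.

Lemma wedge_mul (x y z w : 'cV[R]_n) u : x *m y^T *m invmx (g u) *m (z *m w^T) = dt u y z *: (x *m w^T).
Proof.
rewrite -!mulmxA (mulmxA (invmx _)) (mulmxA y^T) (mulmxA y^T) [y^T *m _ *m z]mx11_scalar.
by rewrite mul_scalar_mx -scalemxAr.
Qed.

(** The derivatives of [X1] and [X2] enter only antisymmetrized, so [torsion1] and [torsion2] remove
    them; combined with the commutator of [rW] they leave only the terms quadratic in [b] and
    [nu]. *)
Lemma curv_Gp k l u : U u -> conn_curv Gp k l u *m g u =
  wedge (be u *m ecol k) (X1 l u) - wedge (be u *m ecol l) (X1 k u)
  + wedge (et u *m ecol k) (X2 l u) - wedge (et u *m ecol l) (X2 k u)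
  - (dt u (b u) (b u) *: wedge (X1 k u) (X1 l u)
     + dt u (b u) (nu u) *: (wedge (X1 k u) (X2 l u) + wedge (X2 k u) (X1 l u))
     + dt u (nu u) (nu u) *: wedge (X2 k u) (X2 l u)).
Proof.
move=> Uu; rewrite curv_Gp_CW// !CWE//.
have := torsion1 k l Uu; have := torsion2 k l Uu.
move: (cov Gg k (X1 l) u) (cov Gg l (X1 k) u) => c1 c2.
move: (cov Gg k (X2 l) u) (cov Gg l (X2 k) u) => c3 c4 /eqP.
rewrite subr_eq => /eqP -> /eqP; rewrite subr_eq => /eqP ->.
have h1 := comm_dot k l Uu (selfadj_kk Uu) (selfadj_kk Uu) erefl.
have h2 := comm_dot k l Uu (selfadj_k2 Uu) (selfadj_kk Uu) (esym (kk_k2 Uu)).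
have h3 := comm_dot k l Uu (selfadj_k2 Uu) (selfadj_k2 Uu) erefl.
rewrite -!/(X1 _ u) -!/(X2 _ u) in h1 h2 h3.
have dC x y := dotC mg x y Uu; rewrite /rW /wedge; move: h1 h2 h3.
move: (be u *m _) (be u *m _) (et u *m _) (et u *m _) => bk bl ek el.
move: (X1 k u) (X1 l u) (X2 k u) (X2 l u) (b u) (nu u) => x1 x2 y1 y2 bb nn h1 h2 h3.
rewrite !mulmxDl !mulNmx !mulmxDr !mulmxN !wedge_mul.
rewrite (dC x1 bb) (dC x2 bb) (dC y1 bb) (dC y2 bb).
rewrite (dC x1 nn) (dC x2 nn) (dC y1 nn) (dC y2 nn).
rewrite (dC nn bb) (dC x2 x1) (dC y2 y1) (dC x2 y1) (dC x1 y2) -h2.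
move: (dt u bb x1) (dt u bb x2) (dt u nn x1) (dt u nn x2).
move: (dt u bb y1) (dt u bb y2) (dt u nn y1) (dt u nn y2).
move: (dt u x1 x2) (dt u y1 y2) (dt u y1 x2).
move: (dt u bb bb) (dt u bb nn) (dt u nn nn).
move=> *; apply/matrixP => i j; rewrite !mxE !big_ord1 !mxE; ring.
Qed.

Hypotheses (QE : forall u, U u -> Q u = 2^-1 * dt u (b u) (b u))
  (RE : forall u, U u -> Rf u = 2^-1 * dt u (nu u) (nu u))
  (PSE : forall u, U u -> P u + S u = dt u (b u) (nu u)).

(** By [conn_curvE] and [rgtE] the curvature is that of [Gp] conjugated by [ki], which sends [X1] to
    e, [X2] to vt e, and the columns of [be], [et] to those of [rla], [rmu] plus multiples of e and
    vt e. The extra terms have coefficients 2 Q, P + S and 2 [Rf], and the normalization cancels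
    them against the quadratic terms of [curv_Gp]. *)
Lemma curvature_rgt u i j k l : U u ->
  let d := fun i j : 'I_n => (i == j)%:R : R in
  curvature rgt u i j k l =
          rla u i k * d j l + rla u j l * d i k
          - rla u j k * d i l - rla u i l * d j k
          + rmu u i k * rvt u j l + rmu u j l * rvt u i k
          - rmu u j k * rvt u i l - rmu u i l * rvt u j k.
Proof.
move=> Uu d; rewrite (curvatureE metric_rgt)//.
have -> : conn_curv (Gam rgt) k l u = conn_curv Gt k l u.
  by rewrite /conn_curv !Gam_rgt// !(dmx_eq oU Uu _ (@Gam_rgt _)).
rewrite (conn_curvE oU k l Uu msmooth_Gp msmooth_Gt msmooth_kk kik msmooth_ki)//.
rewrite rgtE// -!mulmxA (mulmxA (kk u)) kki// mul1mx (mulmxA (conn_curv _ _ _ _)) curv_Gp//.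
rewrite mulmxA.
have kiX1 q : ki u *m X1 q u = ecol q by rewrite /X1 mulmxA kik// mul1mx.
have kiX2 q : ki u *m X2 q u = rvt u *m ecol q by rewrite /X2 mulmxA ki_k2.
have kibe q : ki u *m (be u *m ecol q) = rla u *m ecol q + Q u *: ecol q + S u *: (rvt u *m ecol q).
  rewrite mulmxA -(comm_ki Uu (esym (cvb Uu))) la_ki// !mulmxDl !mulNmx -!scalemxAl mul1mx.
  by rewrite addrAC subrK subrK.
have kiet q : ki u *m (et u *m ecol q) = rmu u *m ecol q + P u *: ecol q + Rf u *: (rvt u *m ecol q).
  rewrite mulmxA -(comm_ki Uu (esym (cve Uu))) mu_ki// !mulmxDl !mulNmx -!scalemxAl mul1mx.
  by rewrite addrAC subrK subrK.
pose f X := ki u *m X *m (ki u)^T; rewrite -/(f _).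
have fD X Y : f (X + Y) = f X + f Y by rewrite /f mulmxDr mulmxDl.
have fN X : f (- X) = - f X by rewrite /f mulmxN mulNmx.
have fZ c X : f (c *: X) = c *: f X by rewrite /f -scalemxAr -scalemxAl.
have fw x y : f (wedge x y) = wedge (ki u *m x) (ki u *m y) by exact: wedge_ki.
move: f fD fN fZ fw => f fD fN fZ fw.
rewrite !(fD, fN, fZ, fw) !kiX1 !kiX2 !kibe !kiet.
have Pe : P u = dt u (b u) (nu u) - S u by rewrite -PSE// addrK.
rewrite Pe (QE Uu) (RE Uu).
have wE (x y : 'cV[R]_n) p q : wedge x y p q = x p 0 * y q 0 - y p 0 * x q 0.
  by rewrite /wedge !mxE !big_ord1 !mxE.
have dE p q : d p q = ecol q p 0 by rewrite /ecol /d mxE eqxx andbT.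
rewrite !dE.
move: (rla u) (rmu u) (rvt u) => la mu vt.
rewrite -(mul_ecol la k i) -(mul_ecol la l j) -(mul_ecol la k j) -(mul_ecol la l i).
rewrite -(mul_ecol mu k i) -(mul_ecol mu l j) -(mul_ecol mu k j) -(mul_ecol mu l i).
rewrite -(mul_ecol vt k i) -(mul_ecol vt l j) -(mul_ecol vt k j) -(mul_ecol vt l i).
move: (la *m ecol k) (la *m ecol l) (mu *m ecol k) (mu *m ecol l) (vt *m ecol k) (vt *m ecol l).
move: (ecol k) (ecol l) (dt u _ _) (dt u _ _) (dt u _ _) => *.
have mD (X Y : 'M[R]_n) : (X + Y) i j = X i j + Y i j by rewrite mxE.
have mN (X : 'M[R]_n) : (- X) i j = - X i j by rewrite mxE.
have mZ c (X : 'M[R]_n) : (c *: X) i j = c * X i j by rewrite mxE.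
rewrite !(mD, mN, mZ, wE).
have cD (X Y : 'cV[R]_n) p : (X + Y) p 0 = X p 0 + Y p 0 by rewrite mxE.
have cZ c (X : 'cV[R]_n) p : (c *: X) p 0 = c * X p 0 by rewrite mxE.
rewrite !(cD, cZ).
by field.
Qed.

(* Gam rgt is the transform of Gp under the change of frame kk. *)
Lemma rgt_closed (w : point -> 'M[R]_n) k l u : U u -> msmooth U w ->
  cov Gp k (fun p => (kk p *m w p) *m ecol l) u = cov Gp l (fun p => (kk p *m w p) *m ecol k) u ->
  cov (Gam rgt) k (fun p => w p *m ecol l) u = cov (Gam rgt) l (fun p => w p *m ecol k) u.
Proof.
move=> Uu sw E.
have swe j : msmooth U (fun p => w p *m ecol j) by exact: msmoothM.
have h i j : cov (Gam rgt) i (fun p => w p *m ecol j) u =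
    ki u *m cov Gp i (fun p => (kk p *m w p) *m ecol j) u.
  rewrite {1}/cov Gam_rgt// -/(cov Gt i (fun p => w p *m ecol j) u).
  rewrite (cov_gauge (Gm := Gp) oU Uu msmooth_kk (kik Uu))//; congr (_ *m _).
  by apply: (cov_eq oU _ _ Uu) => p Up; rewrite mulmxA.
by rewrite !h E.
Qed.

Lemma rgt_closed_id k l u : U u ->
  cov (Gam rgt) k (fun p => 1%:M *m ecol l) u = cov (Gam rgt) l (fun p => 1%:M *m ecol k) u.
Proof.
move=> Uu; apply: (@rgt_closed (fun=> 1%:M)) => //.
have E i j : cov Gp i (fun p => (kk p *m 1%:M) *m ecol j) u = cov Gp i (X1 j) u.
  by apply: (cov_eq oU _ _ Uu) => p Up; rewrite mulmx1.
by rewrite !E closed_kk.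
Qed.

Lemma rgt_closed_vt k l u : U u ->
  cov (Gam rgt) k (fun p => rvt p *m ecol l) u = cov (Gam rgt) l (fun p => rvt p *m ecol k) u.
Proof.
move=> Uu; apply: rgt_closed => //; first exact: msmooth_vt.
have E i j : cov Gp i (fun p => (kk p *m rvt p) *m ecol j) u = cov Gp i (X2 j) u.
  by apply: (cov_eq oU _ _ Uu) => p Up; rewrite kk_vt.
by rewrite !E closed_k2.
Qed.

Lemma rgt_closed_la k l u : U u ->
  cov (Gam rgt) k (fun p => rla p *m ecol l) u = cov (Gam rgt) l (fun p => rla p *m ecol k) u.
Proof.
by move=> Uu; apply: rgt_closed => //; [exact: msmooth_la|exact: closed_la].
Qed.

Lemma rgt_closed_mu k l u : U u ->
  cov (Gam rgt) k (fun p => rmu p *m ecol l) u = cov (Gam rgt) l (fun p => rmu p *m ecol k) u.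
Proof.
by move=> Uu; apply: rgt_closed => //; [exact: msmooth_mu|exact: closed_mu].
Qed.

Lemma rgt_selfadj u w : U u -> selfadj g u w -> w *m kk u = kk u *m w -> selfadj rgt u w.
Proof.
move=> Uu sw wk; rewrite /selfadj invmx_rgt /rgt_cov -(mulmxA _ (kk u) w) -wk (mulmxA _ w) -(mulmxA _ _ w).
by rewrite sw (mulmxA _ w^T) -trmx_mul wk trmx_mul !mulmxA.
Qed.

Lemma rgt_selfadj_vt u : U u -> selfadj rgt u (rvt u).
Proof.
by move=> Uu; apply: rgt_selfadj => //; [exact: selfadj_vt|apply: comm_kk; exact: vt_v].
Qed.
Lemma rgt_selfadj_la u : U u -> selfadj rgt u (rla u).
Proof.
by move=> Uu; apply: rgt_selfadj => //; [exact: selfadj_la|apply: comm_kk; exact: la_v].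
Qed.
Lemma rgt_selfadj_mu u : U u -> selfadj rgt u (rmu u).
Proof.
by move=> Uu; apply: rgt_selfadj => //; [exact: selfadj_mu|apply: comm_kk; exact: mu_v].
Qed.

(* The density h and its flux f become (h M - f N) / D and (B f - A h) / D. *)
Section Density.
Context (h f : point -> R) (gh : point -> 'cV[R]_n).
Hypotheses (sh : smooth U h) (sf : smooth U f) (sgh : msmooth U gh).
Hypothesis covgh : forall k u, U u -> cov Gg k gh u = v u *m ecol k.
Hypotheses (pdh : forall k u, U u -> pd k h u = dt u (gh u) (ecol k))
  (pdf : forall k u, U u -> pd k f u = dt u (gh u) (v u *m ecol k)).

Definition rht u : R := (h u * M u - f u * N u) / rD u.
Definition rft u : R := (B u * f u - A u * h u) / rD u.
Definition rx u : 'cV[R]_n := gh u - rht u *: b u - rft u *: nu u.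

Lemma smooth_rht : smooth U rht.
Proof.
apply: (smoothM oU _ smooth_rDV).
by apply: smoothB => //; exact: smoothM.
Qed.
Lemma smooth_rft : smooth U rft.
Proof.
apply: (smoothM oU _ smooth_rDV).
by apply: smoothB => //; exact: smoothM.
Qed.
Lemma msmooth_rx : msmooth U rx.
Proof.
have s1' := smooth_rht; have s2' := smooth_rft.
by apply: msmoothB => //; [apply: msmoothB => //|]; exact: msmoothZ.
Qed.

(** With [fE]: the 1-form h dx + f dt rewritten in the differentials of the new variables has
    coefficients [rht] and [rft]. *)
Let hE u : U u -> h u = rht u * B u + rft u * N u.
Proof. by move=> Uu; rewrite /rht /rft; have := nz Uu; rewrite /rD => ?; field. Qed.
Let fE u : U u -> f u = rht u * A u + rft u * M u.
Proof. by move=> Uu; rewrite /rht /rft; have := nz Uu; rewrite /rD => ?; field. Qed.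

Lemma pd_eq (f1 f2 : point -> R) k u : U u -> (forall p, U p -> f1 p = f2 p) ->
  pd k f1 u = pd k f2 u.
Proof. by move=> Uu E; apply: near_eq_derive; exact: open_near oU Uu E. Qed.
Lemma pdD (f1 f2 : point -> R) k u : U u -> smooth U f1 -> smooth U f2 ->
  pd k (fun p => f1 p + f2 p) u = pd k f1 u + pd k f2 u.
Proof.
move=> Uu sf1 sf2; rewrite /pd deriveD//.
  exact: smooth_derivable sf1 Uu.
exact: smooth_derivable sf2 Uu.
Qed.
Lemma pdBB (f1 f2 : point -> R) k u : U u -> smooth U f1 -> smooth U f2 ->
  pd k (fun p => f1 p - f2 p) u = pd k f1 u - pd k f2 u.
Proof.
move=> Uu sf1 sf2; rewrite /pd deriveB//.
  exact: smooth_derivable sf1 Uu.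
exact: smooth_derivable sf2 Uu.
Qed.
Lemma pdMM (f1 f2 : point -> R) k u : U u -> smooth U f1 -> smooth U f2 ->
  pd k (fun p => f1 p * f2 p) u = pd k f1 u * f2 u + f1 u * pd k f2 u.
Proof. by move=> Uu sf1 sf2; rewrite /pd (deriveMs Uu). Qed.

(** Differentiating [hE] and [fE] gives two linear equations for the two derivatives. The deviations
    from the claimed values solve the homogeneous system with rows (B, N), (A, M), whose determinant
    is not zero. *)
Lemma pd_rht_rft k u : U u ->
  pd k rht u = dt u (rx u) (X1 k u) /\ pd k rft u = dt u (rx u) (X2 k u).
Proof.
move=> Uu; have s1' := smooth_rht; have s2' := smooth_rft.
have sm (f1 f2 : point -> R) : smooth U f1 -> smooth U f2 -> smooth U (fun p => f1 p * f2 p).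
  by move=> *; exact: smoothM.
have Eh : pd k h u = pd k rht u * B u + rht u * pd k B u + (pd k rft u * N u + rft u * pd k N u).
  rewrite (pd_eq k Uu hE) (pdD k Uu); [|exact: sm|exact: sm].
  by rewrite (pdMM k Uu s1' sB) (pdMM k Uu s2' sN).
have Ef : pd k f u = pd k rht u * A u + rht u * pd k A u + (pd k rft u * M u + rft u * pd k M u).
  rewrite (pd_eq k Uu fE) (pdD k Uu); [|exact: sm|exact: sm].
  by rewrite (pdMM k Uu s1' sA) (pdMM k Uu s2' sM).
rewrite pdh// pdB// pdN// {1}(eX k Uu) dotDr !dotZr in Eh.
rewrite pdf// pdA// pdM// {1}(vX k Uu) dotDr !dotZr in Ef.
rewrite /rx !(dotDl, dotNl, dotZl).
have D0 := nz Uu; rewrite /rD in D0.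
move: (pd k rht u) (pd k rft u) Eh Ef => a c.
move: (dt u (gh u) (X1 k u)) (dt u (gh u) (X2 k u)) (dt u (b u) (X1 k u)) (dt u (b u) (X2 k u)).
move: (dt u (nu u) (X1 k u)) (dt u (nu u) (X2 k u)).
move=> n1 n2 g1 g2 b1 b2 Eh Ef.
have Eh' : B u * (a - (g1 - rht u * b1 - rft u * n1)) + N u * (c - (g2 - rht u * b2 - rft u * n2)) = 0.
  by apply/eqP; rewrite -subr_eq0; apply/eqP; rewrite -(subrr (B u * g1 + N u * g2)) {1}Eh; ring.
have Ef' : A u * (a - (g1 - rht u * b1 - rft u * n1)) + M u * (c - (g2 - rht u * b2 - rft u * n2)) = 0.
  by apply/eqP; rewrite -subr_eq0; apply/eqP; rewrite -(subrr (A u * g1 + M u * g2)) {1}Ef; ring.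
split; apply/eqP; rewrite -subr_eq0; apply/eqP; apply: (mulfI D0); rewrite mulr0.
  by rewrite -[RHS](subrr 0) -{1}(mulr0 (M u)) -{1}Eh' -{1}(mulr0 (N u)) -{1}Ef'; ring.
by rewrite -[RHS](subrr 0) -{1}(mulr0 (B u)) -{1}Ef' -{1}(mulr0 (A u)) -{1}Eh'; ring.
Qed.

Let pdht k u (Uu : U u) := (pd_rht_rft k Uu).1.
Let pdft k u (Uu : U u) := (pd_rht_rft k Uu).2.

(** The terms along [b] and [nu] that come from differentiating [rht] and [rft] cancel against those
    of [rW] applied to [rx]. *)
Lemma cov_rx k u : U u -> cov Gp k rx u =
  v u *m ecol k - rht u *: (be u *m ecol k) - rft u *: (et u *m ecol k)
  - dt u (b u) (rx u) *: X1 k u - dt u (nu u) (rx u) *: X2 k u.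
Proof.
move=> Uu; have s1' := smooth_rht; have s2' := smooth_rft.
have sz (f1 : point -> R) (Z : point -> 'cV[R]_n) : smooth U f1 -> msmooth U Z ->
   msmooth U (fun p => f1 p *: Z p) by move=> *; exact: msmoothZ.
rewrite cov_Gp rW_dot// {1}/rx.
rewrite (covB oU Gg k Uu); [|apply: msmoothB => //; exact: sz|exact: sz].
rewrite (covB oU Gg k Uu)//; last exact: sz.
rewrite (covZ Gg k Uu s1' sb) (covZ Gg k Uu s2' snu) covgh// covb// covnu//.
rewrite pdht// pdft// (dotC mg (X1 k u) _ Uu) (dotC mg (X2 k u) _ Uu).
move: (v u *m ecol k) (be u *m ecol k) (et u *m ecol k) => *.
move: (dt u (rx u) (X1 k u)) (dt u (rx u) (X2 k u)) (dt u (b u) (rx u)) (dt u (nu u) (rx u)) => *.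
move: (b u) (nu u) (X1 k u) (X2 k u) => *.
by apply/matrixP => i j; rewrite !mxE; ring.
Qed.

Lemma gc_rht u : U u -> gc rgt rht u = ki u *m rx u.
Proof.
move=> Uu; rewrite /gc; have -> : grad rht u = (rx u)^T *m invmx (g u) *m kk u.
  apply/matrixP => i j; rewrite (ord1 i) [LHS]mxE pdht// /X1 /dot mulmxA.
  by rewrite mul_ecol.
rewrite !trmx_mul trmxK (metric_inv_sym mg Uu) rgtE// -!mulmxA.
rewrite (mulmxA (ki u)^T) -trmx_mul kki// trmx1 mul1mx (mulmxA (g u)).
by rewrite (mulmxV (metric_unit mg Uu)) mul1mx.
Qed.

(* The integrals of the tail densities la and mu along the gradient of rht, as
   rht and rft are those of 1 and vt. *)
Definition rF1 u : R := dt u (b u) (rx u) - A u + (rht u * Q u + rft u * P u).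
Definition rF3 u : R := 1 + (dt u (nu u) (rx u) - M u + (rht u * S u + rft u * Rf u)).

Lemma smooth_rF1 : smooth U rF1.
Proof.
have s1' := smooth_rht; have s2' := smooth_rft; have sx := msmooth_rx.
apply: smoothD => //; first by apply: smoothB => //; exact: smooth_dot.
by apply: smoothD => //; exact: smoothM.
Qed.
Lemma smooth_rF3 : smooth U rF3.
Proof.
have s1' := smooth_rht; have s2' := smooth_rft; have sx := msmooth_rx.
apply: smoothD => //; first exact: smooth_cst.
apply: smoothD => //; first by apply: smoothB => //; exact: smooth_dot.
by apply: smoothD => //; exact: smoothM.
Qed.

(** The Hessian is [ki] applied to [cov_rx]; the multiples of 1 and [rvt] left over are absorbed in
    [rF1] and [rF3]. Without the summand 1 in [rF3] the right-hand side would vanish: the whole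
    transformed flow is produced by this integration constant. *)
Lemma hess_rht u : U u -> rvt u =
  hess rgt rht u + (rht u *: rla u + rF1 u *: 1%:M + rft u *: rmu u + rF3 u *: rvt u).
Proof.
move=> Uu; apply: eq_ecol => k; have sx := msmooth_rx.
have skx : msmooth U (fun p => ki p *m rx p) by apply: msmoothM => //; exact: msmooth_ki.
have -> : (hess rgt rht u + (rht u *: rla u + rF1 u *: 1%:M + rft u *: rmu u + rF3 u *: rvt u)) *m ecol k
  = hess rgt rht u *m ecol k + (rht u *: (rla u *m ecol k) + rF1 u *: ecol k
      + rft u *: (rmu u *m ecol k) + rF3 u *: (rvt u *m ecol k)).
  move: (hess rgt rht u) (rla u) (rmu u) (rvt u) => *.
  by rewrite !mulmxDl -!scalemxAl mul1mx.
rewrite (hess_cov oU metric_rgt k Uu smooth_rht) (cov_eq oU _ _ Uu gc_rht).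
rewrite {1}/cov Gam_rgt// -/(cov Gt k (fun p => ki p *m rx p) u).
rewrite (cov_gauge (Gm := Gp) oU Uu msmooth_kk (kik Uu))//.
rewrite (cov_eq oU Gp k Uu (Z := rx)); last by move=> p Up; rewrite mulmxA kki// mul1mx.
rewrite cov_rx//.
have kiX1 q : ki u *m X1 q u = ecol q by rewrite /X1 mulmxA kik// mul1mx.
have kiX2 q : ki u *m X2 q u = rvt u *m ecol q by rewrite /X2 mulmxA ki_k2.
have kibe q : ki u *m (be u *m ecol q) = rla u *m ecol q + Q u *: ecol q + S u *: (rvt u *m ecol q).
  rewrite mulmxA -(comm_ki Uu (esym (cvb Uu))) la_ki// !mulmxDl !mulNmx -!scalemxAl mul1mx.
  by rewrite addrAC subrK subrK.
have kiet q : ki u *m (et u *m ecol q) = rmu u *m ecol q + P u *: ecol q + Rf u *: (rvt u *m ecol q).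
  rewrite mulmxA -(comm_ki Uu (esym (cve Uu))) mu_ki// !mulmxDl !mulNmx -!scalemxAl mul1mx.
  by rewrite addrAC subrK subrK.
have kiv q : ki u *m (v u *m ecol q) = A u *: ecol q + M u *: (rvt u *m ecol q).
  by rewrite vX// mulmxDr -!scalemxAr kiX1 kiX2.
pose f0 (x : 'cV[R]_n) := ki u *m x; rewrite -/(f0 _).
have fD x y : f0 (x + y) = f0 x + f0 y by rewrite /f0 mulmxDr.
have fN x : f0 (- x) = - f0 x by rewrite /f0 mulmxN.
have fZ c x : f0 (c *: x) = c *: f0 x by rewrite /f0 -scalemxAr.
have h1 : f0 (X1 k u) = _ := kiX1 k; have h2 : f0 (X2 k u) = _ := kiX2 k.
have h3 : f0 (be u *m ecol k) = _ := kibe k; have h4 : f0 (et u *m ecol k) = _ := kiet k.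
have h5 : f0 (v u *m ecol k) = _ := kiv k.
move: f0 fD fN fZ h1 h2 h3 h4 h5 => f0 fD fN fZ h1 h2 h3 h4 h5.
rewrite !(fD, fN, fZ) h1 h2 h3 h4 h5 /rF1 /rF3.
move: (rla u *m ecol k) (rmu u *m ecol k) (rvt u *m ecol k) (ecol k) => *.
move: (dt u (b u) (rx u)) (dt u (nu u) (rx u)) => *.
by apply/matrixP => i j; rewrite !mxE; ring.
Qed.

Let grad_kk (w : point -> 'M[R]_n) k u : U u ->
  \sum_j w u j k * pd j rht u = dt u (rx u) (kk u *m w u *m ecol k).
Proof.
move=> Uu; rewrite -mulmxA.
have -> : dt u (rx u) (kk u *m (w u *m ecol k)) = (grad rht u *m (w u *m ecol k)) 0 0.
  rewrite /dot !mulmxA; congr ((_ *m _ *m _) 0 0).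
  apply/matrixP => i j; rewrite (ord1 i) [RHS]mxE pdht// /X1 /dot mulmxA.
  by rewrite mul_ecol.
rewrite mulmxA mul_ecol mxE; apply: eq_bigr => j _.
by rewrite mulrC mxE.
Qed.

Lemma pd_rF0 k u : U u -> pd k rht u = \sum_j (1%:M : 'M[R]_n) j k * pd j rht u.
Proof. by move=> Uu; rewrite (grad_kk (fun=> 1%:M))// mulmx1 pdht. Qed.

Lemma pd_rF2 k u : U u -> pd k rft u = \sum_j rvt u j k * pd j rht u.
Proof. by move=> Uu; rewrite grad_kk// kk_vt// pdft. Qed.

(** By [cov_rx] the derivatives of A, Q and P cancel, and along [X1] and [X2] there remain Q - <b,
    b> and P - <b, nu>. The normalization turns them into -Q and -S, the coefficients in [kk_la]. *)
Lemma pd_rF1 k u : U u -> pd k rF1 u = \sum_j rla u j k * pd j rht u.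
Proof.
move=> Uu; rewrite grad_kk// kk_la//.
have s1' := smooth_rht; have s2' := smooth_rft; have sx := msmooth_rx.
have sm (f1 f2 : point -> R) : smooth U f1 -> smooth U f2 -> smooth U (fun p => f1 p * f2 p).
  by move=> *; exact: smoothM.
have sd : smooth U (fun p => dt p (b p) (rx p)) by exact: smooth_dot.
rewrite /rF1 (pdD k Uu); [|exact: smoothB|by apply: smoothD => //; exact: sm].
rewrite (pdD k Uu (sm _ _ s1' sQ) (sm _ _ s2' sP)).
rewrite (pdBB k Uu sd sA) (pdMM k Uu s1' sQ) (pdMM k Uu s2' sP) (pd_dotE oU mg k Uu)//.
have cx : cov Gg k rx u = cov Gp k rx u - rW k u *m invmx (g u) *m rx u.
  by rewrite cov_Gp addrK.
rewrite cx cov_rx// rW_dot// covb// pdht// pdft// pdA0// pdQ0// pdP0//.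
have Pe : P u = dt u (b u) (nu u) - S u by rewrite -PSE// addrK.
rewrite 2!mulmxBl -(scalemxAl (Q u)) -(scalemxAl (S u)) -!/(X1 k u) -!/(X2 k u).
rewrite (dotC mg (X1 k u) _ Uu) (dotC mg (X2 k u) _ Uu).
rewrite !(dotDr, dotDl, dotNr, dotNl, dotZr, dotZl) (QE Uu).
rewrite (dotC mg (be u *m ecol k) (gh u) Uu) (dotC mg (be u *m ecol k) (b u) Uu).
rewrite (dotC mg (be u *m ecol k) (nu u) Uu) (dotC mg (nu u) (b u) Uu) Pe.
by field.
Qed.

(** As for [rF1], with <nu, nu> = 2 [Rf], and with the normalization of P + S now used to eliminate
    S. *)
Lemma pd_rF3 k u : U u -> pd k rF3 u = \sum_j rmu u j k * pd j rht u.
Proof.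
move=> Uu; rewrite grad_kk// kk_mu//.
have s1' := smooth_rht; have s2' := smooth_rft; have sx := msmooth_rx.
have sm (f1 f2 : point -> R) : smooth U f1 -> smooth U f2 -> smooth U (fun p => f1 p * f2 p).
  by move=> *; exact: smoothM.
have sd : smooth U (fun p => dt p (nu p) (rx p)) by exact: smooth_dot.
rewrite /rF3 (pdD k Uu); [|exact: smooth_cst|apply: smoothD => //; [exact: smoothB|by apply: smoothD => //; exact: sm]].
rewrite [pd k (fun=> 1) u]derive_cst add0r (pdD k Uu); [|exact: smoothB|by apply: smoothD => //; exact: sm].
rewrite (pdD k Uu (sm _ _ s1' sS) (sm _ _ s2' sR)).
rewrite (pdBB k Uu sd sM) (pdMM k Uu s1' sS) (pdMM k Uu s2' sR) (pd_dotE oU mg k Uu)//.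
have cx : cov Gg k rx u = cov Gp k rx u - rW k u *m invmx (g u) *m rx u.
  by rewrite cov_Gp addrK.
rewrite cx cov_rx// rW_dot// covnu// pdht// pdft// pdM0// pdS0// pdR0//.
have Se : S u = dt u (b u) (nu u) - P u by rewrite -PSE// addrAC subrr add0r.
rewrite 2!mulmxBl -(scalemxAl (P u)) -(scalemxAl (Rf u)) -!/(X1 k u) -!/(X2 k u).
rewrite (dotC mg (X1 k u) _ Uu) (dotC mg (X2 k u) _ Uu).
rewrite !(dotDr, dotDl, dotNr, dotNl, dotZr, dotZl) (RE Uu).
rewrite (dotC mg (et u *m ecol k) (gh u) Uu) (dotC mg (et u *m ecol k) (b u) Uu).
rewrite (dotC mg (et u *m ecol k) (nu u) Uu) (dotC mg (nu u) (b u) Uu) Se.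
by field.
Qed.

End Density.

End Reciprocal.

(** * The transformed system *)

Section Transform.
Context {R : realType} {n : nat}.
Notation point := 'rV[R]_n.

Lemma actE (a : 'M[R]_n) (w : 'rV[R]_n) : act a w = w *m a^T.
Proof. by apply/rowP => i; rewrite !mxE; apply: eq_bigr => k _; rewrite mxE mulrC. Qed.

(** Put u_x = B w_X + N w_T and u_t = A w_X + M w_T into u_t = v u_x: then (M - N v) w_T = (B v - A)
    w_X, and the left factor is cancelled. *)
Lemma reciprocal_transform_of (U : set point) (B A N M : point -> R)
    (v vt : point -> 'M[R]_n) :
  (forall u, U u -> M u *: 1%:M - N u *: v u \in unitmx) ->
  (forall u, U u -> (M u *: 1%:M - N u *: v u) *m vt u = B u *: v u - A u *: 1%:M) ->
  reciprocal_transform U B A N M v vt.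
Proof.
move=> uK Kvt O u w X T oO OU sol rec uw dw _ [p Op <-].
have Up := OU p Op.
split; first exact: dw.
have [dX dT [X1 X2] [T1 T2]] := rec p Op.
have [du ut] := sol p Op.
have dXT : differentiable (fun q => (X q, T q)) p by exact: differentiable_pair.
have chain (e : R * R) : 'D_e u p = 'D_e X p *: 'D_((1, 0) : R * R) w (X p, T p)
     + 'D_e T p *: 'D_((0, 1) : R * R) w (X p, T p).
  have -> : 'D_e u p = 'D_e (fun q => w (X q, T q)) p.
    by apply: near_eq_derive; apply: open_near oO Op uw.
  rewrite deriveE; last exact: (differentiable_comp dXT (dw p Op)).
  have -> : 'd (fun q => w (X q, T q)) p = 'd w (X p, T p) \o 'd (fun q => (X q, T q)) p :> (R * R -> _).
    exact: (diff_comp dXT (dw p Op)).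
  rewrite /= diff_pair// -(deriveE _ dX) -(deriveE _ dT).
  have -> : ('D_e X p, 'D_e T p) = 'D_e X p *: ((1, 0) : R * R) + 'D_e T p *: ((0, 1) : R * R).
    by apply/eqP; rewrite xpair_eqE /= !scaler0 addr0 add0r /GRing.scale /= !mulr1 !eqxx.
  rewrite linearD !linearZ /=.
  by rewrite -!deriveE//; exact: dw.
have e1 := chain (1, 0); have e2 := chain (0, 1).
rewrite X1 T1 in e1; rewrite X2 T2 in e2.
rewrite ut e1 in e2; move: e2; rewrite -(uw p Op).
move: ('D_(1, 0) w _) ('D_(0, 1) w _) => wx wt; rewrite !actE => e2.
have kU : (M (u p) *: 1%:M - N (u p) *: v (u p))^T \in unitmx by rewrite unitmx_tr uK.
apply: (can_inj (mulmxK kU)); rewrite -mulmxA -trmx_mul Kvt// !trmx_add !trmx_opp !trmx_scale trmx1.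
rewrite !mulmxDr !mulmxN -!scalemxAr !mulmx1.
move: e2; rewrite mulmxDl -!scalemxAl.
move: (wx *m _) (wt *m _) => a b /eqP; rewrite -subr_eq => /eqP <-.
by rewrite addrAC -addrA opprD addrA; apply/matrixP => i j; rewrite !mxE; ring.
Qed.

(** Along a curve, the local part of the operator applied to a gradient is the Hessian applied to
    u_x, and every tail is its primitive times an affinor; both conditions thus become pointwise on
    [U]. *)
Lemma hamiltonian_system_of (U : set point) (gt : point -> 'M[R]_n) m
    (a b : 'I_m -> point -> 'M[R]_n) (V : point -> 'M[R]_n) (ht : point -> R)
    (F : 'I_m -> point -> R) :
  open U -> metric U gt -> smooth U ht -> (forall al, smooth U (F al)) ->
  (forall u, U u -> V u = hess gt ht u + \sum_al F al u *: a al u) ->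
  (forall al u k, U u -> pd k (F al) u = \sum_j b al u j k * pd j ht u) ->
  hamiltonian_system U gt a b V ht.
Proof.
move=> oU mg sh sF VE FE; exists F; split=> // u su uU x.
have du : differentiable u x by apply: smooth_diff su I.
have D1 (f : point -> R) : smooth U f ->
    is_derive x (1 : R) (fun y => f (u y)) (\sum_k (derive1 u x) 0 k * pd k f (u x)).
  move=> sf; have df := smooth_diff sf (uU x).
  apply: DeriveDef; first by apply: diff_derivable; exact: (differentiable_comp du df).
  apply: etrans (derive_comp (1 : R) du df) _; apply: etrans (derive_rV _ df) _.
  by apply: eq_bigr => k _; rewrite derive1E.
split=> [al|].
  apply: (is_derive_eq (D1 _ (sF al))); rewrite /tail_density exchange_big /=.
  apply: eq_bigr => k _; rewrite FE// mulr_sumr; apply: eq_bigr => j _.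
  by rewrite mxE; ring.
have dg j : (derive1 (fun y => grad ht (u y)) x) 0 j =
    \sum_k (derive1 u x) 0 k * pd k (fun p => pd j ht p) (u x).
  have sj i : smooth U (fun p => pd i ht p) by exact: smooth_derive.
  have gE i k : (fun y => grad ht (u y) i k) = (fun y => pd k ht (u y)).
    by apply/funext => y; rewrite mxE.
  have dgu : differentiable (fun y => grad ht (u y)) x.
    apply: differentiable_mx => i k; rewrite gE.
    exact: (differentiable_comp du (smooth_diff (sj k) (uU x))).
  rewrite derive1E; apply: etrans (derive_mxE (1 : R) 0 j dgu) _; rewrite gE.
  exact: (@derive_val _ _ _ _ _ _ _ (D1 _ (sj j))).
have actD (X Y : 'M[R]_n) w : act (X + Y) w = act X w + act Y w.
  by rewrite !actE trmx_add mulmxDr.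
rewrite VE// actD /hydro_op; congr (_ + _).
  apply/rowP => i; rewrite [LHS]mxE [RHS]mxE.
  have -> : \sum_j gt (u x) i j * (derive1 (fun y => grad ht (u y)) x) 0 j =
      \sum_k \sum_s gt (u x) i s * (pd s (fun p => pd k ht p) (u x) * (derive1 u x) 0 k).
    rewrite exchange_big /=; apply: eq_bigr => s _; rewrite dg mulr_sumr.
    by apply: eq_bigr => k _; rewrite (pd_comm oU s k (uU x) sh) [pd k _ _ * _]mulrC.
  have -> : \sum_j \sum_s \sum_k gt (u x) i s * christoffel gt (u x) j s k *
       (derive1 u x) 0 k * grad ht (u x) 0 j =
      \sum_k \sum_s gt (u x) i s * ((\sum_j christoffel gt (u x) j s k * pd j ht (u x))
         * (derive1 u x) 0 k).
    rewrite exchange_big /= [RHS]exchange_big /=; apply: eq_bigr => s _.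
    rewrite exchange_big /=; apply: eq_bigr => k _.
    rewrite mulr_suml mulr_sumr; apply: eq_bigr => j _; rewrite mxE.
    by move: (christoffel _ _ _ _ _) (pd _ _ _) => *; ring.
  rewrite -sumrB; apply: eq_bigr => k _; rewrite mxE mulr_suml -sumrB; apply: eq_bigr => s _.
  by move: (pd s _ _) (\sum_(_ < _) _) => *; ring.
elim/big_rec2: _ => [|al y1 y2 _ <-]; first by rewrite actE trmx0 mulmx0.
by rewrite actD !actE trmx_scale -scalemxAr.
Qed.

End Transform.

(** * The Jacobi identity *)

Section Trivector.
Context {R : fieldType} {n : nat}.
Notation col := 'cV[R]_n.
Notation mat := 'M[R]_n.

Definition sp (x y : col) : R := (x^T *m y) 0 0.

Lemma spT x (M : mat) y : sp x (M *m y) = sp y (M^T *m x).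
Proof.
rewrite /sp; have -> : x^T *m (M *m y) = (y^T *m (M^T *m x))^T.
  by rewrite !trmx_mul !trmxK mulmxA.
by rewrite mxE.
Qed.
Lemma spDl x y z : sp (x + y) z = sp x z + sp y z.
Proof. by rewrite /sp trmx_add mulmxDl mxE. Qed.
Lemma spDr x y z : sp x (y + z) = sp x y + sp x z.
Proof. by rewrite /sp mulmxDr mxE. Qed.
Lemma spNr x y : sp x (- y) = - sp x y.
Proof. by rewrite /sp mulmxN mxE. Qed.

Lemma spZr x c y : sp x (c *: y) = c * sp x y.
Proof. by rewrite /sp -scalemxAr mxE. Qed.
Lemma sp0r x : sp x 0 = 0.
Proof. by rewrite /sp mulmx0 mxE. Qed.
Lemma spMl x (M : mat) y : sp (M *m x) y = sp x (M^T *m y).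
Proof. by rewrite /sp trmx_mul mulmxA. Qed.
Lemma sp_sum (I : Type) (r : seq I) x (F : I -> col) :
  sp x (\sum_(i <- r) F i) = \sum_(i <- r) sp x (F i).
Proof.
elim: r => [|a r IH]; first by rewrite !big_nil sp0r.
by rewrite !big_cons spDr IH.
Qed.

(** The terms with [Gm] cancel in pairs by its symmetry. Among the others, those quadratic in the
    [P] cancel because the [P] commute, and those with [g] because each [P] is self-adjoint. *)
Lemma cyclic_zero (g : mat) (Gm : col -> mat) (P1 P2 P3 : mat) (xi1 xi2 xi3 x1 x2 x3 w : col) :
  g^T = g -> (forall a b, Gm a *m b = Gm b *m a) ->
  P1 *m g = g *m P1^T -> P2 *m g = g *m P2^T -> P3 *m g = g *m P3^T ->
  P1 *m P2 = P2 *m P1 -> P1 *m P3 = P3 *m P1 -> P2 *m P3 = P3 *m P2 ->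
  let X1 := g *m x1 + P1 *m w in
  let X2 := g *m x2 + P2 *m w in
  let X3 := g *m x3 + P3 *m w in
  (sp xi2 (Gm X3 *m X1) - sp xi1 (Gm X3 *m X2) - sp x1 (P2 *m X3) + sp x2 (P1 *m X3)) +
  (sp xi3 (Gm X1 *m X2) - sp xi2 (Gm X1 *m X3) - sp x2 (P3 *m X1) + sp x3 (P2 *m X1)) +
  (sp xi1 (Gm X2 *m X3) - sp xi3 (Gm X2 *m X1) - sp x3 (P1 *m X2) + sp x1 (P3 *m X2)) = 0.
Proof.
move=> gT Gs P1g P2g P3g c12 c13 c23 X1 X2 X3.
rewrite (Gs X1 X3) (Gs X2 X1) (Gs X3 X2) /X1 /X2 /X3 !mulmxDr !spDr !mulmxA.
rewrite c12 c13 c23.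
have s (P : mat) x y : P *m g = g *m P^T -> sp x (P *m g *m y) = sp y (P *m g *m x).
  by move=> E; rewrite spT {1}E trmx_mul trmxK gT.
rewrite (s P2 x3 x1 P2g) (s P3 x2 x1 P3g) (s P1 x3 x2 P1g).
by ring.
Qed.

Context {m : nat} (sg : 'I_m -> 'I_m) (sgK : involutive sg).

(* the Jacobi integrand minus a total derivative, at a point *)
Lemma jacobi_integrand (g Gu Gv dgV CV dCVu dCuV Rm : mat) (a : 'I_m -> mat)
    (av au : 'I_m -> col) (p q : 'I_m -> R) (xi eta x1 x2 w V : col) :
  g^T = g -> dgV = - (Gv *m g + g *m Gv^T) -> CV = - (g *m Gv^T) ->
  dCVu - dCuV = Gv *m g *m Gu^T - Gu *m g *m Gv^T - g *m Rm^T ->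
  (forall al, av al - au al = Gu *m (a al *m V) - Gv *m (a al *m w)) ->
  sp eta (Rm *m g *m xi) =
    \sum_al (sp eta (a al *m V) * sp xi (a (sg al) *m w)
             - sp eta (a al *m w) * sp xi (a (sg al) *m V)) ->
  let xi' := x1 + Gu^T *m xi in
  let eta' := x2 + Gu^T *m eta in
  let P1 := \sum_al p al *: a al in
  let P2 := \sum_al q al *: a al in
  sp xi (dgV *m eta') + sp xi (dCVu *m eta) - sp xi (dCuV *m eta)
  - sp xi' (CV *m eta) - sp xi (CV *m eta')
  + \sum_al (((sp xi (av al) - sp xi (au al)) - sp xi' (a al *m V)) * q al
             - ((sp eta (av al) - sp eta (au al)) - sp eta' (a al *m V)) * p al
             - (sp xi (a al *m V) * sp eta (a (sg al) *m w)
                - sp eta (a al *m V) * sp xi (a (sg al) *m w)))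
  = sp eta (Gv *m (g *m x1 + P1 *m w)) - sp xi (Gv *m (g *m x2 + P2 *m w))
    - sp x1 (P2 *m V) + sp x2 (P1 *m V).
Proof.
move=> gT dgE CE dCE avE RE xi' eta' P1 P2.
have sub (y z t : col) (M N : mat) : sp y (M *m z) - sp y (N *m z) = sp y ((M - N) *m z).
  by rewrite mulmxBl spDr spNr.
have h1 : sp xi (dgV *m eta') - sp xi (CV *m eta') =
    - sp xi (Gv *m (g *m x2)) - sp xi (Gv *m g *m Gu^T *m eta).
  rewrite sub// dgE CE opprK opprD subrK mulNmx spNr mulmxDr spDr opprD !mulmxA.
  by [].
have h2 : - sp xi' (CV *m eta) = sp eta (Gv *m (g *m x1)) + sp xi (Gu *m g *m Gv^T *m eta).
  rewrite CE mulNmx spNr opprK /xi' spDl; congr (_ + _).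
    by rewrite [LHS]spT trmx_mul trmxK gT mulmxA.
  by rewrite spMl trmxK !mulmxA.
(* The second derivatives of the metric appear only through the curvature [Rm], which the Gauss
   equation [RE] turns into products of tail densities. *)
have h3 : sp xi (dCVu *m eta) - sp xi (dCuV *m eta) =
    sp xi (Gv *m g *m Gu^T *m eta) - sp xi (Gu *m g *m Gv^T *m eta) - sp eta (Rm *m g *m xi).
  rewrite sub// dCE !mulmxDl !mulNmx !spDr !spNr; congr (_ - _).
  by rewrite [LHS]spT trmx_mul trmxK gT.
have tail (y z z' : col) (r : 'I_m -> R) : z' = z + Gu^T *m y ->
    \sum_al ((sp y (av al) - sp y (au al)) - sp z' (a al *m V)) * r al =
    - sp y (Gv *m ((\sum_al r al *: a al) *m w)) - sp z ((\sum_al r al *: a al) *m V).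
  move=> ->; have -> : (\sum_al r al *: a al) *m V = \sum_al r al *: (a al *m V).
    by rewrite mulmx_suml; apply: eq_bigr => i _; rewrite -scalemxAl.
  have -> : Gv *m ((\sum_al r al *: a al) *m w) = \sum_al r al *: (Gv *m (a al *m w)).
    rewrite mulmx_suml mulmx_sumr; apply: eq_bigr => i _.
    by rewrite -scalemxAl -scalemxAr.
  rewrite !sp_sum -!sumrN -big_split /=; apply: eq_bigr => i _.
  have -> : sp y (av i) - sp y (au i) = sp y (Gu *m (a i *m V)) - sp y (Gv *m (a i *m w)).
    by rewrite -!spNr -!spDr avE.
  rewrite spDl spMl trmxK !spZr; ring.
rewrite !sumrB (tail xi x1)// (tail eta x2)//.
(* Reindexing by the involution brings the curvature sum to the form in which it cancels the
   products left by differentiating the tails. *)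
have cross : \sum_al sp eta (a al *m w) * sp xi (a (sg al) *m V) =
    \sum_al sp xi (a al *m V) * sp eta (a (sg al) *m w).
  rewrite (reindex_inj (inv_inj sgK)) /=; apply: eq_bigr => i _.
  by rewrite sgK mulrC.
rewrite sumrB cross in RE.
rewrite RE in h3.
have split (A B C D E T : R) : A + B - C - D - E + T = (A - E) + (B - C) + - D + T by ring.
rewrite split h1 h2 h3 -!/P1 -!/P2 (mulmxDr Gv (g *m x1)) (mulmxDr Gv (g *m x2)) !spDr; ring.
Qed.

End Trivector.

(** * Compactly supported integrands and the skew inverse of the derivative *)

Section RealIntegral.
Context {R : realType}.
Notation mu := (@lebesgue_measure R).
Implicit Types (f g : R -> R) (L : R).

Definition cc L f : Prop := continuous f /\ forall x, L <= `|x| -> f x = 0.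
Definition integral f : R := Rintegral mu setT f.

Lemma cc_integrable L f : 0 < L -> cc L f -> mu.-integrable setT (EFin \o f).
Proof.
move=> L0 [cf f0].
have mI : measurable (`[(- L), L]%classic : set R) by exact: measurable_itv.
have int1 : mu.-integrable `[(- L), L] (EFin \o f).
  apply: continuous_compact_integrable; first exact: segment_compact.
  exact: continuous_subspaceT.
have := (@integrable_mkcond _ _ _ mu _ (EFin \o f) mI).1 int1.
congr (mu.-integrable setT _); apply/funext => x; rewrite patchE.
case: ifPn => // /negP xL; rewrite /= f0//.
rewrite leNgt; apply/negP => xL'; apply: xL; apply/mem_set; rewrite /= in_itv /=.
by move: xL'; rewrite ltr_norml => /andP[h1 h2]; rewrite !ltW.
Qed.

(** The single contact with measure theory after [cc_integrable]: with the primitive that vanishes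
    on the left, [Dinv] is that primitive minus half the total integral, and later facts follow from
    ordinary calculus. *)
Lemma cc_primitive L f : 0 < L -> cc L f -> exists P : R -> R,
  [/\ forall x, is_derive x (1 : R) P (f x),
      forall x, x <= - L -> P x = 0,
      forall x, L <= x -> P x = integral f &
      forall x, Dinv f x = P x - 2^-1 * integral f].
Proof.
move=> L0 cf; have intf := cc_integrable L0 cf; have [ctf f0] := cf.
pose P x := Rintegral mu [set` `]-oo, x]] f.
have dP x : is_derive x (1 : R) P (f x).
  have x1 : x < x + 1 by rewrite ltrDl.
  have i1 : mu.-integrable [set` `]-oo, (x + 1)]] (EFin \o f).
    by apply: integrableS intf.
  have [|d1 d2] := @continuous_FTC1 R f (BInfty R true) x (x + 1) x1 i1 _ (ctf x).
    exact: ltNyr.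
  by apply: DeriveDef d1 _; rewrite -derive1E; exact: d2.
have P0 x : x <= - L -> P x = 0.
  move=> xL; rewrite /P (@eq_Rintegral _ _ _ _ _ (fun=> 0)); last first.
    move=> y /set_mem /=; rewrite in_itv /= => yx; rewrite f0//.
    have yL : y <= - L by apply: le_trans xL.
    by rewrite ler_normr lerNr yL orbT.
  by rewrite Rintegral_cst// mul0r.
have split x : Rintegral mu [set` `[x, +oo[] f = integral f - P x.
  rewrite /integral /P -set_itvNyy; apply/esym.
  rewrite (@Rintegral_itvB _ f (BInfty R true) (BInfty R false) x)//; last by rewrite set_itvNyy.
  by rewrite Rintegral_itv_obnd_cbnd//; apply: integrableS intf.
have tail x : L <= x -> Rintegral mu [set` `[x, +oo[] f = 0.
  move=> xL; rewrite (@eq_Rintegral _ _ _ _ _ (fun=> 0)); last first.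
    move=> y /set_mem /=; rewrite in_itv /= andbT => xy; rewrite f0//.
    by rewrite ler_normr (le_trans xL xy).
  by rewrite Rintegral_cst// mul0r.
exists P; split => // x.
  by move=> xL; have := split x; rewrite tail// => /eqP; rewrite eq_sym subr_eq0 => /eqP.
by rewrite /Dinv split -/(P x); field.
Qed.

Lemma derive_eq_diff f g (df : R -> R) :
  (forall x, is_derive x (1 : R) f (df x)) -> (forall x, is_derive x (1 : R) g (df x)) ->
  forall x y, f x - f y = g x - g y.
Proof.
move=> hf hg x y.
have h z : is_derive z (1 : R) (f - g) 0.
  by rewrite -(subrr (df z)); apply: is_deriveB.
have : (f - g) x = (f - g) y := is_derive_0_is_cst x y h.
rewrite -[(f - g) x]/(f x - g x) -[(f - g) y]/(f y - g y) => e.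
have -> : f x = f y - g y + g x by rewrite -e subrK.
by ring.
Qed.

Lemma integral_derive L f F : 0 < L -> cc L f -> (forall x, is_derive x (1 : R) F (f x)) ->
  integral f = F L - F (- L).
Proof.
move=> L0 cf dF; have [P [dP P0 PI _]] := cc_primitive L0 cf.
by rewrite -(derive_eq_diff dP dF) (PI L)// (P0 (- L))// subr0.
Qed.

Lemma ccD L f g : cc L f -> cc L g -> cc L (fun x => f x + g x).
Proof.
move=> [cf f0] [cg g0]; split=> [x|x Lx]; last by rewrite f0// g0// addr0.
by apply: continuousD; [exact: cf|exact: cg].
Qed.

Lemma ccN L f : cc L f -> cc L (fun x => - f x).
Proof.
move=> [cf f0]; split=> [x|x Lx]; last by rewrite f0// oppr0.
by apply: continuousN; exact: cf.
Qed.

Lemma ccB L f g : cc L f -> cc L g -> cc L (fun x => f x - g x).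
Proof. by move=> cf cg; apply: ccD => //; apply: ccN. Qed.

Lemma ccMl L f g : continuous g -> cc L f -> cc L (fun x => g x * f x).
Proof.
move=> cg [cf f0]; split=> [x|x Lx]; last by rewrite f0// mulr0.
by apply: continuousM; [exact: cg|exact: cf].
Qed.

Lemma ccMr L f g : continuous g -> cc L f -> cc L (fun x => f x * g x).
Proof.
move=> cg cf; have := ccMl cg cf.
by under eq_fun do rewrite mulrC.
Qed.

Lemma cc0 L : cc L (fun=> 0).
Proof. by split=> // x; apply: cst_continuous. Qed.

Lemma cc_sum (I : Type) (r : seq I) L (F : I -> R -> R) :
  (forall i, cc L (F i)) -> cc L (fun x => \sum_(i <- r) F i x).
Proof.
move=> cF; elim: r => [|a r IH].
  by under eq_fun do rewrite big_nil; exact: cc0.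
by under eq_fun do rewrite big_cons; exact: ccD.
Qed.

Lemma integralD L f g : 0 < L -> cc L f -> cc L g ->
  integral (fun x => f x + g x) = integral f + integral g.
Proof.
move=> L0 cf cg; rewrite /integral RintegralD//; exact: (cc_integrable L0).
Qed.

Lemma integralB L f g : 0 < L -> cc L f -> cc L g ->
  integral (fun x => f x - g x) = integral f - integral g.
Proof.
move=> L0 cf cg; rewrite /integral RintegralB//; exact: (cc_integrable L0).
Qed.

Lemma integralZ L c f : 0 < L -> cc L f -> integral (fun x => c * f x) = c * integral f.
Proof. by move=> L0 cf; rewrite /integral RintegralZl//; exact: (cc_integrable L0). Qed.

Lemma integral_sum (I : Type) (r : seq I) L (F : I -> R -> R) : 0 < L ->
  (forall i, cc L (F i)) ->
  integral (fun x => \sum_(i <- r) F i x) = \sum_(i <- r) integral (F i).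
Proof.
move=> L0 cF; elim: r => [|a r IH].
  rewrite big_nil; under eq_fun do rewrite big_nil.
  by rewrite /integral Rintegral_cst// mul0r.
rewrite big_cons -IH -(integralD L0)//; last exact: cc_sum.
by congr integral; apply/funext => x; rewrite big_cons.
Qed.

Lemma is_derive_cont f (df : R -> R) : (forall x, is_derive x (1 : R) f (df x)) -> continuous f.
Proof.
move=> d x; apply/differentiable_continuous/derivable1_diffP.
by have [] := d x.
Qed.

(** The mean value theorem for the primitive between the two ends. *)
Lemma integral_bound L f C : 0 < L -> cc L f -> (forall x, `|f x| <= C) ->
  `|integral f| <= C * (L + L).
Proof.
move=> L0 cf bf; have [P [dP P0 PI _]] := cc_primitive L0 cf.
have LL : - L < L by rewrite lt_neqAle; lra.
have cP : {within `[(- L), L], continuous P}.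
  by apply: continuous_subspaceT; exact: is_derive_cont dP.
have [c _] := MVT LL (fun x _ => dP x) cP.
rewrite (PI L)// (P0 (- L))// subr0 opprK => ->.
by rewrite normrM ler_pM// ger0_norm// addr_ge0// ltW.
Qed.

Lemma Dinv_derive L f x : 0 < L -> cc L f -> is_derive x (1 : R) (Dinv f) (f x).
Proof.
move=> L0 cf; have [P [dP _ _ PD]] := cc_primitive L0 cf.
have -> : Dinv f = P - cst (2^-1 * integral f).
  by apply/funext => y; rewrite PD.
by rewrite -[f x]subr0; apply: is_deriveB.
Qed.

Lemma Dinv_cont L f : 0 < L -> cc L f -> continuous (Dinv f).
Proof. by move=> L0 cf; apply: (@is_derive_cont _ f) => x; exact: Dinv_derive L0 cf. Qed.

Lemma Dinv_ends L f : 0 < L -> cc L f ->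
  Dinv f L = 2^-1 * integral f /\ Dinv f (- L) = - (2^-1 * integral f).
Proof.
move=> L0 cf; have [P [_ P0 PI PD]] := cc_primitive L0 cf.
by rewrite !PD (P0 (- L))// (PI L)//; split; [field|rewrite sub0r].
Qed.

Lemma Dinv_bound L f C x : 0 < L -> cc L f -> (forall x, `|f x| <= C) ->
  `|x| <= L -> `|Dinv f x| <= C * (L + L) * 2.
Proof.
move=> L0 cf bf xL; have [P [dP P0 PI PD]] := cc_primitive L0 cf.
have C0 : 0 <= C by apply: le_trans (bf 0).
have LL : - L <= x by move: xL; rewrite ler_norml => /andP[].
have xL' : x <= L by move: xL; rewrite ler_norml => /andP[].
have cP : {within `[(- L), x], continuous P}.
  by apply: continuous_subspaceT; exact: is_derive_cont dP.
have [c _] := MVT_segment LL (fun x _ => dP x) cP.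
rewrite (P0 (- L))// subr0 opprK PD => ->.
apply: (le_trans (ler_normB _ _)).
have h1 : `|f c * (x + L)| <= C * (L + L).
  by rewrite normrM ler_pM// ger0_norm ?lerD2r//; lra.
have h2 : `|2^-1 * integral f| <= C * (L + L).
  rewrite normrM ger0_norm ?invr_ge0//; apply: le_trans (integral_bound L0 cf bf).
  by rewrite ler_piMl// invf_le1// ler1n.
by rewrite mulr_natr mulr2n; exact: lerD.
Qed.

(* Dinv f . Dinv g takes the same value at both ends. *)
Lemma Dinv_skew L f g : 0 < L -> cc L f -> cc L g ->
  integral (fun x => f x * Dinv g x) = - integral (fun x => Dinv f x * g x).
Proof.
move=> L0 cf cg; apply/eqP; rewrite -addr_eq0; apply/eqP.
have c1 : cc L (fun x => f x * Dinv g x) by apply: ccMr => //; exact: Dinv_cont L0 cg.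
have c2 : cc L (fun x => Dinv f x * g x) by apply: ccMl => //; exact: Dinv_cont L0 cf.
rewrite -(integralD L0)//.
have dF x : is_derive x (1 : R) (Dinv f * Dinv g) (f x * Dinv g x + Dinv f x * g x).
  have df := Dinv_derive x L0 cf; have dg := Dinv_derive x L0 cg.
  apply: is_derive_eq; rewrite addrC; congr (_ + _).
  by rewrite mulrC.
rewrite (integral_derive L0 (ccD c1 c2) dF) -[(Dinv f * Dinv g) L]/(Dinv f L * Dinv g L).
rewrite -[(Dinv f * Dinv g) (- L)]/(Dinv f (- L) * Dinv g (- L)).
have [-> ->] := Dinv_ends L0 cf; have [-> ->] := Dinv_ends L0 cg.
by rewrite mulrNN subrr.
Qed.

(** Both sides have the same derivative, and by [Dinv_ends] they agree at [L]. *)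
Lemma DinvD L f g x : 0 < L -> cc L f -> cc L g ->
  Dinv (fun y => f y + g y) x = Dinv f x + Dinv g x.
Proof.
move=> L0 cf cg; have cfg := ccD cf cg.
have e := derive_eq_diff (fun y => Dinv_derive y L0 cfg)
  (fun y => is_deriveD (Dinv_derive y L0 cf) (Dinv_derive y L0 cg)) x L.
have [e1 _] := Dinv_ends L0 cfg; have [e2 _] := Dinv_ends L0 cf; have [e3 _] := Dinv_ends L0 cg.
rewrite -[(_ + _ : _ -> _) x]/(Dinv f x + Dinv g x) -[(_ + _ : _ -> _) L]/(Dinv f L + Dinv g L) in e.
move: e; rewrite e1 e2 e3 (integralD L0 cf cg) mulrDr => /addIr.
by [].
Qed.

Lemma DinvZ L c f x : 0 < L -> cc L f -> Dinv (fun y => c * f y) x = c * Dinv f x.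
Proof.
move=> L0 cf; have ccf : cc L (fun y => c * f y) by apply: ccMl => //; exact: cst_continuous.
have e := derive_eq_diff (fun y => Dinv_derive y L0 ccf)
  (fun y => is_deriveZ c (Dinv_derive y L0 cf)) x L.
have [e1 _] := Dinv_ends L0 ccf; have [e2 _] := Dinv_ends L0 cf.
rewrite -[(c \*: _) x]/(c * Dinv f x) -[(c \*: _) L]/(c * Dinv f L) in e.
move: e; rewrite e1 e2 (integralZ c L0 cf).
by rewrite mulrCA => /addIr.
Qed.

End RealIntegral.

(** * First-order expansions in two parameters, uniform in x on a segment *)

Section UniformExpansion.
Context {R : realType}.
Notation par := (R * R)%type.
Notation dom := (R * R * R)%type.

Definition es : dom := ((1, 0), 0).
Definition et : dom := ((0, 1), 0).
Definition ex : dom := ((0, 0), 1).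

Definition over (O : set par) : set dom := [set q | O q.1].

Lemma open_over (O : set par) : open O -> open (over O).
Proof. by move=> oO; apply: open_comp oO => q _; exact: cvg_fst. Qed.

(** Compactness of the segment in its near-covering form makes the neighbourhood of the parameter 0
    independent of x. *)
Lemma unif_cont (O : set par) (k : dom -> R) L e : open O -> O 0 -> 0 < e ->
  (forall q, over O q -> {for q, continuous k}) ->
  exists2 d, 0 < d & forall p : par, `|p| < d -> forall x, `|x| <= L ->
    `|k (p, x) - k (0, x)| <= e.
Proof.
move=> oO O0 e0 ck.
have cK : compact (`[(- L), L]%classic : set R) by exact: segment_compact.
have /compact_near_coveringP nc := cK.
have := nc par (nbhs (0 : par)) (fun p x => `|k (p, x) - k (0, x)| <= e) _.
have h (x : R) : `[(- L), L]%classic x -> \forall x' \near x & p \near (0 : par),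
    `|k (p, x') - k (0, x')| <= e.
  move=> _; have c := ck ((0 : par), x) O0.
  have e2 : 0 < e / 2 by rewrite divr_gt0.
  have /cvgrPdist_lt/(_ _ e2)/nbhs_ballP[d /= d0 Hd] := c.
  exists (ball x d, ball (0 : par) d); first by split; exact: nbhsx_ballx.
  move=> [x' p] /= [bx bp].
  have h1 : `|k (0, x) - k (p, x')| < e / 2 by apply: Hd; split.
  have h2 : `|k (0, x) - k (0, x')| < e / 2 by apply: Hd; split => //; exact: ballxx.
  have -> : k (p, x') - k (0, x') = (k (0, x) - k (0, x')) - (k (0, x) - k (p, x')) by ring.
  by rewrite (le_trans (ler_normB _ _))//; lra.
move=> /(_ _ h) /nbhs_ballP[d /= d0 Hd]; exists d => // p pd x xL.
have := Hd p; rewrite -ball_normE /= sub0r normrN => /(_ pd); apply.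
by rewrite /= in_itv /= -ler_norml.
Qed.

Lemma dir_split (f : dom -> R) (q : dom) (p : par) : differentiable f q ->
  'D_((p, 0) : dom) f q = p.1 * 'D_es f q + p.2 * 'D_et f q.
Proof.
move=> df; have -> : ((p, 0) : dom) = p.1 *: es + p.2 *: et.
  case: p => p1 p2; apply/eqP; rewrite /es /et !xpair_eqE /GRing.scale /= /GRing.scale /=.
  by rewrite !mulr1 !mulr0 addr0 add0r addr0 !eqxx.
by rewrite deriveDl// !deriveZdir.
Qed.

Lemma norm_par (p : par) : `|p.1| <= `|p| /\ `|p.2| <= `|p|.
Proof. by rewrite prod_normE /= !le_max !lexx orbT. Qed.

(** The mean value theorem on the segment from (0, x) to (p, x), with [unif_cont] applied to the two
    parameter derivatives at tolerance e/2 each. *)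
Lemma unif_expand (O : set par) (f : dom -> R) L e : open O -> O 0 -> 0 < e ->
  smooth (over O) f ->
  exists2 d, 0 < d & forall p : par, `|p| < d -> O p /\ forall x, `|x| <= L ->
    `|f (p, x) - f (0, x) - (p.1 * 'D_es f (0, x) + p.2 * 'D_et f (0, x))| <= e * `|p|.
Proof.
move=> oO O0 e0 sf; have oo := open_over oO.
have e2 : 0 < e / 2 by rewrite divr_gt0.
have cs q : over O q -> {for q, continuous (fun q => 'D_es f q)}.
  by move=> Oq; apply: smooth_cont Oq; exact: smooth_derive.
have ct q : over O q -> {for q, continuous (fun q => 'D_et f q)}.
  by move=> Oq; apply: smooth_cont Oq; exact: smooth_derive.
have [d1 d10 H1] := unif_cont L oO O0 e2 cs.
have [d2 d20 H2] := unif_cont L oO O0 e2 ct.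
have /nbhs_ballP[d3 /= d30 H3] : nbhs (0 : par) O by apply: open_nbhs_nbhs.
have {}H3 (p : par) : `|p| < d3 -> O p.
  by move=> pd; apply: H3; rewrite -ball_normE /= sub0r normrN.
exists (Num.min d1 (Num.min d2 d3)); first by rewrite !lt_min d10 d20.
move=> p; rewrite !lt_min => /and3P[p1 p2 p3]; split; first exact: H3.
move=> x xL; pose a : dom := (0, x); pose v : dom := (p, 0).
have av (t : R) : a + t *: v = (t *: p, x).
  by apply/eqP; rewrite /a /v xpair_eqE /= add0r scaler0 addr0 !eqxx.
have small (t : R) : 0 <= t -> t <= 1 -> forall d, `|p| < d -> `|t *: p| < d.
  move=> t0 t1 d pd; apply: le_lt_trans pd.
  by rewrite normrZ ger0_norm// ler_piMl.
have dl (t : R) : 0 <= t -> t <= 1 ->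
    is_derive t (1 : R) (fun t => f (a + t *: v)) ('D_v f (a + t *: v)).
  move=> t0 t1; apply: derive_line; apply: smooth_diff sf _; rewrite av.
  by apply: H3; apply: small.
have [||c] := @MVT_segment R (fun t => f (a + t *: v)) (fun t => 'D_v f (a + t *: v)) 0 1 ler01.
- by move=> t; rewrite in_itv /= => /andP[t0 t1]; apply: dl; exact: ltW.
- apply: derivable_within_continuous => t; rewrite in_itv /= => /andP[t0 t1].
  by have [] := dl t t0 t1.
rewrite in_itv /= => /andP[c0 c1]; rewrite !av scale1r scale0r subr0 mulr1 => ->.
have Oc : over O (c *: p, x) by apply: H3; apply: small.
rewrite dir_split; last exact: smooth_diff sf Oc.
have h1 := H1 (c *: p) (small c c0 c1 _ p1) x xL.
have h2 := H2 (c *: p) (small c c0 c1 _ p2) x xL.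
move: h1 h2; move: ('D_es f (c *: p, x)) ('D_es f (0, x)) ('D_et f (c *: p, x)) ('D_et f (0, x)).
move=> s1 s2 t1 t2 h1 h2.
have -> : p.1 * s1 + p.2 * t1 - (p.1 * s2 + p.2 * t2) = p.1 * (s1 - s2) + p.2 * (t1 - t2) by ring.
have [n1 n2] := norm_par p.
apply: (le_trans (ler_normD _ _)); rewrite !normrM.
have b1 := ler_pM (normr_ge0 _) (normr_ge0 _) n1 h1.
have b2 := ler_pM (normr_ge0 _) (normr_ge0 _) n2 h2.
by apply: (le_trans (lerD b1 b2)); lra.
Qed.

End UniformExpansion.

(** * Differentiation of local and nonlocal integrals in a parameter *)

Section ParametricIntegrals.
Context {R : realType}.
Notation par := (R * R)%type.
Notation dom := (R * R * R)%type.
Implicit Types (f g : R -> R) (L : R).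

Lemma cc_bounded L f : 0 < L -> cc L f -> exists2 C, 0 <= C & forall x, `|f x| <= C.
Proof.
move=> L0 [cf f0]; have LL : - L <= L by lra.
have cn : {within `[(- L), L], continuous (fun x => `|f x|)}.
  apply: continuous_subspaceT => x.
  by apply: (@continuous_comp _ _ _ f (fun y : R => `|y|)); [exact: cf|exact: norm_continuous].
have [c _ Hc] := EVT_max LL cn.
exists `|f c|; first exact: normr_ge0.
move=> x; have [xL|Lx] := leP `|x| L; last by rewrite f0 ?normr0// ltW.
by apply: Hc; rewrite in_itv /= -ler_norml.
Qed.

(** What one tail contributes to a bracket, as a bilinear form in its two densities. *)
Definition bil f g : R := integral (fun x => f x * Dinv g x).

Lemma bil_cc L f g : 0 < L -> cc L f -> cc L g -> cc L (fun x => f x * Dinv g x).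
Proof. by move=> L0 cf cg; apply: ccMr => //; exact: Dinv_cont L0 cg. Qed.

Lemma bilDl L f1 f2 g : 0 < L -> cc L f1 -> cc L f2 -> cc L g ->
  bil (fun x => f1 x + f2 x) g = bil f1 g + bil f2 g.
Proof.
move=> L0 c1 c2 cg; rewrite /bil -(integralD L0 (bil_cc L0 c1 cg) (bil_cc L0 c2 cg)).
by congr integral; apply/funext => x; rewrite mulrDl.
Qed.

Lemma bilDr L f g1 g2 : 0 < L -> cc L f -> cc L g1 -> cc L g2 ->
  bil f (fun x => g1 x + g2 x) = bil f g1 + bil f g2.
Proof.
move=> L0 cf c1 c2; rewrite /bil -(integralD L0 (bil_cc L0 cf c1) (bil_cc L0 cf c2)).
by congr integral; apply/funext => x; rewrite (DinvD x L0 c1 c2) mulrDr.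
Qed.

Lemma bilZl L c f g : 0 < L -> cc L f -> cc L g -> bil (fun x => c * f x) g = c * bil f g.
Proof.
move=> L0 cf cg; rewrite /bil -(integralZ c L0 (bil_cc L0 cf cg)).
by congr integral; apply/funext => x; rewrite mulrA.
Qed.

Lemma bilZr L c f g : 0 < L -> cc L f -> cc L g -> bil f (fun x => c * g x) = c * bil f g.
Proof.
move=> L0 cf cg; rewrite /bil -(integralZ c L0 (bil_cc L0 cf cg)).
by congr integral; apply/funext => x; rewrite (DinvZ c x L0 cg) mulrCA.
Qed.

Lemma bil_skew L f g : 0 < L -> cc L f -> cc L g -> bil f g = - bil g f.
Proof.
move=> L0 cf cg; rewrite /bil (Dinv_skew L0 cf cg); congr (- integral _).
by apply/funext => x; rewrite mulrC.
Qed.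

Lemma bil_bound L f g C1 C2 : 0 < L -> cc L f -> cc L g ->
  (forall x, `|f x| <= C1) -> (forall x, `|g x| <= C2) ->
  `|bil f g| <= C1 * C2 * ((L + L) * (L + L) * 2).
Proof.
move=> L0 cf cg b1 b2.
have c0 : 0 <= C1 by apply: le_trans (b1 0).
have c20 : 0 <= C2 by apply: le_trans (b2 0).
have -> : C1 * C2 * ((L + L) * (L + L) * 2) = C1 * (C2 * (L + L) * 2) * (L + L) by ring.
apply: (integral_bound L0 (bil_cc L0 cf cg)) => x.
have [xL|Lx] := leP `|x| L.
  by rewrite normrM ler_pM//; exact: Dinv_bound L0 cg b2 xL.
have [_ ->] := cf; last exact: ltW.
by rewrite mul0r normr0 !mulr_ge0// addr_ge0// ltW.
Qed.

Definition supp L (f : dom -> R) : Prop :=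
  \forall p \near (0 : par), forall x, L <= `|x| -> f (p, x) = 0.

Lemma near_par (P : par -> Prop) : (\forall p \near (0 : par), P p) ->
  exists2 d, 0 < d & forall p : par, `|p| < d -> P p.
Proof.
move=> /nbhs_ballP[d /= d0 Hd]; exists d => // p pd.
by apply: Hd; rewrite -ball_normE /= sub0r normrN.
Qed.

Lemma smooth_slice (O : set par) (f : dom -> R) p : smooth (over O) f -> O p ->
  smooth setT (fun x => f (p, x)).
Proof.
move=> sf Op.
have dff (x : R) : is_diff x (fun x : R => ((p, x) : dom)) (fun y => (0, y)).
  by apply: is_diff_pair.
apply: (smooth_affine (a := fun x : R => ((p, x) : dom)) (L := fun v => ((0, v) : dom)) _ _ _ _ sf).
- exact: openT.
- by move=> x; have [] := dff x.
- move=> v x; have [d e] := dff x; rewrite (deriveE _ d).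
  exact: (congr1 (fun h => h v) e).
- by move=> x _.
Qed.

Lemma smooth_continuous f : smooth setT f -> continuous f.
Proof. by move=> sf x; exact: (smooth_cont sf I). Qed.

Lemma cc_slice (O : set par) (f : dom -> R) L : smooth (over O) f -> open O -> O 0 -> supp L f ->
  \forall p \near (0 : par), cc L (fun x => f (p, x)).
Proof.
move=> sf oO O0 sL; have Oe : \forall p \near (0 : par), O p by apply: open_nbhs_nbhs.
near=> p; split.
  by apply/smooth_continuous/(smooth_slice sf); near: p.
by near: p.
Unshelve. all: by end_near. Qed.

(** The positions [x] and [y] may differ: this serves to compare the two ends of a segment, and also
    to differentiate a vanishing condition. *)
Lemma near_param_derive (O : set par) (f h : dom -> R) (p : par) x y : O 0 ->
  smooth (over O) f -> smooth (over O) h ->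
  (\forall q \near (0 : par), f (q, x) = h (q, y)) ->
  'D_((p, 0) : dom) f (0, x) = 'D_((p, 0) : dom) h (0, y).
Proof.
move=> O0 sf sh /near_par[d d0 Hd].
pose v : dom := (p, 0).
have E z (t : R) : ((0, z) : dom) + t *: v = (t *: p, z).
  by apply/eqP; rewrite /v xpair_eqE /= add0r scaler0 addr0 !eqxx.
have w0 z : ((0, z) : dom) + 0 *: v = (0, z) by rewrite scale0r addr0.
have dl (k : dom -> R) z : smooth (over O) k ->
    is_derive (0 : R) (1 : R) (fun t => k ((0, z) + t *: v)) ('D_v k (0, z)).
  move=> sk; rewrite -{2}(w0 z); apply: derive_line; rewrite w0.
  by apply: smooth_diff sk _.
have ne : \forall t \near (0 : R), (fun t => f ((0, x) + t *: v)) t = h ((0, y) + t *: v).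
  have p1 : 0 < `|p| + 1 by rewrite ltr_wpDl.
  have dp : 0 < d / (`|p| + 1) by rewrite divr_gt0.
  apply/nbhs_ballP; exists (d / (`|p| + 1)) => //= t.
  rewrite -ball_normE /= sub0r normrN ltr_pdivlMr// => td.
  rewrite !E Hd// normrZ; apply: le_lt_trans td.
  by rewrite ler_wpM2l// lerDl.
have e1 := @derive_val _ _ _ _ _ _ _ (near_eq_is_derive ne (dl f x sf)).
by have e2 := @derive_val _ _ _ _ _ _ _ (dl h y sh); rewrite -e1 -e2.
Qed.

Lemma supp_derive (O : set par) (f : dom -> R) L (p : par) x : smooth (over O) f -> O 0 ->
  supp L f -> L <= `|x| -> 'D_((p, 0) : dom) f (0, x) = 0.
Proof.
move=> sf O0 sL Lx; rewrite (@near_param_derive O f (cst 0) p x x)//.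
- by rewrite derive_cst.
- exact: smooth_cst.
- by apply: filterS sL => q; exact.
Qed.

Lemma cc_derive (O : set par) (f : dom -> R) L p : open O -> smooth (over O) f -> O 0 ->
  supp L f -> cc L (fun x => 'D_((p, 0) : dom) f (0, x)).
Proof.
move=> oO sf O0 sL; split; last by move=> x Lx; exact: supp_derive sf O0 sL Lx.
by apply/smooth_continuous/(smooth_slice (smooth_derive _ sf)).
Qed.

Lemma unif_expand_supp (O : set par) (f : dom -> R) L e : open O -> O 0 -> 0 < e ->
  smooth (over O) f -> supp L f ->
  exists2 d, 0 < d & forall p : par, `|p| < d -> cc L (fun x => f (p, x)) /\ forall x,
    `|f (p, x) - f (0, x) - (p.1 * 'D_es f (0, x) + p.2 * 'D_et f (0, x))| <= e * `|p|.
Proof.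
move=> oO O0 e0 sf sL; have [d1 d10 H1] := unif_expand L oO O0 e0 sf.
have [d2 d20 H2] := near_par (cc_slice sf oO O0 sL).
exists (Num.min d1 d2); first by rewrite lt_min d10.
move=> p; rewrite lt_min => /andP[p1 p2]; split; first exact: H2.
have c0 : cc L (fun x => f (0, x)) by apply: H2; rewrite normr0.
move=> x; have [xL|Lx] := leP `|x| L; first exact: (H1 p p1).2.
have [_ ->] := H2 p p2; last exact: ltW.
have [_ ->] := c0; last exact: ltW.
rewrite (supp_derive _ sf O0 sL (ltW Lx)) (supp_derive _ sf O0 sL (ltW Lx)).
by rewrite !mulr0 addr0 !subr0 normr0 mulr_ge0// ltW.
Qed.

(** The pointwise tolerance e / (L + L) is what [integral_bound] turns into e. Both parameters are
    kept because [young] needs the joint expansion. *)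
Lemma integral_expand (O : set par) (f : dom -> R) L e : open O -> O 0 -> 0 < e -> 0 < L ->
  smooth (over O) f -> supp L f ->
  exists2 d, 0 < d & forall p : par, `|p| < d ->
    `|integral (fun x => f (p, x)) - integral (fun x => f (0, x))
      - (p.1 * integral (fun x => 'D_es f (0, x)) + p.2 * integral (fun x => 'D_et f (0, x)))|
    <= e * `|p|.
Proof.
move=> oO O0 e0 L0 sf sL; have e1 : 0 < e / (L + L) by rewrite divr_gt0// addr_gt0.
have [d d0 Hd] := unif_expand_supp oO O0 e1 sf sL.
exists d => // p pd; have [cp bp] := Hd p pd.
have [c0 _] : cc L (fun x => f (0, x)) /\ _ := Hd 0 (eq_ind_r (fun z => z < d) d0 (normr0 _)).
have cS : cc L (fun x => 'D_es f (0, x)) := cc_derive _ oO sf O0 sL.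
have cT : cc L (fun x => 'D_et f (0, x)) := cc_derive _ oO sf O0 sL.
have cS' : cc L (fun x => p.1 * 'D_es f (0, x)) by apply: ccMl => //; exact: cst_continuous.
have cT' : cc L (fun x => p.2 * 'D_et f (0, x)) by apply: ccMl => //; exact: cst_continuous.
rewrite -(integralZ _ L0 cS) -(integralZ _ L0 cT) -(integralD L0 cS' cT').
rewrite -(integralB L0 cp c0) -(integralB L0 (ccB cp c0) (ccD cS' cT')).
apply: le_trans (integral_bound L0 (ccB (ccB cp c0) (ccD cS' cT')) bp) _.
by rewrite mulrAC divfK// gt_eqF// addr_gt0.
Qed.

Lemma is_derive_expand (h : R -> R) (c : R) :
  (forall e, 0 < e -> exists2 d, 0 < d & forall s, `|s| < d -> `|h s - h 0 - s * c| <= e * `|s|) ->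
  is_derive (0 : R) (1 : R) h c.
Proof.
move=> H.
have cv : (fun t : R => t^-1 *: (h (t *: 1 + 0) - h 0)) @ (0 : R)^' --> c.
  apply/cvgrPdist_le => e e0; have [d d0 Hd] := H e e0.
  near=> t.
  have t0 : t != 0 by near: t; exact: nbhs_dnbhs_neq.
  have td : `|t| < d by near: t; exact: dnbhs0_lt.
  have nt : 0 < `|t| by rewrite normr_gt0.
  rewrite distrC addr0 [t *: 1]mulr1 -(ler_pM2r nt) -normrM.
  have -> : (t^-1 *: (h t - h 0) - c) * t = h t - h 0 - t * c.
    by rewrite /GRing.scale /=; field.
  exact: Hd.
apply: DeriveDef; first by apply/cvg_ex; exists c.
by apply/cvg_lim.
Unshelve. all: by end_near. Qed.

Lemma normr_par1 (s : R) : `|((s, 0) : par)| = `|s|.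
Proof. by rewrite prod_normE /= normr0; apply/max_idPl. Qed.

Lemma integral_is_derive (O : set par) (f : dom -> R) L : open O -> O 0 -> 0 < L ->
  smooth (over O) f -> supp L f ->
  is_derive (0 : R) (1 : R) (fun s => integral (fun x => f ((s, 0), x)))
    (integral (fun x => 'D_es f (0, x))).
Proof.
move=> oO O0 L0 sf sL; apply: is_derive_expand => e e0.
have [d d0 Hd] := integral_expand oO O0 e0 L0 sf sL.
exists d => // s sd; have := Hd (s, 0); rewrite normr_par1 => /(_ sd) /=.
by rewrite mul0r addr0.
Qed.

(** The product rule for the bounded bilinear form [bil]: only a uniform expansion of each density
    is needed, and [Dinv] is never differentiated in the parameter. *)
Lemma bil_is_derive (O : set par) (A B : dom -> R) L : open O -> O 0 -> 0 < L ->
  smooth (over O) A -> supp L A -> smooth (over O) B -> supp L B ->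
  is_derive (0 : R) (1 : R) (fun s => bil (fun x => A ((s, 0), x)) (fun x => B ((s, 0), x)))
    (bil (fun x => 'D_es A (0, x)) (fun x => B (0, x))
     + bil (fun x => A (0, x)) (fun x => 'D_es B (0, x))).
Proof.
move=> oO O0 L0 sA sLA sB sLB; apply: is_derive_expand => e e0.
have cA' : cc L (fun x => 'D_es A (0, x)) := cc_derive _ oO sA O0 sLA.
have cB' : cc L (fun x => 'D_es B (0, x)) := cc_derive _ oO sB O0 sLB.
have cA0 : cc L (fun x => A (0, x)) by apply: nbhs_singleton (cc_slice sA oO O0 sLA).
have cB0 : cc L (fun x => B (0, x)) by apply: nbhs_singleton (cc_slice sB oO O0 sLB).
have [C1 C10 b1] := cc_bounded L0 cA'; have [C2 C20 b2] := cc_bounded L0 cB'.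
have [C3 C30 b3] := cc_bounded L0 cA0; have [C4 C40 b4] := cc_bounded L0 cB0.
pose K := (L + L) * (L + L) * 2.
have K0 : 0 < K by rewrite !mulr_gt0// addr_gt0.
(* [T] controls the two terms with one expansion remainder, [W] below the term quadratic in s; each
   receives e/2. The added 1 keeps the divisors positive. *)
pose T := (C3 + C4) * K + 1.
have T0 : 0 < T by rewrite ltr_wpDl// mulr_ge0 ?addr_ge0// ltW.
pose e1 := e / 2 / T.
have e10 : 0 < e1 by rewrite !divr_gt0.
have [dA dA0 HA] := unif_expand_supp oO O0 e10 sA sLA.
have [dB dB0 HB] := unif_expand_supp oO O0 e10 sB sLB.
pose W := (C1 + e1) * (C2 + e1) * K + 1.
have W0 : 0 < W by rewrite ltr_wpDl// !mulr_ge0// ?addr_ge0// ltW.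
exists (Num.min (Num.min dA dB) (e / 2 / W)); first by rewrite !lt_min dA0 dB0 !divr_gt0.
move=> s; rewrite !lt_min => /andP[/andP[sdA sdB]]; rewrite ltr_pdivlMr// => sW.
have := HA (s, 0); have := HB (s, 0); rewrite normr_par1 => /(_ sdB)[cBs rB] /(_ sdA)[cAs rA].
pose As x := A (s, 0, x); pose Bs x := B (s, 0, x).
pose A0 x := A (0, x); pose B0 x := B (0, x).
pose A1 (x : R) : R := 'D_es A (0, x); pose B1 (x : R) : R := 'D_es B (0, x).
rewrite -/As -/Bs -/A0 -/B0 -/A1 -/B1.
have {}rA x : `|As x - A0 x - s * A1 x| <= e1 * `|s|.
  by have := rA x; rewrite /= mul0r addr0.
have {}rB x : `|Bs x - B0 x - s * B1 x| <= e1 * `|s|.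
  by have := rB x; rewrite /= mul0r addr0.
have {}b1 x : `|A1 x| <= C1 := b1 x. have {}b2 x : `|B1 x| <= C2 := b2 x.
have {}b3 x : `|A0 x| <= C3 := b3 x. have {}b4 x : `|B0 x| <= C4 := b4 x.
have {}cAs : cc L As := cAs. have {}cBs : cc L Bs := cBs.
have {}cA0 : cc L A0 := cA0. have {}cB0 : cc L B0 := cB0.
have {}cA' : cc L A1 := cA'. have {}cB' : cc L B1 := cB'.
move: (As) (Bs) (A0) (B0) (A1) (B1) cAs cBs cA0 cB0 cA' cB' rA rB b1 b2 b3 b4.
move=> {}As {}Bs {}A0 {}B0 {}A1 {}B1 {}cAs {}cBs {}cA0 {}cB0 {}cA' {}cB' {}rA {}rB {}b1 {}b2 {}b3 {}b4.
have csA : cc L (fun x => s * A1 x) by apply: ccMl cA'; exact: cst_continuous.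
have csB : cc L (fun x => s * B1 x) by apply: ccMl cB'; exact: cst_continuous.
pose wA x := As x - A0 x; pose wB x := Bs x - B0 x.
pose eA x := wA x - s * A1 x; pose eB x := wB x - s * B1 x.
have cdA : cc L wA by exact: ccB. have cdB : cc L wB by exact: ccB.
have ceA : cc L eA by exact: ccB. have ceB : cc L eB by exact: ccB.
have bdA x : `|wA x| <= (C1 + e1) * `|s|.
  have -> : wA x = eA x + s * A1 x by rewrite /eA subrK.
  apply: (le_trans (ler_normD _ _)); rewrite normrM addrC mulrDl [`|s| * _]mulrC.
  by apply: lerD; [rewrite ler_wpM2r|exact: rA].
have bdB x : `|wB x| <= (C2 + e1) * `|s|.
  have -> : wB x = eB x + s * B1 x by rewrite /eB subrK.
  apply: (le_trans (ler_normD _ _)); rewrite normrM addrC mulrDl [`|s| * _]mulrC.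
  by apply: lerD; [rewrite ler_wpM2r|exact: rB].
have EA : As = (fun x => A0 x + wA x) by apply/funext => x; rewrite /wA addrC subrK.
have EB : Bs = (fun x => B0 x + wB x) by apply/funext => x; rewrite /wB addrC subrK.
have EdA : wA = (fun x => s * A1 x + eA x) by apply/funext => x; rewrite /eA addrC subrK.
have EdB : wB = (fun x => s * B1 x + eB x) by apply/funext => x; rewrite /eB addrC subrK.
(* Here [w] denotes an increment and [e] what remains of it after its linear part. *)
have -> : bil As Bs - bil A0 B0 - s * (bil A1 B0 + bil A0 B1) = bil eA B0 + bil wA wB + bil A0 eB.
  have cc1 := ccD cA0 cdA; have cc2 := ccD cB0 cdB.
  rewrite EA EB (bilDl L0 cA0 cdA cc2) (bilDr L0 cA0 cB0 cdB) (bilDr L0 cdA cB0 cdB).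
  have -> : bil wA B0 = s * bil A1 B0 + bil eA B0.
    by rewrite {1}EdA (bilDl L0 csA ceA cB0) (bilZl s L0 cA' cB0).
  have -> : bil A0 wB = s * bil A0 B1 + bil A0 eB.
    by rewrite {1}EdB (bilDr L0 cA0 csB ceB) (bilZr s L0 cA0 cB').
  move: (bil A0 B0) (bil A1 B0) (bil eA B0) (bil A0 B1) (bil A0 eB) (bil wA wB) => *.
  by ring.
have n1 : `|bil eA B0| <= e1 * `|s| * C4 * K := bil_bound L0 ceA cB0 rA b4.
have n2 : `|bil wA wB| <= (C1 + e1) * `|s| * ((C2 + e1) * `|s|) * K := bil_bound L0 cdA cdB bdA bdB.
have n3 : `|bil A0 eB| <= C3 * (e1 * `|s|) * K := bil_bound L0 cA0 ceB b3 rB.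
apply: (le_trans (ler_normD _ _)); apply: (le_trans (lerD (ler_normD _ _) (lexx _))).
apply: (le_trans (lerD (lerD n1 n2) n3)).
have s0 : 0 <= `|s| := normr_ge0 s.
have h1 : e1 * ((C3 + C4) * K) <= e / 2.
  have -> : e / 2 = e1 * T by rewrite /e1 divfK// gt_eqF.
  by rewrite ler_wpM2l ?(ltW e10)// /T lerDl.
have h2 : (C1 + e1) * (C2 + e1) * K * `|s| <= e / 2.
  apply: le_trans (ltW sW); rewrite mulrC ler_wpM2l//.
  by rewrite /W lerDl.
have -> : e1 * `|s| * C4 * K + (C1 + e1) * `|s| * ((C2 + e1) * `|s|) * K + C3 * (e1 * `|s|) * K =
  (e1 * ((C3 + C4) * K) + (C1 + e1) * (C2 + e1) * K * `|s|) * `|s| by ring.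
by rewrite ler_wpM2r//; apply: (le_trans (lerD h1 h2)); rewrite -splitr.
Qed.

End ParametricIntegrals.


(** * Connections and affinors contracted with vectors *)

Section Contractions.
Context {R : realType} {n : nat} (U : set 'rV[R]_n) (oU : open U).
Notation point := 'rV[R]_n.
Notation col := 'cV[R]_n.

Definition along {p q} (w : col) (A : point -> 'M[R]_(p, q)) u : 'M[R]_(p, q) :=
  \sum_k w k 0 *: dm k A u.

Lemma dmx_along p q (A : point -> 'M[R]_(p, q)) w u : U u -> msmooth U A ->
  dmx w A u = along w^T A u.
Proof.
move=> Uu sA; apply/matrixP => i j; rewrite dmxE /along summxE.
rewrite derive_rV; last exact: smooth_diff (sA i j) Uu.
by apply: eq_bigr => k _; rewrite mxE dmxE mxE.
Qed.

Definition contract (Gm : 'I_n -> point -> 'M[R]_n) u (w : col) : 'M[R]_n :=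
  \sum_k w k 0 *: Gm k u.

Lemma col_ecol (w : col) : w = \sum_k w k 0 *: ecol k.
Proof.
apply/matrixP => i j; rewrite (ord1 j) summxE (bigD1 i)//= big1 ?addr0.
  by rewrite !mxE !eqxx mulr1.
by move=> k ki; rewrite !mxE eq_sym (negbTE ki) mulr0.
Qed.

Lemma contract_mul Gm u w z :
  contract Gm u w *m z = \sum_k \sum_l (w k 0 * z l 0) *: (Gm k u *m ecol l).
Proof.
rewrite /contract mulmx_suml; apply: eq_bigr => k _.
rewrite {1}(col_ecol z) mulmx_sumr; apply: eq_bigr => l _.
by rewrite -scalemxAl -scalemxAr scalerA.
Qed.

Lemma contract_sym Gm u w z : (forall k l, Gm k u *m ecol l = Gm l u *m ecol k) ->
  contract Gm u w *m z = contract Gm u z *m w.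
Proof.
move=> sG; rewrite !contract_mul exchange_big /=; apply: eq_bigr => k _.
by apply: eq_bigr => l _; rewrite sG mulrC.
Qed.

(* D_w (Gm (z)) with z held fixed *)
Definition dcontract (Gm : 'I_n -> point -> 'M[R]_n) u (w z : col) : 'M[R]_n :=
  contract (fun l => along w (Gm l)) u z.

Lemma dcontract_sum Gm u w z :
  dcontract Gm u w z = \sum_k \sum_l (w k 0 * z l 0) *: dm k (Gm l) u.
Proof.
rewrite /dcontract /contract /along exchange_big /=; apply: eq_bigr => l _.
by rewrite scaler_sumr; apply: eq_bigr => k _; rewrite scalerA mulrC.
Qed.

(** The vectors are held constant, so no bracket of vector fields appears. *)
Lemma contract_curv Gm u (w z : col) :
  dcontract Gm u w z - dcontract Gm u z w + contract Gm u w *m contract Gm u z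
   - contract Gm u z *m contract Gm u w =
  \sum_k \sum_l (w k 0 * z l 0) *: conn_curv Gm k l u.
Proof.
have cm w' z' : contract Gm u w' *m contract Gm u z' =
    \sum_k \sum_l (w' k 0 * z' l 0) *: (Gm k u *m Gm l u).
  rewrite /contract mulmx_suml; apply: eq_bigr => k _; rewrite mulmx_sumr.
  by apply: eq_bigr => l _; rewrite -scalemxAl -scalemxAr scalerA.
rewrite !cm !dcontract_sum.
rewrite [X in _ - X + _ - _]exchange_big [X in _ - X]exchange_big /=.
rewrite -sumrB -big_split -sumrB /=; apply: eq_bigr => k _.
rewrite -sumrB -big_split -sumrB /=; apply: eq_bigr => l _.
rewrite (mulrC (z l 0)) -!scalerBr -scalerDr -scalerBr; congr (_ *: _).
Qed.

Lemma along_mul p (A : point -> 'M[R]_(p, n)) w z u :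
  along w A u *m z = \sum_k \sum_l (w k 0 * z l 0) *: (dm k A u *m ecol l).
Proof.
rewrite /along mulmx_suml; apply: eq_bigr => k _.
rewrite {1}(col_ecol z) mulmx_sumr; apply: eq_bigr => l _.
by rewrite -scalemxAl -scalemxAr scalerA.
Qed.

(** The Codazzi equation contracted with two vectors and solved for the ordinary derivatives. *)
Lemma closed_along Gm (A : point -> 'M[R]_n) u w z : U u -> msmooth U A ->
  (forall k l, cov Gm k (fun p => A p *m ecol l) u = cov Gm l (fun p => A p *m ecol k) u) ->
  along w A u *m z - along z A u *m w =
  contract Gm u z *m (A u *m w) - contract Gm u w *m (A u *m z).
Proof.
move=> Uu sA cl.
have E w' z' : along w' A u *m z' + contract Gm u w' *m (A u *m z') =
    \sum_k \sum_l (w' k 0 * z' l 0) *: cov Gm k (fun p => A p *m ecol l) u.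
  have -> : contract Gm u w' *m (A u *m z') =
      \sum_k \sum_l (w' k 0 * z' l 0) *: (Gm k u *m (A u *m ecol l)).
    rewrite /contract mulmx_suml; apply: eq_bigr => k _.
    rewrite {1}(col_ecol z') !mulmx_sumr; apply: eq_bigr => l _.
    by rewrite -!scalemxAr -scalemxAl scalerA mulrC.
  rewrite along_mul -big_split; apply: eq_bigr => k _ /=.
  rewrite -big_split; apply: eq_bigr => l _ /=.
  rewrite (cov_mulr oU _ _ _ Uu sA) /cov mulmxDl mulmxA -scalerDr.
  by [].
have h : along w A u *m z + contract Gm u w *m (A u *m z) =
         along z A u *m w + contract Gm u z *m (A u *m w).
  rewrite !E exchange_big /=; apply: eq_bigr => k _; apply: eq_bigr => l _.
  by rewrite cl mulrC.
by apply/eqP; rewrite subr_eq addrAC eq_sym subr_eq addrC; apply/eqP; rewrite -h addrC.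
Qed.

End Contractions.

(** * Calculus along curves and along families of curves *)

Section SmoothCurves.
Context {R : realType}.

Lemma derive1_dmx n (u : R -> 'rV[R]_n) x : smooth setT u -> derive1 u x = dmx (1 : R) u x.
Proof.
move=> su; apply/matrixP => i j; rewrite derive1E dmxE derive_mxE//.
exact: smooth_diff su I.
Qed.

Lemma is_derive_dmx (f : R -> R) (A : R -> 'M[R]_1) x : (forall y, f y = A y 0 0) ->
  msmooth setT A -> is_derive x (1 : R) f (dmx (1 : R) A x 0 0).
Proof.
move=> fA sA; have -> : f = (fun y => A y 0 0) by apply/funext.
apply: DeriveDef; first exact: smooth_derivable (sA 0 0) I.
by rewrite dmxE.
Qed.

(** The inequality is strict because constancy is needed on a neighbourhood of [x]; this is the
    origin of the bounds L + 1 further on. *)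
Lemma dmx_const_outside p q (A : R -> 'M[R]_(p, q)) L c x :
  (forall x, L <= `|x| -> A x = c) -> L < `|x| -> dmx (1 : R) A x = 0.
Proof.
move=> Ac Lx; have oL : open [set x : R | L < `|x|].
  apply: (@open_comp _ _ (fun y : R => `|y|) [set y | L < y]); last exact: open_gt.
  by move=> y _; exact: (@norm_continuous _ R).
have h y : L < `|y| -> A y = (fun=> c) y by move=> Ly; apply: Ac; exact: ltW.
by rewrite (dmx_eq oL Lx (1 : R) h) dmx_cst.
Qed.

Lemma sp_derive n (xi v : R -> 'cV[R]_n) x : msmooth setT xi -> msmooth setT v ->
  is_derive x (1 : R) (fun y => sp (xi y) (v y))
    (sp (dmx (1 : R) xi x) (v x) + sp (xi x) (dmx (1 : R) v x)).
Proof.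
move=> sx sv; have oT : open (setT : set R) by exact: openT.
have sxt := msmooth_tr oT sx; have sm := msmoothM oT sxt sv.
have h := is_derive_dmx x (fun y => erefl (sp (xi y) (v y))) sm.
apply: is_derive_eq h _; rewrite (dmxM oT I)// dmx_tr.
by rewrite /sp mxE.
Qed.

Lemma smooth_primitive (P f : R -> R) : (forall x, is_derive x (1 : R) P (f x)) ->
  smooth setT f -> smooth setT P.
Proof.
move=> dP sf k; have dfP x : differentiable P x.
  by apply/derivable1_diffP; have [] := dP x.
case: k => [|k]; first by move=> x _; exact: differentiable_continuous.
split=> [x _|v]; first exact: dfP.
have oT : open (setT : set R) by exact: openT.
have := smoothM oT (@smooth_cst _ _ _ setT v) sf k.
apply: Ck_eq oT _ => x _; have -> : 'D_v P x = v * 'D_1 P x.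
  by rewrite -{1}[v]mulr1 (@deriveZdir _ _ P x v 1).
by have [_ ->] := dP x.
Qed.

Lemma Dinv_smooth L (f : R -> R) : 0 < L -> cc L f -> smooth setT f -> smooth setT (Dinv f).
Proof. by move=> L0 cf sf; apply: smooth_primitive sf => x; exact: Dinv_derive L0 cf. Qed.

End SmoothCurves.

Section AlongMaps.
Context {R : realType} {W : normedModType R} {n : nat} (U : set 'rV[R]_n) (oU : open U).
Context (D : set W) (oD : open D) (phi : W -> 'rV[R]_n) (sphi : msmooth D phi)
  (DU : forall q, D q -> U (phi q)).
Notation col := 'cV[R]_n.

Lemma msmooth_along p q (A : 'rV[R]_n -> 'M[R]_(p, q)) : msmooth U A ->
  msmooth D (fun x => A (phi x)).
Proof. by move=> sA i j; apply: (smooth_comp oD DU (sA i j)) => k; exact: sphi. Qed.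

Lemma dmx_map p q (A : 'rV[R]_n -> 'M[R]_(p, q)) x w : msmooth U A -> D x ->
  dmx w (fun x => A (phi x)) x = along (dmx w phi x)^T A (phi x).
Proof.
move=> sA Dx; rewrite (dmx_comp w oD DU sA sphi Dx).
exact: dmx_along (DU Dx) sA.
Qed.

Context (Gm : 'I_n -> 'rV[R]_n -> 'M[R]_n) (sGm : forall k, msmooth U (Gm k)).

Lemma msmooth_contract (V : W -> col) : msmooth D V ->
  msmooth D (fun x => contract Gm (phi x) (V x)).
Proof.
move=> sV; apply: msmooth_sum => // k; apply: msmoothZ => //.
exact: msmooth_along.
Qed.

Lemma dmx_contract (V : W -> col) x w : msmooth D V -> D x ->
  dmx w (fun x => contract Gm (phi x) (V x)) x =
    contract Gm (phi x) (dmx w V x) + dcontract Gm (phi x) (dmx w phi x)^T (V x).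
Proof.
move=> sV Dx; have sk k := msmooth_along (sGm k).
rewrite /contract (dmx_sum oD Dx); last by move=> k; apply: msmoothZ.
rewrite -big_split; apply: eq_bigr => k _ /=.
by rewrite (dmxZ Dx _ (sV k 0) (sk k)) (dmx_map _ (sGm k) Dx) dmxE.
Qed.

End AlongMaps.

(** * The Jacobi integrand along one curve *)

Section Criterion.
Context {R : realType} {n : nat} (U : set 'rV[R]_n) (oU : open U).
Notation point := 'rV[R]_n.
Notation col := 'cV[R]_n.
Context (g : point -> 'M[R]_n) (mg : metric U g).
Context (m : nat) (a : 'I_m -> point -> 'M[R]_n) (sg : 'I_m -> 'I_m) (sgK : involutive sg).
Hypotheses (sa : forall al, msmooth U (a al))
  (ada : forall al u, U u -> selfadj g u (a al u))
  (cla : forall al k l u, U u -> cov (Gam g) k (fun p => a al p *m ecol l) u =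
     cov (Gam g) l (fun p => a al p *m ecol k) u)
  (cma : forall al be u, U u -> a al u *m a be u = a be u *m a al u)
  (crv : forall k l u, U u -> conn_curv (Gam g) k l u *m g u =
     \sum_al ((a al u *m ecol k) *m (a (sg al) u *m ecol l)^T
              - (a al u *m ecol l) *m (a (sg al) u *m ecol k)^T)).

Notation Gc := (contract (Gam g)).
(** The zeroth-order coefficient - g^{is} Gamma^j_{sk} w^k of the operator; [dCm] is its derivative
    along [v] with [w] fixed. *)
Definition Cm p (w : col) : 'M[R]_n := - (g p *m (Gc p w)^T).
Definition dCm p (v w : col) : 'M[R]_n :=
  - (along v g p *m (Gc p w)^T + g p *m (dcontract (Gam g) p v w)^T).
Definition tl al p (w xi : col) : R := sp xi (a al p *m w).
Notation D1 := (dmx (1 : R)).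

Let sgm : msmooth U g. Proof. exact: metric_msmooth. Qed.
Let sGm k : msmooth U (Gam g k). Proof. exact: msmooth_Gam. Qed.

Section Maps.
Context {W : normedModType R} (D : set W) (oD : open D) (phi : W -> point)
  (sphi : msmooth D phi) (DU : forall q, D q -> U (phi q)).

Lemma msmooth_Cm (V : W -> col) : msmooth D V -> msmooth D (fun x => Cm (phi x) (V x)).
Proof.
move=> sV; apply: msmoothN => //; apply: msmoothM => //; first exact: (msmooth_along oD sphi DU sgm).
by apply: msmooth_tr => //; exact: (msmooth_contract oD sphi DU sGm).
Qed.

Lemma dmx_Cm (V : W -> col) x w : msmooth D V -> D x ->
  dmx w (fun x => Cm (phi x) (V x)) x =
    dCm (phi x) (dmx w phi x)^T (V x) + Cm (phi x) (dmx w V x).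
Proof.
move=> sV Dx; have sc := msmooth_contract oD sphi DU sGm sV; have sct := msmooth_tr oD sc.
have sgu := msmooth_along oD sphi DU sgm.
rewrite /Cm (dmxN Dx _ (msmoothM oD sgu sct)) (dmxM oD Dx _ sgu sct) dmx_tr.
rewrite (dmx_contract oD sphi DU sGm _ sV Dx) (dmx_map oD sphi DU _ sgm Dx).
rewrite trmx_add mulmxDr /dCm.
move: (along _ _ _ *m _) (g _ *m (dcontract _ _ _ _)^T) (g _ *m (Gc _ _)^T) => X Y Z.
by apply/matrixP => i j; rewrite !mxE; ring.
Qed.

End Maps.

Section Curve.
Context (u : R -> point) (su : smooth setT u) (uU : forall x, U (u x)).
Definition vel (x : R) : col := (D1 u x)^T.
(** The index [sg al] is the convention of the paired tails: the affinor under the inverse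
    derivative is the partner of the one in front. *)
Definition pt al (xi : R -> col) : R -> R := Dinv (fun y => tl (sg al) (u y) (vel y) (xi y)).
(** The covariant derivative of the covector field [xi] along the curve; the local part of the
    operator is [g] applied to it. *)
Definition hat (xi : R -> col) x : col := D1 xi x - (Gc (u x) (vel x))^T *m xi x.
Definition Jc (xi : R -> col) x : col :=
  g (u x) *m hat xi x + (\sum_al pt al xi x *: a al (u x)) *m vel x.
(* The integral of Eint is the variation of <xi, J(u) eta> with u in the direction
   V, at fixed xi and eta, after (d/dx)^{-1} has been moved off the varied factor. *)
Definition Eint (xi eta V : R -> col) x : R :=
  sp (xi x) (along (V x) g (u x) *m D1 eta x) + sp (xi x) (dCm (u x) (V x) (vel x) *m eta x)
  + sp (xi x) (Cm (u x) (D1 V x) *m eta x)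
  + \sum_al (sp (xi x) (along (V x) (a al) (u x) *m vel x + a al (u x) *m D1 V x) * pt al eta x
    - sp (eta x) (along (V x) (a al) (u x) *m vel x + a al (u x) *m D1 V x) * pt al xi x).
(** The terms of [Eint] that contain the derivative of [V], with [V] in its place: subtracting the
    derivative of [Theta] integrates these terms by parts. *)
Definition Theta (xi eta V : R -> col) x : R :=
  sp (xi x) (Cm (u x) (V x) *m eta x)
  + \sum_al (sp (xi x) (a al (u x) *m V x) * pt al eta x
             - sp (eta x) (a al (u x) *m V x) * pt al xi x).

Let oT : open (setT : set R). Proof. exact: openT. Qed.
Let smu : msmooth setT u. Proof. by move=> i j; apply: (smooth_mxP _ oT).1. Qed.

Lemma msmooth_vel : msmooth setT vel.
Proof. by apply: msmooth_tr => //; exact: msmooth_dmx. Qed.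

Let uUT x : [set: R] x -> U (u x). Proof. by []. Qed.

Lemma msmooth_curve p q (A : point -> 'M[R]_(p, q)) : msmooth U A ->
  msmooth setT (fun x => A (u x)).
Proof. exact: (msmooth_along oT smu uUT). Qed.

Lemma dmx_curve p q (A : point -> 'M[R]_(p, q)) x : msmooth U A ->
  D1 (fun x => A (u x)) x = along (vel x) A (u x).
Proof. by move=> sA; rewrite (dmx_map oT smu uUT _ sA I). Qed.

Context (L : R) (L0 : 0 < L) (u0 : forall x, L <= `|x| -> D1 u x = 0).

Lemma vel0 x : L <= `|x| -> vel x = 0.
Proof. by move=> Lx; rewrite /vel u0// trmx0. Qed.

Lemma smooth_tl al (xi : R -> col) : msmooth setT xi ->
  smooth setT (fun x => tl al (u x) (vel x) (xi x)).
Proof.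
move=> sx; have sv := msmooth_vel; have sA := msmooth_curve (sa al).
exact: (msmoothM oT (msmooth_tr oT sx) (msmoothM oT sA sv)).
Qed.

Lemma cc_tl al (xi : R -> col) : msmooth setT xi ->
  cc L (fun x => tl al (u x) (vel x) (xi x)).
Proof.
move=> sx; split; last by move=> x Lx; rewrite /tl vel0// mulmx0 sp0r.
by move=> x; apply: (smooth_cont (smooth_tl al sx) I).
Qed.

Lemma pt_derive al (xi : R -> col) x : msmooth setT xi ->
  is_derive x (1 : R) (pt al xi) (tl (sg al) (u x) (vel x) (xi x)).
Proof. by move=> sx; apply: (Dinv_derive x L0); exact: cc_tl. Qed.

Lemma smooth_pt al (xi : R -> col) : msmooth setT xi -> smooth setT (pt al xi).
Proof.
by move=> sx; apply: (Dinv_smooth L0); [exact: cc_tl|exact: smooth_tl].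
Qed.

Lemma msmooth_hat (xi : R -> col) : msmooth setT xi -> msmooth setT (hat xi).
Proof.
move=> sx; apply: msmoothB => //; first exact: msmooth_dmx.
apply: msmoothM => //; apply: msmooth_tr => //; apply: (msmooth_contract oT smu uUT sGm).
exact: msmooth_vel.
Qed.

Lemma msmooth_Jc (xi : R -> col) : msmooth setT xi -> msmooth setT (Jc xi).
Proof.
move=> sx; apply: msmoothD => //.
  by apply: msmoothM => //; [exact: msmooth_curve|exact: msmooth_hat].
apply: msmoothM => //; last exact: msmooth_vel.
apply: msmooth_sum => // al; apply: msmoothZ => //; first exact: smooth_pt.
exact: msmooth_curve.
Qed.

(** Every term has a derivative of [u] or of [xi] as a factor, so the nonzero limits of the tails do
    no harm. *)
Lemma Jc0 (xi : R -> col) x : (forall x, L <= `|x| -> D1 xi x = 0) -> L <= `|x| -> Jc xi x = 0.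
Proof.
move=> x0 Lx; rewrite /Jc vel0// mulmx0 addr0 /hat x0// vel0// sub0r.
have -> : Gc (u x) 0 = 0 by rewrite /contract big1// => k _; rewrite mxE scale0r.
by rewrite trmx0 mul0mx oppr0 mulmx0.
Qed.

Lemma Theta_derive (xi eta V : R -> col) x :
  msmooth setT xi -> msmooth setT eta -> msmooth setT V ->
  is_derive x (1 : R) (Theta xi eta V)
    (sp (D1 xi x) (Cm (u x) (V x) *m eta x)
     + sp (xi x) (dCm (u x) (vel x) (V x) *m eta x + Cm (u x) (D1 V x) *m eta x
                  + Cm (u x) (V x) *m D1 eta x)
     + \sum_al ((sp (D1 xi x) (a al (u x) *m V x)
          + sp (xi x) (along (vel x) (a al) (u x) *m V x + a al (u x) *m D1 V x)) * pt al eta x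
        + sp (xi x) (a al (u x) *m V x) * tl (sg al) (u x) (vel x) (eta x)
        - ((sp (D1 eta x) (a al (u x) *m V x)
          + sp (eta x) (along (vel x) (a al) (u x) *m V x + a al (u x) *m D1 V x)) * pt al xi x
        + sp (eta x) (a al (u x) *m V x) * tl (sg al) (u x) (vel x) (xi x)))).
Proof.
move=> sx se sV; have sC := msmooth_Cm oT smu uUT sV.
have sA al := msmooth_curve (sa al).
have d1 : is_derive x (1 : R) (fun x => sp (xi x) (Cm (u x) (V x) *m eta x))
    (sp (D1 xi x) (Cm (u x) (V x) *m eta x)
     + sp (xi x) (dCm (u x) (vel x) (V x) *m eta x + Cm (u x) (D1 V x) *m eta x
                  + Cm (u x) (V x) *m D1 eta x)).
  apply: is_derive_eq (sp_derive x sx (msmoothM oT sC se)) _.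
  by rewrite (dmxM oT I _ sC se) (dmx_Cm oT smu uUT _ sV I) mulmxDl.
have d2 (al : 'I_m) (y z : R -> col) : msmooth setT y -> msmooth setT z ->
    is_derive x (1 : R) (fun x => sp (y x) (a al (u x) *m V x) * pt al z x)
     ((sp (D1 y x) (a al (u x) *m V x)
          + sp (y x) (along (vel x) (a al) (u x) *m V x + a al (u x) *m D1 V x)) * pt al z x
        + sp (y x) (a al (u x) *m V x) * tl (sg al) (u x) (vel x) (z x)).
  move=> sy sz; have e1 := sp_derive x sy (msmoothM oT (sA al) sV).
  rewrite (dmxM oT I _ (sA al) sV) (dmx_curve x (sa al)) in e1.
  have e2 := pt_derive al x sz.
  have e3 := is_deriveM e1 e2; apply: is_derive_eq e3 _.
  by rewrite /GRing.scale /= addrC mulrC.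
have d3 (al : 'I_m) := is_deriveB (d2 al _ _ sx se) (d2 al _ _ se sx).
have d4 := is_deriveD d1 (is_derive_sum d3).
move: d4; set F := (X in is_derive _ _ X _); have -> : F = Theta xi eta V by
  apply/funext => y; rewrite /F /Theta -[LHS]/(_ + (\sum_(i < m) _) y) fct_sumE.
by [].
Qed.

Definition Pm (xi : R -> col) x : 'M[R]_n := \sum_al pt al xi x *: a al (u x).

Lemma dg_contract w p : U p -> along w g p = - (Gc p w *m g p + g p *m (Gc p w)^T).
Proof.
move=> Up; rewrite /along /contract mulmx_suml.
have -> : (\sum_k w k 0 *: Gam g k p)^T = \sum_k w k 0 *: (Gam g k p)^T.
  by rewrite linear_sum /=; apply: eq_bigr => k _; rewrite trmx_scale.
rewrite mulmx_sumr -big_split -sumrN; apply: eq_bigr => k _ /=.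
by rewrite (dm_metric oU mg k Up) scalerN -scalemxAl -scalemxAr scalerDr.
Qed.

(** The Gauss equation contracted with two vectors and two covectors. *)
Lemma curv_sp p (V w xi eta : col) : U p ->
  sp eta ((\sum_k \sum_l (V k 0 * w l 0) *: conn_curv (Gam g) k l p) *m g p *m xi) =
    \sum_al (sp eta (a al p *m V) * sp xi (a (sg al) p *m w)
             - sp eta (a al p *m w) * sp xi (a (sg al) p *m V)).
Proof.
move=> Up.
have outer (x y z t : col) : sp x (y *m z^T *m t) = sp x y * sp t z.
  have -> : sp t z = sp z t by rewrite -[z in LHS]mul1mx spT trmx1 mul1mx.
  rewrite /sp !mulmxA -[in LHS]mulmxA [x^T *m y]mx11_scalar mul_scalar_mx mxE.
  by rewrite !mxE eqxx mulr1n.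
have term k l : sp eta (conn_curv (Gam g) k l p *m g p *m xi) =
   \sum_al (sp eta (a al p *m ecol k) * sp xi (a (sg al) p *m ecol l)
             - sp eta (a al p *m ecol l) * sp xi (a (sg al) p *m ecol k)).
  rewrite (crv k l Up) mulmx_suml sp_sum; apply: eq_bigr => al _.
  by rewrite mulmxBl spDr spNr !outer.
have -> : (\sum_k \sum_l (V k 0 * w l 0) *: conn_curv (Gam g) k l p) *m g p *m xi =
   \sum_k \sum_l (V k 0 * w l 0) *: (conn_curv (Gam g) k l p *m g p *m xi).
  rewrite !mulmx_suml; apply: eq_bigr => k _; rewrite !mulmx_suml.
  by apply: eq_bigr => l _; rewrite -!scalemxAl.
rewrite sp_sum; under eq_bigr do rewrite sp_sum.
under eq_bigr => k _ do under eq_bigr => l _ do rewrite spZr term mulr_sumr.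
under eq_bigr => k _ do rewrite exchange_big /=.
rewrite exchange_big /=; apply: eq_bigr => al _.
have ex (x z : col) (M : 'M[R]_n) : sp x (M *m z) = \sum_k z k 0 * sp x (M *m ecol k).
  by rewrite {1}(col_ecol z) mulmx_sumr sp_sum; apply: eq_bigr => k _; rewrite -scalemxAr spZr.
rewrite (ex eta V) (ex xi w) (ex eta w) (ex xi V) !big_distrlr /=.
rewrite [X in _ = _ - X]exchange_big /= -sumrB; apply: eq_bigr => k _.
by rewrite -sumrB; apply: eq_bigr => l _; ring.
Qed.

(** [jacobi_integrand] at the point [u x], fed with metric compatibility, the definition of
    curvature, the Codazzi equations and the Gauss equation. The difference it leaves contains no
    derivative of [V]. *)
Lemma Eint_Theta (xi eta V : R -> col) x :
  msmooth setT xi -> msmooth setT eta -> msmooth setT V ->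
  is_derive x (1 : R) (Theta xi eta V)
    (Eint xi eta V x -
     (sp (eta x) (Gc (u x) (V x) *m Jc xi x) - sp (xi x) (Gc (u x) (V x) *m Jc eta x)
      - sp (hat xi x) (Pm eta x *m V x) + sp (hat eta x) (Pm xi x *m V x))).
Proof.
move=> sx se sV; apply: is_derive_eq (Theta_derive x sx se sV) _.
have Up := uU x.
have gT := metric_sym mg Up.
pose Rm := \sum_k \sum_l (V x k 0 * vel x l 0) *: conn_curv (Gam g) k l (u x).
have RmE := contract_curv (Gam g) (u x) (V x) (vel x).
have dC : dCm (u x) (V x) (vel x) - dCm (u x) (vel x) (V x) =
    Gc (u x) (V x) *m g (u x) *m (Gc (u x) (vel x))^T
    - Gc (u x) (vel x) *m g (u x) *m (Gc (u x) (V x))^T - g (u x) *m Rm^T.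
  rewrite /Rm -RmE /dCm !(dg_contract _ Up).
  move: (g (u x)) (Gc (u x) (V x)) (Gc (u x) (vel x)) => g' A B.
  move: (dcontract _ _ _ _) (dcontract _ _ _ _) => dA dB.
  rewrite !(trmx_add, trmx_opp, trmx_mul) !mulNmx !mulmxDl !mulmxDr !mulmxN !mulmxA.
  move: (A *m g' *m B^T) (g' *m A^T *m B^T) (g' *m dA^T) (B *m g' *m A^T) (g' *m B^T *m A^T).
  move: (g' *m dB^T) => *.
  by apply/matrixP => i j; rewrite !mxE; ring.
have av al : along (V x) (a al) (u x) *m vel x - along (vel x) (a al) (u x) *m V x =
    Gc (u x) (vel x) *m (a al (u x) *m V x) - Gc (u x) (V x) *m (a al (u x) *m vel x).
  rewrite (closed_along oU _ _ Up (sa al) (fun k l => cla al k l Up)).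
  by [].
have J := jacobi_integrand sgK (fun al => pt al xi x) (fun al => pt al eta x) (hat xi x) (hat eta x)
  gT (dg_contract (V x) Up) (erefl (Cm (u x) (V x))) dC av (curv_sp (V x) (vel x) (xi x) (eta x) Up).
have E (y : R -> col) : hat y x + (Gc (u x) (vel x))^T *m y x = D1 y x by rewrite /hat subrK.
rewrite /= !E in J; rewrite -[Jc xi x]/(_ + Pm xi x *m vel x) -[Jc eta x]/(_ + Pm eta x *m vel x).
rewrite /Eint -J.
set S1 := (X in _ + X = _); set S2 := (X in _ = _ + X - _); set S3 := (X in _ = _ - (_ + X)).
have -> : S1 = S2 - S3.
  by rewrite /S1 /S2 /S3 -sumrB; apply: eq_bigr => al _; rewrite /tl !spDr; ring.
rewrite !spDr; ring.
Qed.

Lemma msmooth_alongV p q (A : point -> 'M[R]_(p, q)) (V : R -> col) : msmooth U A ->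
  msmooth setT V -> msmooth setT (fun x => along (V x) A (u x)).
Proof.
move=> sA sV; apply: msmooth_sum => // k; apply: msmoothZ => //.
by apply: msmooth_curve; apply: msmooth_dmx.
Qed.

Lemma smooth_sp (xi V : R -> col) : msmooth setT xi -> msmooth setT V ->
  smooth setT (fun x => sp (xi x) (V x)).
Proof. by move=> sx sV; exact: (msmoothM oT (msmooth_tr oT sx) sV). Qed.

Lemma msmooth_Eblocks (V : R -> col) : msmooth setT V ->
  [/\ msmooth setT (fun x => along (V x) g (u x)),
      msmooth setT (fun x => dCm (u x) (V x) (vel x)),
      msmooth setT (fun x => Cm (u x) (D1 V x)) &
      forall al, msmooth setT (fun x => along (V x) (a al) (u x) *m vel x + a al (u x) *m D1 V x)].
Proof.
move=> sV; have sv := msmooth_vel; have sDV : msmooth setT (D1 V) by exact: msmooth_dmx.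
have sgV := msmooth_alongV sgm sV; split => //.
- apply: msmoothN => //; apply: msmoothD => //; apply: msmoothM => //.
  + by apply: msmooth_tr => //; exact: (msmooth_contract oT smu uUT sGm).
  + exact: msmooth_curve.
  + apply: msmooth_tr => //; apply: msmooth_sum => // k; apply: msmoothZ => //.
    exact: msmooth_alongV.
- exact: (msmooth_Cm oT smu uUT).
- move=> al; apply: msmoothD => //; apply: msmoothM => //.
  + exact: msmooth_alongV.
  + exact: msmooth_curve.
Qed.

Lemma smooth_Eint (xi eta V : R -> col) : msmooth setT xi -> msmooth setT eta ->
  msmooth setT V -> smooth setT (Eint xi eta V).
Proof.
move=> sx se sV; have [b1 b2 b3 b4] := msmooth_Eblocks sV.
apply: smoothD => //; first apply: smoothD => //; first apply: smoothD => //.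
- by apply: smooth_sp => //; apply: msmoothM => //; exact: msmooth_dmx.
- by apply: smooth_sp => //; apply: msmoothM.
- by apply: smooth_sp => //; apply: msmoothM.
apply: smooth_sum => // al _; apply: smoothB => //; apply: smoothM => //.
- exact: smooth_sp.
- exact: smooth_pt.
- exact: smooth_sp.
- exact: smooth_pt.
Qed.

Lemma cc_Eint (xi eta V : R -> col) : msmooth setT xi -> msmooth setT eta ->
  msmooth setT V -> (forall x, L <= `|x| -> V x = 0) -> cc (L + 1) (Eint xi eta V).
Proof.
move=> sx se sV V0; split => [x|x Lx]; first exact: (smooth_cont (smooth_Eint sx se sV) I).
have Lx' : L < `|x| by apply: lt_le_trans Lx; rewrite ltrDl.
have z p q (A : point -> 'M[R]_(p, q)) : along 0 A (u x) = 0.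
  by rewrite /along big1// => k _; rewrite mxE scale0r.
have zc Gm : contract Gm (u x) 0 = 0 :> 'M[R]_n.
  by rewrite /contract big1// => k _; rewrite mxE scale0r.
rewrite /Eint (dmx_const_outside V0 Lx') (V0 x (ltW Lx')) (vel0 (ltW Lx')).
rewrite !z /dCm /Cm /dcontract !zc trmx0 !mulmx0 addr0 oppr0 !mul0mx !sp0r !add0r.
by rewrite big1// => al _; rewrite !z !mul0mx !mulmx0 addr0 !sp0r !mul0r subrr.
Qed.

(** By [Eint_Theta] and [cyclic_zero] the cyclic sum of the integrands is the derivative of a cyclic
    sum of [Theta], which vanishes at both ends together with the variations. *)
Lemma Eint_cyclic (xi1 xi2 xi3 : R -> col) :
  msmooth setT xi1 -> msmooth setT xi2 -> msmooth setT xi3 ->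
  (forall x, L <= `|x| -> D1 xi1 x = 0) -> (forall x, L <= `|x| -> D1 xi2 x = 0) ->
  (forall x, L <= `|x| -> D1 xi3 x = 0) ->
  integral (Eint xi1 xi2 (Jc xi3)) + integral (Eint xi2 xi3 (Jc xi1))
    + integral (Eint xi3 xi1 (Jc xi2)) = 0.
Proof.
move=> s1 s2 s3 z1 z2 z3.
(* [cc_Eint] controls the derivative of the variation only strictly beyond [L], so the integrals are
   taken on the larger segment. *)
have L1 : 0 < L + 1 by apply: addr_gt0.
have S1 := msmooth_Jc s1; have S2 := msmooth_Jc s2; have S3 := msmooth_Jc s3.
have c1 := cc_Eint s1 s2 S3 (fun x => Jc0 z3).
have c2 := cc_Eint s2 s3 S1 (fun x => Jc0 z1).
have c3 := cc_Eint s3 s1 S2 (fun x => Jc0 z2).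
have T0 y z V x : V x = 0 -> Theta y z V x = 0.
  move=> V0; rewrite /Theta V0 /Cm.
  have -> : Gc (u x) 0 = 0 by rewrite /contract big1// => k _; rewrite mxE scale0r.
  rewrite trmx0 mulmx0 oppr0 mul0mx sp0r add0r big1// => al _.
  by rewrite !mulmx0 !sp0r !mul0r subrr.
have dT x := is_deriveD (is_deriveD (Eint_Theta x s1 s2 S3) (Eint_Theta x s2 s3 S1))
  (Eint_Theta x s3 s1 S2).
have nL : `|L + 1| = L + 1 by rewrite gtr0_norm.
have zL x : `|x| = L + 1 ->
    Theta xi1 xi2 (Jc xi3) x + Theta xi2 xi3 (Jc xi1) x + Theta xi3 xi1 (Jc xi2) x = 0.
  move=> xL; have Lx : L <= `|x| by rewrite xL lerDl.
  by rewrite !T0 ?addr0//; apply: Jc0.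
pose F x := Theta xi1 xi2 (Jc xi3) x + Theta xi2 xi3 (Jc xi1) x + Theta xi3 xi1 (Jc xi2) x.
have {}zL x : `|x| = L + 1 -> F x = 0 by exact: zL.
have dF x : is_derive x (1 : R) F
    (Eint xi1 xi2 (Jc xi3) x + Eint xi2 xi3 (Jc xi1) x + Eint xi3 xi1 (Jc xi2) x); last first.
  rewrite -(integralD L1 c1 c2) -(integralD L1 (ccD c1 c2) c3).
  rewrite (integral_derive L1 (ccD (ccD c1 c2) c3) dF).
  by rewrite !zL ?normrN// subrr.
apply: is_derive_eq (dT x) _.
have Up := uU x; have gT := metric_sym mg Up.
have sP (y : R -> col) : Pm y x *m g (u x) = g (u x) *m (Pm y x)^T.
  rewrite /Pm mulmx_suml linear_sum mulmx_sumr; apply: eq_bigr => al _ /=.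
  have := ada al Up; rewrite /selfadj => sadj; have gU := metric_unit mg Up.
  rewrite -scalemxAl (trmx_scale (pt al y x)) -scalemxAr; congr (_ *: _).
  by rewrite -[LHS]mul1mx -{1}(mulmxV gU) -!mulmxA (mulmxA (invmx _)) sadj -!mulmxA mulVmx// mulmx1.
have cP (y z : R -> col) : Pm y x *m Pm z x = Pm z x *m Pm y x.
  rewrite /Pm !mulmx_suml; under eq_bigr do rewrite mulmx_sumr.
  under [RHS]eq_bigr do rewrite mulmx_sumr.
  rewrite exchange_big; apply: eq_bigr => al _; apply: eq_bigr => be _.
  rewrite -!scalemxAl -!scalemxAr !scalerA (cma _ _ Up) mulrC.
  by [].
have Gs w z : Gc (u x) w *m z = Gc (u x) z *m w.
  by apply: contract_sym => k l; apply: (Gam_sym oU mg k l Up).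
have CZ := cyclic_zero (xi1 x) (xi2 x) (xi3 x) (hat xi1 x) (hat xi2 x) (hat xi3 x) (vel x) gT Gs
  (sP xi1) (sP xi2) (sP xi3) (cP xi1 xi2) (cP xi1 xi3) (cP xi2 xi3).
have alg (e1 e2 e3 t1 t2 t3 : R) : t1 + t2 + t3 = 0 ->
  (e1 - t1) + (e2 - t2) + (e3 - t3) = e1 + e2 + e3.
  by move=> h; rewrite -[RHS]subr0 -h; ring.
exact: (alg _ _ _ _ _ _ CZ).
Qed.

End Curve.
End Criterion.

(** * Skew-symmetry of the operator *)

Section Skew.
Context {R : realType} {n : nat} (U : set 'rV[R]_n) (oU : open U).
Notation point := 'rV[R]_n.
Notation col := 'cV[R]_n.
Context (g : point -> 'M[R]_n) (mg : metric U g).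
Context (m : nat) (a : 'I_m -> point -> 'M[R]_n) (sg : 'I_m -> 'I_m) (sgK : involutive sg).
Hypotheses (sa : forall al, msmooth U (a al)).
Context (u : R -> point) (su : smooth setT u) (uU : forall x, U (u x)).
Context (L : R) (L0 : 0 < L) (u0 : forall x, L <= `|x| -> dmx (1 : R) u x = 0) (uL : u L = u (- L)).
Notation Jc := (Jc g a sg u).
Notation hatu := (hat g u).
Notation vel := (vel u).
Implicit Types xi eta : R -> col.

Definition lpart xi eta (x : R) : R := sp (xi x) (g (u x) *m hatu eta x).
Definition tld al xi (x : R) : R := tl a al (u x) (vel x) (xi x).

Let oT : open (setT : set R). Proof. exact: openT. Qed.
Let sgm : msmooth U g. Proof. exact: metric_msmooth. Qed.

Lemma hat0 xi x : (forall x, L <= `|x| -> dmx (1 : R) xi x = 0) -> L <= `|x| -> hatu xi x = 0.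
Proof.
move=> x0 Lx; rewrite /hat x0// (vel0 u0)//.
have -> : contract (Gam g) (u x) 0 = 0 by rewrite /contract big1// => k _; rewrite mxE scale0r.
by rewrite trmx0 mul0mx subr0.
Qed.

Lemma cc_lpart xi eta : msmooth setT xi -> msmooth setT eta ->
  (forall x, L <= `|x| -> dmx (1 : R) eta x = 0) -> cc L (lpart xi eta).
Proof.
move=> sx se e0; split=> [x|x Lx]; last by rewrite /lpart hat0// mulmx0 sp0r.
have sm : smooth setT (lpart xi eta).
  apply: smooth_sp => //; apply: msmoothM => //; last exact: (msmooth_hat oU mg su uU se).
  exact: (msmooth_curve su uU sgm).
exact: (smooth_cont sm I).
Qed.

Lemma cc_tld al xi : msmooth setT xi -> cc L (tld al xi).
Proof. by move=> sx; exact: (cc_tl sa su uU u0). Qed.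

Lemma integral_Jc xi eta : msmooth setT xi -> msmooth setT eta ->
  (forall x, L <= `|x| -> dmx (1 : R) eta x = 0) ->
  cc L (fun x => sp (xi x) (Jc eta x)) /\
  integral (fun x => sp (xi x) (Jc eta x)) =
    integral (lpart xi eta) + \sum_al bil (tld al xi) (tld (sg al) eta).
Proof.
move=> sx se e0; have cq := cc_lpart sx se e0.
have cb al := bil_cc L0 (cc_tld al sx) (cc_tld (sg al) se).
have E : (fun x => sp (xi x) (Jc eta x)) =
    (fun x => lpart xi eta x + \sum_al tld al xi x * Dinv (tld (sg al) eta) x).
  apply/funext => x; rewrite /Jc spDr; congr (_ + _).
  rewrite mulmx_suml sp_sum; apply: eq_bigr => al _.
  by rewrite -scalemxAl spZr mulrC.
rewrite E; split; first by apply: ccD => //; exact: cc_sum.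
by rewrite (integralD L0 cq (cc_sum _ cb)) (integral_sum _ L0 cb).
Qed.

(** The sum of the two integrands is the derivative of g(xi, eta), since [g] is parallel. The
    covectors need not vanish at the ends; equal values there suffice. *)
Lemma lpart_skew xi eta : msmooth setT xi -> msmooth setT eta ->
  (forall x, L <= `|x| -> dmx (1 : R) xi x = 0) -> (forall x, L <= `|x| -> dmx (1 : R) eta x = 0) ->
  xi L = xi (- L) -> eta L = eta (- L) ->
  integral (lpart xi eta) = - integral (lpart eta xi).
Proof.
move=> sx se x0 e0 xL eL; apply/eqP; rewrite -addr_eq0; apply/eqP.
have c1 := cc_lpart sx se e0; have c2 := cc_lpart se sx x0.
rewrite -(integralD L0 c1 c2).
have sgu : msmooth setT (fun x => g (u x)) := msmooth_curve su uU sgm.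
have d x : is_derive x (1 : R) (fun y => sp (xi y) (g (u y) *m eta y)) (lpart xi eta x + lpart eta xi x).
  apply: is_derive_eq (sp_derive x sx (msmoothM oT sgu se)) _.
  rewrite (dmxM oT I _ sgu se) (dmx_curve su uU x sgm) (dg_contract oU mg _ (uU x)).
  rewrite /lpart /hat.
  have gT := metric_sym mg (uU x); move: gT.
  move: (contract (Gam g) (u x) (vel x)) (g (u x)) => Gu G gT.
  rewrite !mulmxBr !spDr !spNr mulNmx spNr mulmxDl spDr.
  rewrite (spT (eta x) G (dmx (1 : R) xi x)) gT.
  have -> : sp (eta x) (G *m (Gu^T *m xi x)) = sp (xi x) (Gu *m G *m eta x).
    by rewrite mulmxA spT trmx_mul trmxK gT.
  by rewrite !mulmxA; ring.
rewrite (integral_derive L0 (ccD c1 c2) d).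
by rewrite uL xL eL subrr.
Qed.

(** For the tails, skewness of [bil] exchanges a density with that of its partner, and reindexing by
    the involution restores the sum. *)
Lemma Jc_skew xi eta : msmooth setT xi -> msmooth setT eta ->
  (forall x, L <= `|x| -> dmx (1 : R) xi x = 0) -> (forall x, L <= `|x| -> dmx (1 : R) eta x = 0) ->
  xi L = xi (- L) -> eta L = eta (- L) ->
  integral (fun x => sp (xi x) (Jc eta x)) = - integral (fun x => sp (eta x) (Jc xi x)).
Proof.
move=> sx se x0 e0 xL eL.
apply: (etrans (integral_Jc sx se e0).2); apply/esym.
apply: (etrans (congr1 -%R (integral_Jc se sx x0).2)).
rewrite (lpart_skew sx se x0 e0 xL eL) opprD; congr (_ + _).
rewrite -sumrN [RHS](reindex_inj (inv_inj sgK)) /=.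
apply: eq_bigr => al _; rewrite sgK.
by rewrite (bil_skew L0 (cc_tld _ se) (cc_tld _ sx)) opprK.
Qed.

End Skew.

Section Slices.
Context {R : realType}.
Notation par := (R * R)%type.
Notation dom := (R * R * R)%type.
Context (O : set par) (oO : open O) {p q : nat} (A : dom -> 'M[R]_(p, q)) (sA : msmooth (over O) A).
Let oO' := open_over oO.

Lemma msmooth_slice z : O z -> msmooth setT (fun x => A (z, x)).
Proof. by move=> Oz i j; exact: smooth_slice (sA i j) Oz. Qed.

Lemma dmx_slice z x : O z -> dmx (1 : R) (fun y => A (z, y)) x = dmx (@ex R) A (z, x).
Proof.
move=> Oz; apply/matrixP => i j; rewrite !dmxE.
have [d e] : is_diff x (fun x : R => ((z, x) : dom)) (fun y => (0, y)) by apply: is_diff_pair.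
have dA : differentiable (fun w => A w i j) (z, x) := smooth_diff (sA i j) (Oz : over O (z, x)).
rewrite (@derive_comp _ _ _ (fun w => A w i j) (fun y : R => ((z, y) : dom)) x 1 d dA).
by rewrite (deriveE _ d) e.
Qed.

Lemma dmx_supp L (v : par) x : O 0 ->
  (\forall z \near (0 : par), forall x, L <= `|x| -> A (z, x) = 0) -> L <= `|x| ->
  dmx ((v, 0) : dom) A (0, x) = 0.
Proof.
move=> O0 A0 Lx; apply/matrixP => i j; rewrite dmxE mxE.
apply: (supp_derive v (sA i j) O0 _ Lx); apply: filterS A0 => z Az y Ly.
by rewrite Az// mxE.
Qed.

Lemma dmx_ends (v : par) x y : O 0 -> (\forall z \near (0 : par), A (z, x) = A (z, y)) ->
  dmx ((v, 0) : dom) A (0, x) = dmx ((v, 0) : dom) A (0, y).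
Proof.
move=> O0 Axy; apply/matrixP => i j; rewrite !dmxE.
apply: (near_param_derive v O0 (sA i j) (sA i j)).
by apply: filterS Axy => z ->.
Qed.

End Slices.

Lemma derive_sp (R : realType) (W : normedModType R) n (D : set W) (X Z : W -> 'cV[R]_n) x v :
  open D -> msmooth D X -> msmooth D Z -> D x ->
  'D_v (fun y => sp (X y) (Z y)) x = sp (dmx v X x) (Z x) + sp (X x) (dmx v Z x).
Proof.
move=> oD sX sZ Dx; have sXt := msmooth_tr oD sX.
have -> : 'D_v (fun y => sp (X y) (Z y)) x = dmx v (fun y => (X y)^T *m Z y) x 0 0 by rewrite dmxE.
by rewrite (dmxM oD Dx _ sXt sZ) dmx_tr mxE.
Qed.

(** * Variation of a bracket along a family of fields *)

Section Family.
Context {R : realType} {n : nat} (U : set 'rV[R]_n) (oU : open U).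
Notation point := 'rV[R]_n.
Notation col := 'cV[R]_n.
Notation par := (R * R)%type.
Notation dom := (R * R * R)%type.
Context (g : point -> 'M[R]_n) (mg : metric U g).
Context (m : nat) (a : 'I_m -> point -> 'M[R]_n) (sg : 'I_m -> 'I_m) (sgK : involutive sg).
Hypotheses (sa : forall al, msmooth U (a al)).
Context (O : set par) (oO : open O) (O0 : O 0).
Context (Uf : dom -> point) (Xf Ef : dom -> col) (sU : msmooth (over O) Uf)
  (UU : forall q, over O q -> U (Uf q)) (sX : msmooth (over O) Xf) (sE : msmooth (over O) Ef).
Notation es := (@es R).
Notation ex := (@ex R).
Context (L : R) (L0 : 0 < L).
Hypotheses (U0 : \forall z \near (0 : par), forall x, L <= `|x| -> dmx ex Uf (z, x) = 0)
  (X0 : \forall z \near (0 : par), forall x, L <= `|x| -> dmx ex Xf (z, x) = 0)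
  (E0 : \forall z \near (0 : par), forall x, L <= `|x| -> dmx ex Ef (z, x) = 0)
  (UL : \forall z \near (0 : par), Uf (z, L) = Uf (z, - L))
  (XL : \forall z \near (0 : par), Xf (z, L) = Xf (z, - L))
  (EL : \forall z \near (0 : par), Ef (z, L) = Ef (z, - L)).

Let oO' := open_over oO.
Let sgm : msmooth U g. Proof. exact: metric_msmooth. Qed.

Notation u := (fun x => Uf (0, x)).
Notation xi := (fun x => Xf (0, x)).
Notation eta := (fun x => Ef (0, x)).
Notation xid := (fun x => dmx es Xf (0, x)).
Notation etad := (fun x => dmx es Ef (0, x)).
Notation V := (fun x => (dmx es Uf (0, x))^T).
(** Below, [Lf] is the local integrand of the bracket and [Tf] a tail density, both as functions of
    parameters and position, as the lemmas on parametric integrals require. *)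
Let vf q : col := (dmx ex Uf q)^T.
Let Zf q : col := g (Uf q) *m dmx ex Ef q + Cm g (Uf q) (vf q) *m Ef q.
Let Lf q : R := sp (Xf q) (Zf q).
Let Tf (Y : dom -> col) al q : R := sp (Y q) (a al (Uf q) *m vf q).

Let svf : msmooth (over O) vf.
Proof. by apply: msmooth_tr => //; exact: msmooth_dmx. Qed.
Let sDU w : msmooth (over O) (dmx w Uf). Proof. exact: msmooth_dmx. Qed.
Let sDX w : msmooth (over O) (dmx w Xf). Proof. exact: msmooth_dmx. Qed.
Let sDE w : msmooth (over O) (dmx w Ef). Proof. exact: msmooth_dmx. Qed.
Let sgU : msmooth (over O) (fun q => g (Uf q)). Proof. exact: (msmooth_along oO' sU UU sgm). Qed.
Let saU al : msmooth (over O) (fun q => a al (Uf q)).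
Proof. exact: (msmooth_along oO' sU UU (sa al)). Qed.
Let sC : msmooth (over O) (fun q => Cm g (Uf q) (vf q)). Proof. exact: (msmooth_Cm oU mg oO' sU UU svf). Qed.

Let sZf : msmooth (over O) Zf.
Proof. by apply: msmoothD => //; apply: msmoothM. Qed.

Let sLf : smooth (over O) Lf.
Proof. exact: (msmoothM oO' (msmooth_tr oO' sX) sZf). Qed.

Let sTf Y al : msmooth (over O) Y -> smooth (over O) (Tf Y al).
Proof. by move=> sY; exact: (msmoothM oO' (msmooth_tr oO' sY) (msmoothM oO' (saU al) svf)). Qed.

Let Oq x : over O (0, x). Proof. exact: O0. Qed.

Let dvf w x : dmx ((w, 0) : dom) vf (0, x) = dmx (1 : R) (fun y => (dmx ((w, 0) : dom) Uf (0, y))^T) x.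
Proof.
rewrite !dmx_tr (dmx_slice (sDU _) x O0).
by rewrite (dmx_comm oO' (Oq x) _ _ sU).
Qed.

Let suppL : supp L Lf.
Proof.
apply: filterS2 U0 E0 => z Uz Ez x Lx; rewrite /Lf /Zf /vf Uz// Ez// trmx0 /Cm.
have -> : contract (Gam g) (Uf (z, x)) 0 = 0.
  by rewrite /contract big1// => k _; rewrite mxE scale0r.
by rewrite trmx0 !mulmx0 oppr0 mul0mx addr0 sp0r.
Qed.

Let suppT Y al : supp L (Tf Y al).
Proof. by apply: filterS U0 => z Uz x Lx; rewrite /Tf /vf Uz// trmx0 mulmx0 sp0r. Qed.

Let nA al (y : R -> col) x : R :=
  sp (y x) (along (V x) (a al) (u x) *m vel u x + a al (u x) *m dmx (1 : R) V x).

Let e1 x : R := sp (xi x) (along (V x) g (u x) *m dmx (1 : R) eta x)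
  + sp (xi x) (dCm g (u x) (V x) (vel u x) *m eta x)
  + sp (xi x) (Cm g (u x) (dmx (1 : R) V x) *m eta x).

Let velE z x : O z -> vel (fun y => Uf (z, y)) x = vf (z, x).
Proof. by move=> Oz; rewrite /vel (dmx_slice sU x Oz). Qed.

Let hatE (w : R -> point) (y : R -> col) x : g (w x) *m hat g w y x =
  g (w x) *m dmx (1 : R) y x + Cm g (w x) (vel w x) *m y x.
Proof. by rewrite /hat mulmxBr /Cm mulNmx mulmxA. Qed.

Let Zf_hat z x : O z ->
  g (Uf (z, x)) *m hat g (fun y => Uf (z, y)) (fun y => Ef (z, y)) x = Zf (z, x).
Proof.
by move=> Oz; rewrite (hatE (fun y => Uf (z, y))) velE// (dmx_slice sE x Oz).
Qed.

Let dZf x : dmx es Zf (0, x) = g (u x) *m hat g u etad x + (along (V x) g (u x) *m dmx (1 : R) eta x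
  + dCm g (u x) (V x) (vel u x) *m eta x + Cm g (u x) (dmx (1 : R) V x) *m eta x).
Proof.
rewrite /Zf (dmxD (Oq x) _ (msmoothM oO' sgU (sDE ex)) (msmoothM oO' sC sE)).
rewrite (dmxM oO' (Oq x) _ sgU (sDE ex)) (dmxM oO' (Oq x) _ sC sE).
rewrite (dmx_map oO' sU UU es sgm (Oq x)) (dmx_Cm oU mg oO' sU UU es svf (Oq x)).
rewrite (dmx_comm oO' (Oq x) es ex sE) [dmx es vf _](dvf (1, 0)) -(velE x O0).
rewrite (dmx_slice sE x O0) (hatE u) (dmx_slice (sDE es) x O0) mulmxDl.
move: (along _ _ _ *m _) (g _ *m _) (dCm _ _ _ _ *m _) (Cm _ _ _ *m _) => A B C D.
move: (Cm _ _ _ *m _) => F.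
by apply/matrixP => i j; rewrite !mxE; ring.
Qed.

Let dLf x : 'D_es Lf (0, x) = lpart g u xid eta x + (lpart g u xi etad x + e1 x).
Proof.
rewrite (derive_sp es oO' sX sZf (Oq x)) dZf -(Zf_hat x O0) !spDr.
by rewrite /lpart /e1; ring.
Qed.

Let dTf Y al x : msmooth (over O) Y -> 'D_es (Tf Y al) (0, x) =
  tld a u al (fun x => dmx es Y (0, x)) x + nA al (fun x => Y (0, x)) x.
Proof.
move=> sY; rewrite (derive_sp es oO' sY (msmoothM oO' (saU al) svf) (Oq x)).
rewrite (dmxM oO' (Oq x) _ (saU al) svf) (dmx_map oO' sU UU es (sa al) (Oq x)).
by rewrite [dmx es vf _](dvf (1, 0)) -(velE x O0).
Qed.

Let slice_smooth z : O z -> smooth setT (fun x => Uf (z, x)).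
Proof. by move=> Oz; apply/smooth_mxP; [exact: openT|exact: msmooth_slice]. Qed.

(** Only for small parameters, because the support bounds are uniform only near 0. *)
Let near_bracket : \forall s \near (0 : R),
  integral (fun x => Lf ((s, 0), x))
   + \sum_al bil (fun x => Tf Xf al ((s, 0), x)) (fun x => Tf Ef (sg al) ((s, 0), x))
  = integral (fun x => sp (Xf ((s, 0), x))
     (Jc g a sg (fun y => Uf ((s, 0), y)) (fun y => Ef ((s, 0), y)) x)).
Proof.
have Oe : \forall z \near (0 : par), O z by apply: open_nbhs_nbhs.
have [d d0 Hd] := near_par (filterI (filterI U0 E0) Oe).
apply/nbhs_ballP; exists d => //= s; rewrite -ball_normE /= sub0r normrN => sd.
have [|[Us Es] Os] := Hd (s, 0); first by rewrite normr_par1.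
have su := slice_smooth Os; have sXs := msmooth_slice sX Os; have sEs := msmooth_slice sE Os.
have u0s x : L <= `|x| -> dmx (1 : R) (fun y => Uf ((s, 0), y)) x = 0.
  by move=> Lx; rewrite (dmx_slice sU x Os) Us.
have e0s x : L <= `|x| -> dmx (1 : R) (fun y => Ef ((s, 0), y)) x = 0.
  by move=> Lx; rewrite (dmx_slice sE x Os) Es.
have [_ E] := integral_Jc oU mg sg sa su (fun x => UU (Os : over O (s, 0, x))) L0 u0s sXs sEs e0s.
rewrite E.
have hL : (fun x => Lf ((s, 0), x)) =
    lpart g (fun y => Uf ((s, 0), y)) (fun y => Xf ((s, 0), y)) (fun y => Ef ((s, 0), y)).
  by apply/funext => x; rewrite /lpart (Zf_hat x Os).
have hT Y al : (fun x => Tf Y al ((s, 0), x)) =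
    tld a (fun y => Uf ((s, 0), y)) al (fun y => Y ((s, 0), y)).
  by apply/funext => x; rewrite /tld /tl velE.
have hS al : bil (fun x => Tf Xf al ((s, 0), x)) (fun x => Tf Ef (sg al) ((s, 0), x)) =
    bil (tld a (fun y => Uf ((s, 0), y)) al (fun y => Xf ((s, 0), y)))
        (tld a (fun y => Uf ((s, 0), y)) (sg al) (fun y => Ef ((s, 0), y))).
  by rewrite (hT Xf) (hT Ef).
exact (f_equal2 _ (f_equal (@integral R) hL) (eq_bigr _ (fun al _ => hS al))).
Qed.

Let u0 x : L <= `|x| -> dmx (1 : R) u x = 0.
Proof. by move=> Lx; rewrite (dmx_slice sU x O0); exact: (nbhs_singleton U0). Qed.
Let xi0 x : L <= `|x| -> dmx (1 : R) xi x = 0.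
Proof. by move=> Lx; rewrite (dmx_slice sX x O0); exact: (nbhs_singleton X0). Qed.
Let eta0 x : L <= `|x| -> dmx (1 : R) eta x = 0.
Proof. by move=> Lx; rewrite (dmx_slice sE x O0); exact: (nbhs_singleton E0). Qed.
Let etad0 x : L <= `|x| -> dmx (1 : R) etad x = 0.
Proof.
move=> Lx; rewrite (dmx_slice (sDE es) x O0) (dmx_comm oO' (Oq x) ex es sE).
exact: (dmx_supp (sDE ex) (1, 0) O0 E0 Lx).
Qed.
Let V0 x : L <= `|x| -> dmx (1 : R) V x = 0.
Proof.
move=> Lx; rewrite dmx_tr (dmx_slice (sDU es) x O0) (dmx_comm oO' (Oq x) ex es sU).
by rewrite (dmx_supp (sDU ex) (1, 0) O0 U0 Lx) trmx0.
Qed.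

Let su : smooth setT u := slice_smooth O0.
Let uU x : U (u x) := UU (Oq x).
Let sxi : msmooth setT xi := msmooth_slice sX O0.
Let seta : msmooth setT eta := msmooth_slice sE O0.
Let sxid : msmooth setT xid := msmooth_slice (sDX es) O0.
Let setad : msmooth setT etad := msmooth_slice (sDE es) O0.
Let sV : msmooth setT V.
Proof. by apply: msmooth_tr; [exact: openT|exact: (msmooth_slice (sDU es) O0)]. Qed.

Let cc_nA al y : msmooth setT y -> cc L (nA al y).
Proof.
move=> sy; have [_ _ _ sb] := msmooth_Eblocks oU mg sa su uU sV.
split=> [x|x Lx]; first exact: (smooth_cont (smooth_sp sy (sb al)) I).
by rewrite /nA (V0 Lx) (vel0 u0 Lx) !mulmx0 addr0 sp0r.
Qed.

Let cc_e1 : cc L e1.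
Proof.
have oT : open (setT : set R) by exact: openT.
have [b1 b2 b3 _] := msmooth_Eblocks oU mg sa su uU sV.
have sDe : msmooth setT (dmx (1 : R) eta) by exact: msmooth_dmx.
split=> [x|x Lx].
  suff se1 : smooth setT e1 by exact: (smooth_cont se1 I).
  by apply: smoothD => //; first apply: smoothD => //; apply: smooth_sp => //; apply: msmoothM.
have z Gm : contract Gm (u x) 0 = 0 by rewrite /contract big1// => k _; rewrite mxE scale0r.
rewrite /e1 (eta0 Lx) mulmx0 sp0r add0r (V0 Lx) /dCm (vel0 u0 Lx) /dcontract /Cm !z.
by rewrite trmx0 !mulmx0 addr0 oppr0 !mul0mx sp0r addr0.
Qed.

Let tldE Y al : (fun x => Tf Y al (0, x)) = tld a u al (fun x => Y (0, x)).
Proof. by apply/funext => x; rewrite /tld /tl (velE x O0). Qed.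

Let integral_dLf : integral (fun x => 'D_es Lf (0, x)) =
  integral (lpart g u xid eta) + (integral (lpart g u xi etad) + integral e1).
Proof.
have c1 := cc_lpart oU mg su uU u0 sxid seta eta0.
have c2 := cc_lpart oU mg su uU u0 sxi setad etad0.
have e2 := f_equal (@integral R) (funext dLf); apply: (etrans e2).
exact: (etrans (integralD L0 c1 (ccD c2 cc_e1)) (f_equal _ (integralD L0 c2 cc_e1))).
Qed.

Let bil_dTf al : bil (fun x => 'D_es (Tf Xf al) (0, x)) (fun x => Tf Ef (sg al) (0, x))
    + bil (fun x => Tf Xf al (0, x)) (fun x => 'D_es (Tf Ef (sg al)) (0, x)) =
  (bil (tld a u al xid) (tld a u (sg al) eta) + bil (nA al xi) (tld a u (sg al) eta))
  + (bil (tld a u al xi) (tld a u (sg al) etad) + bil (tld a u al xi) (nA (sg al) eta)).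
Proof.
have t al' y (sy : msmooth setT y) : cc L (tld a u al' y) := cc_tld sa su uU u0 al' sy.
have f1 : (fun x => 'D_es (Tf Xf al) (0, x)) = (fun x => tld a u al xid x + nA al xi x).
  by apply/funext => x; exact: dTf.
have f2 : (fun x => 'D_es (Tf Ef (sg al)) (0, x)) =
    (fun x => tld a u (sg al) etad x + nA (sg al) eta x).
  by apply/funext => x; exact: dTf.
apply: f_equal2.
  apply: (etrans (f_equal2 _ f1 (tldE Ef (sg al)))).
  exact: (bilDl L0 (t al _ sxid) (cc_nA al sxi) (t (sg al) _ seta)).
apply: (etrans (f_equal2 _ (tldE Xf al) f2)).
exact: (bilDr L0 (t al _ sxi) (t (sg al) _ setad) (cc_nA (sg al) seta)).
Qed.

Let integral_Eint : integral (Eint g a sg u xi eta V) = integral e1 +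
  \sum_al (bil (nA al xi) (tld a u (sg al) eta) - bil (nA al eta) (tld a u (sg al) xi)).
Proof.
have t al' y (sy : msmooth setT y) : cc L (tld a u al' y) := cc_tld sa su uU u0 al' sy.
have c1 al := bil_cc L0 (cc_nA al sxi) (t (sg al) _ seta).
have c2 al := bil_cc L0 (cc_nA al seta) (t (sg al) _ sxi).
have cs := @cc_sum _ _ (index_enum 'I_m) L _ (fun al => ccB (c1 al) (c2 al)).
apply: (etrans (integralD L0 cc_e1 cs)); apply: f_equal.
apply: (etrans (integral_sum _ L0 (fun al => ccB (c1 al) (c2 al)))).
by apply: eq_bigr => al _; exact: (integralB L0 (c1 al) (c2 al)).
Qed.

Let regroup (I1 I2 I3 : R) (f1 f2 f3 f4 f5 : 'I_m -> R) :
  \sum_al f5 al = - \sum_al f4 al ->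
  I1 + \sum_al f1 al + (I2 + \sum_al f2 al) + (I3 + \sum_al (f3 al - f4 al)) =
  I1 + (I2 + I3) + \sum_al (f1 al + f3 al + (f2 al + f5 al)).
Proof. by move=> E; rewrite sumrB !big_split /= E; ring. Qed.

(** Variations of [Xf] and [Ef] reassemble into the operator, the latter after [Jc_skew]; those of
    [Uf] form [Eint]. *)
Let derivative_value : integral (fun x => 'D_es Lf (0, x)) +
  \sum_al (bil (fun x => 'D_es (Tf Xf al) (0, x)) (fun x => Tf Ef (sg al) (0, x))
    + bil (fun x => Tf Xf al (0, x)) (fun x => 'D_es (Tf Ef (sg al)) (0, x))) =
  integral (fun x => sp (xid x) (Jc g a sg u eta x))
   - integral (fun x => sp (etad x) (Jc g a sg u xi x)) + integral (Eint g a sg u xi eta V).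
Proof.
have t al' y (sy : msmooth setT y) : cc L (tld a u al' y) := cc_tld sa su uU u0 al' sy.
have uL : u L = u (- L) by exact: (nbhs_singleton UL).
have xL : xi L = xi (- L) by exact: (nbhs_singleton XL).
have eL : etad L = etad (- L) by exact: (dmx_ends sE (1, 0) O0 EL).
have [_ J1] := integral_Jc oU mg sg sa su uU L0 u0 sxid seta eta0.
have [_ J2] := integral_Jc oU mg sg sa su uU L0 u0 sxi setad etad0.
have J3 := Jc_skew oU mg sgK sa su uU L0 u0 uL sxi setad xi0 etad0 xL eL.
(* The varied density stands under the inverse derivative; skewness moves it out, so the tails in
   [Eint] involve unvaried densities only. *)
have cross : \sum_al bil (tld a u al xi) (nA (sg al) eta) =
    - \sum_al bil (nA al eta) (tld a u (sg al) xi).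
  rewrite -sumrN [RHS](reindex_inj (inv_inj sgK)) /=; apply: eq_bigr => al _.
  by rewrite sgK; exact: bil_skew L0 (t al _ sxi) (cc_nA (sg al) seta).
apply: (etrans (f_equal2 _ integral_dLf (eq_bigr _ (fun al _ => bil_dTf al)))); apply/esym.
apply: (etrans (f_equal2 _ (f_equal2 _ J1 (etrans (esym J3) J2)) integral_Eint)).
exact: (regroup _ _ _ _ _ _ cross).
Qed.

Lemma bracket_is_derive : is_derive (0 : R) (1 : R)
  (fun s => integral (fun x => sp (Xf ((s, 0), x))
     (Jc g a sg (fun y => Uf ((s, 0), y)) (fun y => Ef ((s, 0), y)) x)))
  (integral (fun x => sp (xid x) (Jc g a sg u eta x))
   - integral (fun x => sp (etad x) (Jc g a sg u xi x)) + integral (Eint g a sg u xi eta V)).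
Proof.
have d1 := integral_is_derive oO O0 L0 sLf suppL.
have d2 al := bil_is_derive oO O0 L0 (sTf al sX) (@suppT Xf al) (sTf (sg al) sE) (@suppT Ef (sg al)).
have d := is_deriveD d1 (is_derive_sum d2).
have e := is_derive_eq d derivative_value.
apply: near_eq_is_derive e; apply: filterS near_bracket => s <-.
by rewrite fctE fct_sumE.
Qed.

End Family.

(** * Second variations of functionals *)

Section Variations.
Context {R : realType} {n : nat} (U : set 'rV[R]_n) (oU : open U).
Notation point := 'rV[R]_n.
Notation par := (R * R)%type.
Notation dom := (R * R * R)%type.
Notation es := (@es R).
Notation et := (@et R).
Notation ex := (@ex R).
Let oT : open (setT : set R). Proof. exact: openT. Qed.

Lemma smooth_linear (T W : normedModType R) (f : W -> R) (l : {linear T -> W}) (D : set T) :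
  open D -> continuous l -> smooth setT f -> smooth D (fun q => f (l q)).
Proof.
move=> oD cl sf; have dl q : differentiable l q by exact: linear_differentiable.
apply: (smooth_affine (L := l) oD dl _ _ sf) => // v q.
by rewrite (deriveE _ (dl q)) diff_lin.
Qed.

Lemma smooth_id : smooth setT (idfun : R -> R).
Proof.
move=> [|k]; first by move=> x _; exact: cvg_id.
split=> [x _|v]; first by apply/derivable1_diffP; exact: derivable_id.
apply: Ck_eq oT _ (@smooth_cst _ _ _ setT v k) => x _.
by rewrite derive_id.
Qed.

Lemma smooth_fst_fst (D : set dom) : open D -> smooth D (fun q => q.1.1).
Proof.
move=> oD; have sf : smooth setT (fst : par -> R).
  have := @smooth_linear par R idfun (@fst R R) setT openT.
  by apply; [move=> z; exact: cvg_fst|exact: smooth_id].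
by apply: (@smooth_linear dom par (@fst R R) (@fst par R) D oD _ sf) => z; exact: cvg_fst.
Qed.

Lemma smooth_fst_snd (D : set dom) : open D -> smooth D (fun q => q.1.2).
Proof.
move=> oD; have sf : smooth setT (snd : par -> R).
  have := @smooth_linear par R idfun (@snd R R) setT openT.
  by apply; [move=> z; exact: cvg_snd|exact: smooth_id].
by apply: (@smooth_linear dom par (@snd R R) (@fst par R) D oD _ sf) => z; exact: cvg_fst.
Qed.

Lemma msmooth_snd p q (A : R -> 'M[R]_(p, q)) (D : set dom) : open D -> msmooth setT A ->
  msmooth D (fun q => A q.2).
Proof.
move=> oD sA i j; have c : continuous (snd : dom -> R) by move=> z; exact: cvg_snd.
exact: (@smooth_linear dom R _ (@snd par R) D oD c (sA i j)).
Qed.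

Definition vary (u V W : R -> point) (p : par) x : point := u x + p.1 *: V x + p.2 *: W x.

Lemma smooth_vary u V W (D : set dom) : open D -> smooth setT u -> smooth setT V -> smooth setT W ->
  smooth D (fun q => vary u V W q.1 q.2).
Proof.
move=> oD su sV sW; apply/smooth_mxP => // i j.
have h (f : R -> point) : smooth setT f -> msmooth setT f by exact: (smooth_mxP f oT).1.
have mu := msmooth_snd oD (h _ su); have mV := msmooth_snd oD (h _ sV).
have mW := msmooth_snd oD (h _ sW).
have s1 := smooth_fst_fst oD; have s2 := smooth_fst_snd oD.
have mm : msmooth D (fun q : dom => u q.2 + q.1.1 *: V q.2 + q.1.2 *: W q.2).
  apply: msmoothD => //; last exact: msmoothZ.
  by apply: msmoothD => //; exact: msmoothZ.
exact: mm.
Qed.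

Lemma vary0 u V W : vary u V W 0 = u.
Proof. by apply/funext => x; rewrite /vary !scale0r !addr0. Qed.

Definition compact_variation (V : R -> point) : Prop :=
  smooth setT V /\ exists L, forall x, L <= `|x| -> V x = 0.

(** The interior is taken because [functional] is tested on families over an open set of
    parameters. *)
Definition admissible u V W : set par := interior [set p | forall x, U (vary u V W p x)].

(** On a segment containing both supports this is compactness; elsewhere [vary] does not move
    [u]. *)
Lemma admissible0 u V W : field U u -> compact_variation V -> compact_variation W ->
  admissible u V W 0.
Proof.
move=> [su uU [L [c uc]]] [sV [L1 V0]] [sW [L2 W0]].
pose K := Num.max L1 L2.
have cK : compact (`[(- K), K]%classic : set R) by exact: segment_compact.
have /compact_near_coveringP nc := cK.
have := nc par (nbhs (0 : par)) (fun p x => U (vary u V W p x)) _.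
have sv := smooth_vary openT su sV sW.
have h (x : R) : `[(- K), K]%classic x -> \forall x' \near x & p \near (0 : par),
    U (vary u V W p x').
  move=> _; have c0 := sv 0%N ((0 : par), x) I.
  have /c0/nbhs_ballP[d /= d0 Hd] : nbhs (vary u V W 0 x) U.
    by apply: open_nbhs_nbhs; split; rewrite // vary0.
  exists (ball x d, ball (0 : par) d); first by split; exact: nbhsx_ballx.
  by move=> [x' p] /= [bx bp]; apply: (Hd (p, x')); split.
move=> /(_ _ h); rewrite /admissible /interior /=; apply: filterS => p Hp x.
have [xK|Kx] := leP `|x| K; first by apply: Hp; rewrite /= in_itv /= -ler_norml.
rewrite /vary V0 ?W0 ?scaler0 ?addr0//.
  by apply: ltW; apply: le_lt_trans Kx; rewrite le_max lexx orbT.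
by apply: ltW; apply: le_lt_trans Kx; rewrite le_max lexx.
Qed.

Lemma open_admissible u V W : open (admissible u V W).
Proof. exact: open_interior. Qed.

Lemma vary_family u V W : field U u -> compact_variation V -> compact_variation W ->
  field_family U (admissible u V W) (vary u V W).
Proof.
move=> [su uU [L [c uc]]] [sV [L1 V0]] [sW [L2 W0]]; split.
- by apply: smooth_vary => //; apply: open_over; exact: open_admissible.
- by move=> p x /interior_subset; exact.
- move=> p0 _; exists (Num.max L (Num.max L1 L2)), c; apply: (@filterE _ (nbhs p0)) => p x.
  by rewrite !ge_max => /and3P[h1 h2 h3]; rewrite /vary uc// V0// W0// !scaler0 !addr0.
Qed.

Lemma family_msmooth (O : set par) (psi : par -> R -> point) : open O -> smooth_family O psi ->
  msmooth (over O) (fun q => psi q.1 q.2).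
Proof. by move=> oO sf; exact: (smooth_mxP _ (open_over oO)).1. Qed.

Lemma family_ends (O : set par) (psi : par -> R -> point) : open O -> O 0 -> covector_family O psi ->
  exists2 L, 0 < L & forall K, L <= K ->
  (\forall z \near (0 : par), forall x, K <= `|x| -> dmx ex (fun q => psi q.1 q.2) (z, x) = 0) /\
  (\forall z \near (0 : par), psi z K = psi z (- K)).
Proof.
move=> oO O0 [sf ends]; have [L HL] := ends 0 O0; have sX := family_msmooth oO sf.
exists (Num.max 1 (L + 1)); first by rewrite lt_max ltr01.
move=> K; rewrite ge_max => /andP[K1 LK].
have K0 : 0 <= K by apply: le_trans K1.
have LK' : L < K by apply: lt_le_trans LK; rewrite ltrDl.
have Oe : \forall z \near (0 : par), O z by apply: open_nbhs_nbhs.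
split; last first.
  by apply: filterS HL => z [c Hc]; rewrite !Hc// ?normrN ger0_norm//; exact: ltW.
apply: filterS2 Oe HL => z Oz [c Hc] x Kx.
rewrite -(dmx_slice sX x Oz); apply: (dmx_const_outside Hc).
exact: lt_le_trans Kx.
Qed.

(** For maps affine in the direction [e], whose difference quotients are constant. *)
Lemma derive_quotient (T W : normedModType R) (f : T -> W) e p c :
  (forall h, h != 0 -> h^-1 *: (f (h *: e + p) - f p) = c) -> 'D_e f p = c.
Proof.
move=> H; rewrite /derive; apply: cvg_lim => //.
apply: (@cvg_trans _ ((fun=> c) @ (0 : R)^')); last exact: cvg_cst.
apply: near_eq_cvg; near=> h; apply/esym; apply: H.
by near: h; exact: nbhs_dnbhs_neq.
Unshelve. all: by end_near. Qed.

Lemma vary_derive u V W e p x :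
  'D_e (fun q => vary u V W q x) p = e.1 *: V x + e.2 *: W x.
Proof.
apply: derive_quotient => h h0; rewrite /vary /=.
have -> : u x + (h *: e.1 + p.1) *: V x + (h *: e.2 + p.2) *: W x - (u x + p.1 *: V x + p.2 *: W x) =
    h *: (e.1 *: V x + e.2 *: W x).
  by apply/matrixP => i j; rewrite !mxE /GRing.scale /=; ring.
by rewrite scalerK.
Qed.

Lemma dmx_vary u V W e p x :
  dmx ((e, 0) : dom) (fun q => vary u V W q.1 q.2) (p, x) = e.1 *: V x + e.2 *: W x.
Proof.
apply/matrixP => i j; rewrite dmxE; apply: derive_quotient => h h0; rewrite /vary /= scaler0 add0r.
rewrite !mxE.
have -> : u x i j + (h *: e.1 + p.1) * V x i j + (h *: e.2 + p.2) * W x i j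
    - (u x i j + p.1 * V x i j + p.2 * W x i j) = h * (e.1 * V x i j + e.2 * W x i j).
  by rewrite /GRing.scale /=; ring.
by rewrite /GRing.scale /= mulKf.
Qed.

Lemma dmx_snd p q (A : R -> 'M[R]_(p, q)) e z x :
  dmx ((e, 0) : dom) (fun q => A q.2) (z, x) = 0.
Proof.
apply/matrixP => i j; rewrite dmxE mxE; apply: derive_quotient => h h0 /=.
by rewrite scaler0 add0r subrr scaler0.
Qed.

Lemma pairing_sp (y v : R -> point) : pairing y v = integral (fun x => sp (y x)^T (v x)^T).
Proof.
congr Rintegral; apply/funext => x; rewrite /sp trmxK mxE.
by apply: eq_bigr => i _; rewrite !mxE.
Qed.

Lemma is_derive_fst (G : par -> R) s t c : is_derive ((s, t) : par) (1, 0) G c ->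
  is_derive s (1 : R) (fun s => G (s, t)) c.
Proof.
have E h : G (h *: ((1, 0) : par) + (s, t)) = G (h *: 1 + s, t).
  by congr G; apply/eqP; rewrite xpair_eqE /= scaler0 add0r !eqxx.
by case=> d <-; apply: DeriveDef; rewrite /derivable /derive /= in d *;
  under eq_fun do rewrite -E.
Qed.

Lemma is_derive_snd (G : par -> R) s t c : is_derive ((s, t) : par) (0, 1) G c ->
  is_derive t (1 : R) (fun t => G (s, t)) c.
Proof.
have E h : G (h *: ((0, 1) : par) + (s, t)) = G (s, h *: 1 + t).
  by congr G; apply/eqP; rewrite xpair_eqE /= scaler0 add0r !eqxx.
by case=> d <-; apply: DeriveDef; rewrite /derivable /derive /= in d *;
  under eq_fun do rewrite -E.
Qed.

Context (F : (R -> point) -> R) (dF : (R -> point) -> (R -> point)) (fF : functional U F dF).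

(** Defined on the line u + s V alone, so that it does not depend on the family in which this line
    is embedded; [dmx_dF] recovers it from any two-parameter family [vary]. *)
Definition dvar u V x : 'cV[R]_n := dmx (1 : R) (fun s : R => (dF (fun y => u y + s *: V y) x)^T) 0.

Let Xf u V W q : 'cV[R]_n := (dF (vary u V W q.1) q.2)^T.

Section Directions.
Context u V W (fu : field U u) (cV : compact_variation V) (cW : compact_variation W).
Notation O := (admissible u V W).
Let oO : open O := @open_admissible u V W.
Let O0 : O 0 := admissible0 fu cV cW.

Lemma msmooth_dF : msmooth (over O) (Xf u V W).
Proof.
have [[sf _] _] := fF oO (vary_family fu cV cW).
have oO' := open_over oO.
by apply: msmooth_tr => //; apply: (smooth_mxP _ oO').1.
Qed.

Lemma dmx_dF e x :
  dmx ((e, 0) : dom) (Xf u V W) (0, x) = dvar u (fun y => e.1 *: V y + e.2 *: W y) x.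
Proof.
rewrite /dvar; apply/matrixP => i j; rewrite !dmxE.
have d : differentiable (fun q => Xf u V W q i j) (0, x) :=
  smooth_diff (msmooth_dF i j) (O0 : over O (0, x)).
have l : is_derive (0 : R) (1 : R) (fun t => Xf u V W ((0, x) + t *: ((e, 0) : dom)) i j)
    ('D_((e, 0) : dom) (fun q => Xf u V W q i j) (0, x)).
  have e0 : ((0, x) : dom) + 0 *: ((e, 0) : dom) = (0, x) by rewrite scale0r addr0.
  by rewrite -{2}e0; apply: derive_line; rewrite e0.
rewrite -(@derive_val _ _ _ _ _ _ _ l); congr (derive _ (0 : R) (1 : R)); apply/funext => s.
rewrite /Xf /= scaler0 addr0; congr ((dF _ x)^T i j); apply/funext => y.
by rewrite /vary /= !add0r scalerDr !scalerA addrA.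
Qed.

Lemma dmx_dF_es x : dmx es (Xf u V W) (0, x) = dvar u V x.
Proof.
apply: (etrans (dmx_dF (1, 0) x)); congr dvar.
by apply/funext => y; rewrite /= scale1r scale0r addr0.
Qed.

Lemma dmx_dF_et x : dmx et (Xf u V W) (0, x) = dvar u W x.
Proof.
apply: (etrans (dmx_dF (0, 1) x)); congr dvar.
by apply/funext => y; rewrite /= scale1r scale0r add0r.
Qed.

End Directions.

(** [young] for F(u + s V + t W): its first derivatives are the pairings of [dF] with [V] and [W],
    and [integral_expand] expands them. No second derivative of F is assumed. *)
Lemma dvar_sym u V W : field U u -> compact_variation V -> compact_variation W ->
  integral (fun x => sp (dvar u V x) (W x)^T) = integral (fun x => sp (dvar u W x) (V x)^T).
Proof.
move=> fu cV cW.
have oO : open (admissible u V W) := @open_admissible u V W.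
have O0 : admissible u V W 0 := admissible0 fu cV cW.
have [_ dFu] := fF oO (vary_family fu cV cW).
have oO' := open_over oO.
have [sV [L1 V0]] := cV; have [sW [L2 W0]] := cW.
pose L := Num.max 1 (Num.max L1 L2).
have L0 : 0 < L by rewrite lt_max ltr01.
have hm (f : R -> point) : smooth setT f -> msmooth setT f by exact: (smooth_mxP f oT).1.
have sX := msmooth_dF fu cV cW.
pose f1 q : R := sp (Xf u V W q) (V q.2)^T.
pose f2 q : R := sp (Xf u V W q) (W q.2)^T.
have mV := msmooth_tr oO' (msmooth_snd oO' (hm _ sV)).
have mW := msmooth_tr oO' (msmooth_snd oO' (hm _ sW)).
have s1 : smooth (over (admissible u V W)) f1 := msmoothM oO' (msmooth_tr oO' sX) mV 0 0.
have s2 : smooth (over (admissible u V W)) f2 := msmoothM oO' (msmooth_tr oO' sX) mW 0 0.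
have supp0 (X : R -> point) : (forall x, L <= `|x| -> X x = 0) ->
    supp L (fun q => sp (Xf u V W q) (X q.2)^T).
  by move=> X0; apply: (@filterE _ (nbhs (0 : par))) => p x Lx; rewrite X0// trmx0 sp0r.
have S1 : supp L f1.
  by apply: supp0 => x; rewrite !ge_max => /and3P[_ h _]; exact: V0.
have S2 : supp L f2.
  by apply: supp0 => x; rewrite !ge_max => /and3P[_ _ h]; exact: W0.
have [r r0 Hr] := near_par (open_nbhs_nbhs (conj oO O0)).
have np (s t d : R) : `|s| < d -> `|t| < d -> `|((s, t) : par)| < d.
  by move=> sd td; rewrite prod_normE /= gt_max sd td.
have val (f : dom -> R) (X : R -> point) e x : smooth setT X ->
    f = (fun q => sp (Xf u V W q) (X q.2)^T) ->
    'D_((e, 0) : dom) f (0, x) = sp (dmx ((e, 0) : dom) (Xf u V W) (0, x)) (X x)^T.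
  move=> sX' ->; have mX := msmooth_tr oO' (msmooth_snd oO' (hm _ sX')).
  rewrite (derive_sp _ oO' sX mX (O0 : over _ (0, x))).
  by rewrite (dmx_snd (fun x => (X x)^T)) sp0r addr0.
have ex (f : dom -> R) : smooth (over (admissible u V W)) f -> supp L f ->
    forall e, 0 < e -> exists2 d, 0 < d & forall s t, `|s| < d -> `|t| < d ->
   `|integral (fun x => f ((s, t), x)) - integral (fun x => f ((0, 0), x))
     - s * integral (fun x => 'D_es f (0, x)) - t * integral (fun x => 'D_et f (0, x))|
     <= e * (`|s| + `|t|).
  move=> sf sL e e0; have [d d0 Hd] := integral_expand oO O0 e0 L0 sf sL.
  exists d => // s t sd td; have := Hd _ (np _ _ _ sd td); rewrite /= opprD addrA.
  move=> /le_trans; apply; rewrite ler_pM2l// prod_normE /= ge_max.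
  by rewrite lerDl lerDr !normr_ge0.
have E1 : integral (fun x => 'D_et f1 (0, x)) = integral (fun x => sp (dvar u W x) (V x)^T).
  congr integral; apply/funext => x; rewrite (val f1 V (0, 1) x sV (erefl _)).
  by rewrite (dmx_dF_et fu cV cW).
have E2 : integral (fun x => 'D_es f2 (0, x)) = integral (fun x => sp (dvar u V x) (W x)^T).
  congr integral; apply/funext => x; rewrite (val f2 W (1, 0) x sW (erefl _)).
  by rewrite (dmx_dF_es fu cV cW).
apply: (etrans (esym E2)); apply: (etrans _ E1); apply/esym.
apply: (@young R (fun s t => F (vary u V W (s, t))) (fun s t => integral (fun x => f1 ((s, t), x)))
  (fun s t => integral (fun x => f2 ((s, t), x))) _ _ _ _ r r0 _ _ (ex f1 s1 S1) (ex f2 s2 S2)) => s t sr tr.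
  have := (dFu (s, t) (1, 0) (Hr _ (np _ _ _ sr tr))).
  rewrite pairing_sp => /is_derive_fst h; apply: is_derive_eq h _.
  congr integral; apply/funext => x; rewrite /f1 /Xf vary_derive /=.
  by rewrite scale1r scale0r addr0.
have := (dFu (s, t) (0, 1) (Hr _ (np _ _ _ sr tr))).
rewrite pairing_sp => /is_derive_snd h; apply: is_derive_eq h _.
congr integral; apply/funext => x; rewrite /f2 /Xf vary_derive /=.
by rewrite scale1r scale0r add0r.
Qed.

End Variations.

(** * The sufficient criterion for Hamiltonian operators with paired tails *)

Section HamiltonianCriterion.
Context {R : realType} {n : nat} (U : set 'rV[R]_n) (oU : open U).
Notation point := 'rV[R]_n.
Notation par := (R * R)%type.
Notation dom := (R * R * R)%type.
Context (g : point -> 'M[R]_n) (mg : metric U g).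
Context (m : nat) (a : 'I_m -> point -> 'M[R]_n) (sg : 'I_m -> 'I_m) (sgK : involutive sg).
Hypotheses (sa : forall al, msmooth U (a al))
  (ada : forall al u, U u -> selfadj g u (a al u))
  (cla : forall al k l u, U u -> cov (Gam g) k (fun p => a al p *m ecol l) u =
     cov (Gam g) l (fun p => a al p *m ecol k) u)
  (cma : forall al be u, U u -> a al u *m a be u = a be u *m a al u)
  (crv : forall k l u, U u -> conn_curv (Gam g) k l u *m g u =
     \sum_al ((a al u *m ecol k) *m (a (sg al) u *m ecol l)^T
              - (a al u *m ecol l) *m (a (sg al) u *m ecol k)^T)).
Notation J := (nonlocal_op g a (fun al => a (sg al))).
Notation Jc := (Jc g a sg).
Let oT : open (setT : set R). Proof. exact: openT. Qed.
Notation tr xi := (fun x => (xi x)^T).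

Lemma nonlocal_op_Jc (w xi : R -> point) x : smooth setT w -> (forall x, U (w x)) ->
  smooth setT xi -> J w xi x = (Jc w (tr xi) x)^T.
Proof.
move=> sw wU sxi; apply/matrixP => i j; rewrite (ord1 i) => {i}; rewrite [RHS]mxE.
have ptE al : Dinv (tail_density (a (sg al)) w xi) = pt a sg w al (tr xi).
  congr Dinv; apply/funext => y; rewrite /tail_density /tl /sp trmxK [RHS]mxE.
  apply: eq_bigr => k _; rewrite mxE mulr_sumr; apply: eq_bigr => l _.
  by rewrite /vel mxE (derive1_dmx y sw) mulrC mulrA.
rewrite /nonlocal_op /hydro_op mxE [in RHS]mxE; congr (_ + _); last first.
  rewrite summxE mulmx_suml summxE; apply: eq_bigr => al _.
  rewrite -scalemxAl !mxE ptE; congr (_ * _); apply: eq_bigr => k _.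
  by rewrite /vel mxE (derive1_dmx x sw).
rewrite mxE /hat mulmxBr [RHS]mxE [X in _ = _ + X]mxE; congr (_ - _).
  rewrite mxE; apply: eq_bigr => k _.
  by rewrite (derive1_dmx x sxi) dmx_tr mxE.
have Gs i s k : christoffel g (w x) i s k = Gam g k (w x) i s.
  by have := Gam_sym oU mg s k (wU x) => /matrixP/(_ i 0); rewrite !mul_ecol !mxE.
rewrite exchange_big [RHS]mxE; apply: eq_bigr => s _ /=.
rewrite mxE mulr_sumr; apply: eq_bigr => i _.
rewrite !mxE summxE mulr_suml mulr_sumr; apply: eq_bigr => k _.
rewrite Gs /vel (derive1_dmx x sw).
by move: (Gam g k (w x)) (dmx _ _ _) => A B; rewrite !mxE; ring.
Qed.

(** Test the functional on the family that stays at [u], obtained with both directions zero. *)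
Lemma functional_field F dF u : functional U F dF -> field U u ->
  smooth setT (dF u) /\ exists L c, const_outside L c (dF u).
Proof.
move=> fF fu.
have c0 : compact_variation (fun=> 0 : point).
  by split; [exact: smooth_cst|exists 0].
have O0 := admissible0 oU fu c0 c0.
have [[_ ends] _] := fF _ _ (@open_admissible _ _ U u (fun=> 0) (fun=> 0)) (vary_family fu c0 c0).
split.
  have sX := msmooth_slice (msmooth_dF fF fu c0 c0) O0.
  apply/(smooth_mxP _ oT) => i j; have := sX j i; apply: smooth_eq => // x _.
  by rewrite mxE /= vary0.
have [L /nbhs_singleton] := ends 0 O0.
by rewrite vary0 => -[c]; exists L, c.
Qed.

Lemma bracketE dF dG (u : R -> point) : smooth setT u -> (forall x, U (u x)) -> smooth setT (dG u) ->
  bracket J dF dG u = integral (fun x => sp (dF u x)^T (Jc u (tr (dG u)) x)).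
Proof.
move=> su uU sG; rewrite /bracket pairing_sp; congr integral; apply/funext => x.
by rewrite nonlocal_op_Jc// trmxK.
Qed.

Let col_smooth (f : R -> point) : smooth setT f -> msmooth setT (tr f).
Proof. by move=> sf; apply: msmooth_tr => //; exact: (smooth_mxP f oT).1. Qed.

Let row_smooth (f : R -> 'cV[R]_n) : msmooth setT f -> smooth setT (tr f).
Proof. by move=> sf; apply/(smooth_mxP _ oT); exact: (msmooth_tr oT sf). Qed.

Let tr_outside (f : R -> point) L c : const_outside L c f ->
  forall x, L + 1 <= `|x| -> dmx (1 : R) (tr f) x = 0.
Proof.
move=> fc x Lx; apply: (@dmx_const_outside _ _ _ _ L c^T) => [y Ly|]; first by rewrite fc.
by apply: lt_le_trans Lx; rewrite ltrDl.
Qed.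

Let row_outside (f : R -> point) L c : const_outside L c f ->
  forall x, L + 1 <= `|x| -> dmx (1 : R) f x = 0.
Proof.
move=> fc x Lx; apply: (dmx_const_outside fc).
by apply: lt_le_trans Lx; rewrite ltrDl.
Qed.

Let ends_eq (f : R -> point) L c K : const_outside L c f -> 0 <= K -> L <= K -> f K = f (- K).
Proof. by move=> fc K0 LK; rewrite !fc// ?normrN ger0_norm. Qed.

Lemma bracket_skew F dF G dG u : functional U F dF -> functional U G dG -> field U u ->
  bracket J dF dG u = - bracket J dG dF u.
Proof.
move=> fF fG fu; have [sF [L1 [c1 F1]]] := functional_field fF fu.
have [sG [L2 [c2 G2]]] := functional_field fG fu; have [su uU [L3 [c3 u3]]] := fu.
pose L := Num.max 1 (Num.max (L1 + 1) (Num.max (L2 + 1) (L3 + 1))).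
have L0 : 0 < L by rewrite lt_max ltr01.
have [l1 l2 l3] : [/\ L1 + 1 <= L, L2 + 1 <= L & L3 + 1 <= L].
  by rewrite /L !le_max !lexx !orbT.
have up k : k + 1 <= L -> k <= L by apply: le_trans; rewrite lerDl.
rewrite !bracketE//.
apply: (Jc_skew oU mg sgK sa su uU L0 _ _ (col_smooth sF) (col_smooth sG)).
- by move=> x Lx; apply: (row_outside u3); exact: le_trans Lx.
- by apply: (ends_eq u3); [exact: ltW|exact: up].
- by move=> x Lx; apply: (tr_outside F1); exact: le_trans Lx.
- by move=> x Lx; apply: (tr_outside G2); exact: le_trans Lx.
- by rewrite (ends_eq F1 (ltW L0) (up _ l1)).
- by rewrite (ends_eq G2 (ltW L0) (up _ l2)).
Qed.

(** [bracket_is_derive] for the family u + s V; functionals are tested on two-parameter families, so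
    the second direction is set to zero. *)
Lemma bracket_derive F dF G dG u V : functional U F dF -> functional U G dG -> field U u ->
  compact_variation V ->
  is_derive (0 : R) (1 : R) (fun s => bracket J dF dG (fun x => u x + s *: V x))
    (integral (fun x => sp (dvar dF u V x) (Jc u (tr (dG u)) x))
     - integral (fun x => sp (dvar dG u V x) (Jc u (tr (dF u)) x))
     + integral (Eint g a sg u (tr (dF u)) (tr (dG u)) (tr V))).
Proof.
move=> fF fG fu cV.
have c0 : compact_variation (fun=> 0 : point).
  by split; [exact: smooth_cst|exists 0].
pose O : set par := admissible U u V (fun=> 0).
have oO : open O by exact: open_admissible.
have O0 : O 0 := admissible0 oU fu cV c0.
have ff := vary_family fu cV c0; have oO' := open_over oO.
have [su _ _] := ff; have mU := family_msmooth oO su.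
have cov_fam dK K : functional U K dK -> covector_family O (fun p => dK (vary u V (fun=> 0) p)).
  by move=> fK; have [] := fK _ _ oO ff.
have cU : covector_family O (vary u V (fun=> 0)).
  have [h1 _ h2] := ff; split=> // p Op; have [L [c H]] := h2 p Op.
  by exists L; apply: filterS H => q Hq; exists c.
have [L1 L10 E1] := family_ends oO O0 cU.
have [L2 L20 E2] := family_ends oO O0 (cov_fam _ _ fF).
have [L3 L30 E3] := family_ends oO O0 (cov_fam _ _ fG).
pose L := Num.max L1 (Num.max L2 L3).
have L0 : 0 < L by rewrite lt_max L10.
have [l1 l2 l3] : [/\ L1 <= L, L2 <= L & L3 <= L] by rewrite /L !le_max !lexx !orbT.
have [U1 U2] := E1 L l1; have [F1 F2] := E2 L l2; have [G1 G2] := E3 L l3.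
have sF := msmooth_dF fF fu cV c0; have sG := msmooth_dF fG fu cV c0.
have UU q : over O q -> U (vary u V (fun=> 0) q.1 q.2) by move=> Oq; have [_ h _] := ff; exact: h.
pose val (xd ed Vd : R -> 'cV[R]_n) (w : R -> point) (xi eta : R -> 'cV[R]_n) :=
  integral (fun x => sp (xd x) (Jc w eta x)) - integral (fun x => sp (ed x) (Jc w xi x))
  + integral (Eint g a sg w xi eta Vd).
have F1t : \forall z \near (0 : par), forall x, L <= `|x| ->
    dmx (@ex R) (fun q => (dF (vary u V (fun=> 0) q.1) q.2)^T) (z, x) = 0.
  by apply: filterS F1 => z h x Lx; rewrite dmx_tr h// trmx0.
have G1t : \forall z \near (0 : par), forall x, L <= `|x| ->
    dmx (@ex R) (fun q => (dG (vary u V (fun=> 0) q.1) q.2)^T) (z, x) = 0.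
  by apply: filterS G1 => z h x Lx; rewrite dmx_tr h// trmx0.
have F2t : \forall z \near (0 : par),
    (dF (vary u V (fun=> 0) z) L)^T = (dF (vary u V (fun=> 0) z) (- L))^T.
  by apply: filterS F2 => z ->.
have G2t : \forall z \near (0 : par),
    (dG (vary u V (fun=> 0) z) L)^T = (dG (vary u V (fun=> 0) z) (- L))^T.
  by apply: filterS G2 => z ->.
have B := bracket_is_derive oU mg sgK sa oO O0 mU UU sF sG L0 U1 F1t G1t U2 F2t G2t.
have {}B : is_derive (0 : R) (1 : R) (fun s => bracket J dF dG (fun x => u x + s *: V x))
   (val (fun x => dmx (@es R) (fun q => (dF (vary u V (fun=> 0) q.1) q.2)^T) (0, x))
     (fun x => dmx (@es R) (fun q => (dG (vary u V (fun=> 0) q.1) q.2)^T) (0, x))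
     (fun x => (dmx (@es R) (fun q => vary u V (fun=> 0) q.1 q.2) (0, x))^T)
     (vary u V (fun=> 0) 0) (tr (dF (vary u V (fun=> 0) 0))) (tr (dG (vary u V (fun=> 0) 0)))).
  apply: near_eq_is_derive B.
  have [d d0 Hd] := near_par (open_nbhs_nbhs (conj oO O0)).
  apply/nbhs_ballP; exists d => //= s; rewrite -ball_normE /= sub0r normrN => sd.
  have Os : O (s, 0) by apply: Hd; rewrite normr_par1.
  have -> : (fun x => u x + s *: V x) = vary u V (fun=> 0) (s, 0).
    by apply/funext => x; rewrite /vary /= scaler0 addr0.
  have sl (f : dom -> point) : msmooth (over O) f -> smooth setT (fun x => f ((s, 0), x)).
    by move=> sf; apply/(smooth_mxP _ oT); exact: (msmooth_slice sf Os).
  rewrite bracketE//.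
  - exact: (sl _ mU).
  - by move=> x; exact: (UU ((s, 0), x) Os).
  - by have [h _] := cov_fam _ _ fG; exact: (sl _ (family_msmooth oO h)).
apply: is_derive_eq B _; rewrite vary0.
have -> : (fun x => dmx (@es R) (fun q => (dF (vary u V (fun=> 0) q.1) q.2)^T) (0, x)) = dvar dF u V.
  by apply/funext => x; exact: (dmx_dF_es oU fF fu cV c0).
have -> : (fun x => dmx (@es R) (fun q => (dG (vary u V (fun=> 0) q.1) q.2)^T) (0, x)) = dvar dG u V.
  by apply/funext => x; exact: (dmx_dF_es oU fG fu cV c0).
have -> : (fun x => (dmx (@es R) (fun q => vary u V (fun=> 0) q.1 q.2) (0, x))^T) = tr V.
  apply/funext => x; rewrite (dmx_vary u V (fun=> 0) (1, 0) 0 x) /=.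
  by rewrite scale1r scale0r addr0.
by [].
Qed.

(** This is what allows u to be varied along J dH in the double bracket. *)
Lemma compact_variation_J H dH u : functional U H dH -> field U u -> compact_variation (J u (dH u)).
Proof.
move=> fH fu; have [sH [L1 [c1 H1]]] := functional_field fH fu.
have [su uU [L3 [c3 u3]]] := fu.
pose L := Num.max 1 (Num.max (L1 + 1) (L3 + 1)).
have L0 : 0 < L by rewrite lt_max ltr01.
have [l1 l3] : L1 + 1 <= L /\ L3 + 1 <= L by rewrite /L !le_max !lexx !orbT.
have u0 x : L <= `|x| -> dmx (1 : R) u x = 0.
  by move=> Lx; apply: (row_outside u3); exact: le_trans Lx.
have -> : J u (dH u) = tr (Jc u (tr (dH u))).
  by apply/funext => x; exact: nonlocal_op_Jc.
split; first exact: row_smooth (msmooth_Jc oU mg sg sa su uU L0 u0 (col_smooth sH)).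
exists L => x Lx; rewrite (Jc0 g a sg u0 _ Lx) ?trmx0// => y Ly.
by apply: (tr_outside H1); exact: le_trans Ly.
Qed.

Theorem hamiltonian_criterion : hamiltonian_operator U J.
Proof.
split=> [F dF G dG fF fG u fu|F dF G dG H dH fF fG fH u fu]; first exact: bracket_skew fF fG fu.
have cF := compact_variation_J fF fu; have cG := compact_variation_J fG fu.
have cH := compact_variation_J fH fu.
have b1 := bracket_derive fF fG fu cH; have b2 := bracket_derive fG fH fu cF.
have b3 := bracket_derive fH fF fu cG.
eexists; eexists; eexists; split; [exact: b1|exact: b2|exact: b3|] => {b1 b2 b3}.
have [su uU [L0 [c0 u0]]] := fu.
have [sF [L1 [c1 F1]]] := functional_field fF fu.
have [sG [L2 [c2 G2]]] := functional_field fG fu.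
have [sH [L3 [c3 H3]]] := functional_field fH fu.
have JE K dK : functional U K dK -> tr (J u (dK u)) = Jc u (tr (dK u)).
  move=> fK; have [sK _] := functional_field fK fu.
  by apply/funext => x; rewrite nonlocal_op_Jc// trmxK.
(* Each second variation occurs twice in the cyclic sum with opposite signs and with its two
   directions exchanged. *)
have sym K dK A dA B dB : functional U K dK -> functional U A dA -> functional U B dB ->
    integral (fun x => sp (dvar dK u (J u (dA u)) x) (Jc u (tr (dB u)) x)) =
    integral (fun x => sp (dvar dK u (J u (dB u)) x) (Jc u (tr (dA u)) x)).
  move=> fK fA fB.
  have D := dvar_sym oU fK fu (compact_variation_J fA fu) (compact_variation_J fB fu).
  have I dA' V : tr (J u dA') = Jc u (tr dA') ->
      integral (fun x => sp (dvar dK u V x) (J u dA' x)^T) =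
      integral (fun x => sp (dvar dK u V x) (Jc u (tr dA') x)).
    by move=> e; congr integral; apply/funext => x; rewrite -e.
  exact: (etrans (esym (I _ _ (JE _ _ fB))) (etrans D (I _ _ (JE _ _ fA)))).
have E : integral (Eint g a sg u (tr (dF u)) (tr (dG u)) (Jc u (tr (dH u))))
    + integral (Eint g a sg u (tr (dG u)) (tr (dH u)) (Jc u (tr (dF u))))
    + integral (Eint g a sg u (tr (dH u)) (tr (dF u)) (Jc u (tr (dG u)))) = 0.
  pose L := Num.max (Num.max 1 (L0 + 1)) (Num.max (L1 + 1) (Num.max (L2 + 1) (L3 + 1))).
  have L_gt0 : 0 < L by rewrite !lt_max ltr01.
  have [l0 l1 l2 l3] : [/\ L0 + 1 <= L, L1 + 1 <= L, L2 + 1 <= L & L3 + 1 <= L].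
    by rewrite /L !le_max !lexx !orbT.
  apply: (Eint_cyclic oU mg sgK sa ada cla cma crv su uU L_gt0 _
    (col_smooth sF) (col_smooth sG) (col_smooth sH)).
  - by move=> x Lx; apply: (row_outside u0); exact: le_trans Lx.
  - by move=> x Lx; apply: (tr_outside F1); exact: le_trans Lx.
  - by move=> x Lx; apply: (tr_outside G2); exact: le_trans Lx.
  - by move=> x Lx; apply: (tr_outside H3); exact: le_trans Lx.
have alg (a1 a2 b1 b2 d1 d2 e1 e2 e3 e1' e2' e3' : R) : a1 = d2 -> b1 = a2 -> d1 = b2 ->
    e1 = e1' -> e2 = e2' -> e3 = e3' -> e1' + e2' + e3' = 0 ->
    (a1 - a2 + e1) + (b1 - b2 + e2) + (d1 - d2 + e3) = 0.
  by move=> -> -> -> -> -> -> e0; rewrite -[RHS]e0; ring.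
exact: (alg _ _ _ _ _ _ _ _ _ _ _ _ (sym _ _ _ _ _ _ fF fH fG) (sym _ _ _ _ _ _ fG fF fH)
  (sym _ _ _ _ _ _ fH fG fF) (f_equal (fun V => integral (Eint g a sg u _ _ V)) (JE _ _ fH))
  (f_equal (fun V => integral (Eint g a sg u _ _ V)) (JE _ _ fF))
  (f_equal (fun V => integral (Eint g a sg u _ _ V)) (JE _ _ fG)) E).
Qed.

End HamiltonianCriterion.

(** * The theorem *)

(** Ordinals with explicit bounds, so that [tnth] of a literal tuple computes on them. *)
Lemma ord4 (Pr : 'I_4 -> Prop) : Pr (@Ordinal 4 0 isT) -> Pr (@Ordinal 4 1 isT) ->
  Pr (@Ordinal 4 2 isT) -> Pr (@Ordinal 4 3 isT) -> forall al, Pr al.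
Proof.
move=> p0 p1 p2 p3 [k lk]; case: k lk => [|[|[|[|//]]]] lk;
  by rewrite (bool_irrelevance lk isT).
Qed.

Lemma sum_ord4 (T : nmodType) (F : 'I_4 -> T) : \sum_al F al =
  F (@Ordinal 4 0 isT) + F (@Ordinal 4 1 isT) + F (@Ordinal 4 2 isT) + F (@Ordinal 4 3 isT).
Proof.
rewrite !big_ord_recl big_ord0 addr0 !addrA.
by congr (F _ + F _ + F _ + F _); apply/val_inj.
Qed.

(* The partner of each tail: la <-> 1 and mu <-> vt. *)
Definition partner (al : 'I_4) : 'I_4 :=
  tnth [tuple @Ordinal 4 1 isT; @Ordinal 4 0 isT; @Ordinal 4 3 isT; @Ordinal 4 2 isT] al.

Lemma partnerK : involutive partner.
Proof. by apply: ord4. Qed.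

Lemma outer_ecol (R : realType) n (A C : 'M[R]_n) k l i j :
  ((A *m ecol k) *m (C *m ecol l)^T) i j = A i k * C j l.
Proof. by rewrite mxE big_ord1 [X in _ * X]mxE !mul_ecol. Qed.

Theorem theorem3 (R : realType) (n : nat) (U : set 'rV[R]_n)
    (g : 'rV[R]_n -> 'M[R]_n) (h B A N M P Q Rf S : 'rV[R]_n -> R) :
  open U -> metric U g -> flat U g ->
  smooth U h -> smooth U B -> smooth U A -> smooth U N -> smooth U M ->
  smooth U P -> smooth U Q -> smooth U Rf -> smooth U S ->
  let v := hess g h in
  conservation_law U v B A ->
  conservation_law U v N M ->
  (forall u, U u -> B u * M u - A u * N u != 0) ->
  let K := fun u => M u *: 1%:M - N u *: v u in
  (forall u, U u -> K u \in unitmx) ->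
  conservation_law U (hess g N) B P ->
  conservation_law U (hess g B) B Q ->
  conservation_law U (hess g N) N Rf ->
  conservation_law U (hess g B) N S ->
  (forall u, U u -> Q u = 2^-1 * grad_prod g B B u) ->
  (forall u, U u -> Rf u = 2^-1 * grad_prod g N N u) ->
  (forall u, U u -> P u + S u = grad_prod g B N u) ->
  let id := fun _ : 'rV[R]_n => 1%:M : 'M[R]_n in
  let vt : 'rV[R]_n -> 'M[R]_n := fun u => (B u *: v u - A u *: 1%:M) *m invmx (K u) in
  let mu : 'rV[R]_n -> 'M[R]_n := fun u => B u *: hess g N u - P u *: 1%:M
                     + N u *: (hess g N u *m vt u) - Rf u *: vt u in
  let la : 'rV[R]_n -> 'M[R]_n := fun u => B u *: hess g B u - Q u *: 1%:M
                     + N u *: (hess g B u *m vt u) - S u *: vt u in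
  let gt_cov := fun u => \matrix_(i < n, j < n) \sum_s \sum_r
       (K u s i * K u r j) / (B u * M u - A u * N u) ^+ 2
       * invmx (g u) s r in
  let gt := fun u => invmx (gt_cov u) in
  let a := fun al : 'I_4 => tnth [tuple la; id; mu; vt] al in
  let b := fun al : 'I_4 => tnth [tuple id; la; vt; mu] al in
  [/\ reciprocal_transform U B A N M v vt,
      hamiltonian_operator U (nonlocal_op gt a b),
      exists ht : 'rV[R]_n -> R, smooth U ht /\
        hamiltonian_system U gt a b vt ht &
      forall u, U u -> forall i j k l : 'I_n,
        let d := fun i j : 'I_n => (i == j)%:R : R in
        curvature gt u i j k l =
          la u i k * d j l + la u j l * d i k
          - la u j k * d i l - la u i l * d j k
          + mu u i k * vt u j l + mu u j l * vt u i k
          - mu u j k * vt u i l - mu u i l * vt u j k].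
Proof.
move=> oU mg fg sh sB sA sN sM sP sQ sR sS v lawA lawM nzD K uK lawP lawQ lawR lawS QE RE PSE.
move=> id vt mu la gt_cov gt a b.
pose be := hess g B; pose et := hess g N; pose gb := gc g B; pose nu := gc g N; pose gh := gc g h.
have ssv : msmooth U v := msmooth_hess oU mg sh.
have ssbe : msmooth U be := msmooth_hess oU mg sB.
have sset : msmooth U et := msmooth_hess oU mg sN.
have sb : msmooth U gb := msmooth_gc oU mg sB.
have snu : msmooth U nu := msmooth_gc oU mg sN.
have sgh : msmooth U gh := msmooth_gc oU mg sh.
have sv u : U u -> selfadj g u (v u) by move=> Uu; exact: (hess_selfadj oU mg).
have sbe u : U u -> selfadj g u (be u) by move=> Uu; exact: (hess_selfadj oU mg).
have set' u : U u -> selfadj g u (et u) by move=> Uu; exact: (hess_selfadj oU mg).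
(* The three commutations come from the fluxes A, M and P respectively. *)
have cvb u : U u -> v u *m be u = be u *m v u.
  by move=> Uu; exact: (law_commute oU mg fg Uu sh sB sA lawA).
have cve u : U u -> v u *m et u = et u *m v u.
  by move=> Uu; exact: (law_commute oU mg fg Uu sh sN sM lawM).
have ceb u : U u -> et u *m be u = be u *m et u.
  by move=> Uu; exact: (law_commute oU mg fg Uu sN sB sP lawP).
have clv k l u (Uu : U u) := hess_closed oU mg fg k l Uu sh.
have clbe k l u (Uu : U u) := hess_closed oU mg fg k l Uu sB.
have clet k l u (Uu : U u) := hess_closed oU mg fg k l Uu sN.
have covb k u (Uu : U u) : cov (Gam g) k gb u = be u *m ecol k := esym (hess_cov oU mg k Uu sB).
have covnu k u (Uu : U u) : cov (Gam g) k nu u = et u *m ecol k := esym (hess_cov oU mg k Uu sN).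
have covgh k u (Uu : U u) : cov (Gam g) k gh u = v u *m ecol k := esym (hess_cov oU mg k Uu sh).
have pdB k u (Uu : U u) : pd k B u = dot g u (gb u) (ecol k) := pd_dot mg k B Uu.
have pdN k u (Uu : U u) : pd k N u = dot g u (nu u) (ecol k) := pd_dot mg k N Uu.
have pdh k u (Uu : U u) : pd k h u = dot g u (gh u) (ecol k) := pd_dot mg k h Uu.
have pdA k u (Uu : U u) : pd k A u = dot g u (gb u) (v u *m ecol k) := law_pd mg k Uu lawA.
have pdM k u (Uu : U u) : pd k M u = dot g u (nu u) (v u *m ecol k) := law_pd mg k Uu lawM.
have pdP k u (Uu : U u) : pd k P u = dot g u (gb u) (et u *m ecol k) := law_pd mg k Uu lawP.
have pdQ k u (Uu : U u) : pd k Q u = dot g u (gb u) (be u *m ecol k) := law_pd mg k Uu lawQ.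
have pdR k u (Uu : U u) : pd k Rf u = dot g u (nu u) (et u *m ecol k) := law_pd mg k Uu lawR.
have pdS k u (Uu : U u) : pd k S u = dot g u (nu u) (be u *m ecol k) := law_pd mg k Uu lawS.
have {}QE u : U u -> Q u = 2^-1 * dot g u (gb u) (gb u).
  by move=> Uu; rewrite QE// (grad_prod_dot mg).
have {}RE u : U u -> Rf u = 2^-1 * dot g u (nu u) (nu u).
  by move=> Uu; rewrite RE// (grad_prod_dot mg).
have {}PSE u : U u -> P u + S u = dot g u (gb u) (nu u).
  by move=> Uu; rewrite PSE// (grad_prod_dot mg).
pose f u := 2^-1 * dot g u (gh u) (gh u).
have sf : smooth U f by apply: smoothM => //; [exact: smooth_cst|exact: smooth_dot].
have pdf k u : U u -> pd k f u = dot g u (gh u) (v u *m ecol k).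
  move=> Uu; have sd := smooth_dot oU mg sgh sgh.
  have -> : pd k f u = 2^-1 * pd k (fun p => dot g p (gh p) (gh p)) u.
    by rewrite /pd (deriveMs Uu _ (@smooth_cst _ _ _ U (2^-1 : R)) sd) derive_cst mul0r add0r.
  by rewrite (pd_dotE oU mg k Uu sgh sgh) covgh// (dotC mg (v u *m ecol k) _ Uu); field.
(* The squared determinant in the denominator is shared out, one factor to each [kk]. *)
have gtE : gt = rgt g B A N M v.
  apply/funext => z; congr invmx; apply/matrixP => i j.
  have kkE s r : kk B A N M v z s r = (B z * M z - A z * N z)^-1 * K z s r by rewrite [LHS]mxE.
  rewrite [LHS]mxE exchange_big [RHS]mxE; apply: eq_bigr => r _ /=.
  rewrite [X in _ = X * _]mxE mulr_suml; apply: eq_bigr => s _.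
  rewrite [X in _ = X * _ * _]mxE !kkE -exprVn.
  by move: (K z) (invmx (g z)) (B z * M z - A z * N z) => K' G D; ring.
have vtE : vt = rvt B A N M v by [].
have laE : la = rla B A N M Q S v be by [].
have muE : mu = rmu B A N M P Rf v et by [].
have mgt : metric U gt by rewrite gtE; exact: (metric_rgt oU mg sB sA sN sM ssv nzD uK).
have scv := msmooth_vt oU sB sA sN sM ssv uK.
have scl := msmooth_la oU sB sA sN sM sQ sS ssv ssbe uK.
have scm := msmooth_mu oU sB sA sN sM sP sR ssv sset uK.
have clvt := rgt_closed_vt oU mg sB sA sN sM ssv sv clv pdB pdN pdA pdM nzD uK.
have clid := rgt_closed_id oU mg sB sA sN sM ssv sv clv pdB pdN pdA pdM nzD uK.
have clla := rgt_closed_la oU mg sB sA sN sM sQ sS ssv ssbe sv sbe cvb clv clbe pdB pdN pdA pdM pdQ pdS nzD uK.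
have clmu := rgt_closed_mu oU mg sB sA sN sM sP sR ssv sset sv set' cve clv clet pdB pdN pdA pdM pdP pdR nzD uK.
have curv := curvature_rgt oU mg fg sB sA sN sM ssv sb snu sv cvb cve clv covb covnu pdB pdN pdA pdM nzD uK QE RE PSE.
have bE : b = fun al => a (partner al).
  by apply/funext; apply: ord4.
split.
- apply: (@reciprocal_transform_of R n U B A N M v vt uK _) => u Uu.
  rewrite -[M u *: 1%:M - N u *: v u]/(rK N M v u) vtE -(comm_rK N M (vt_v B A uK Uu)).
  exact: (vt_K B A uK Uu).
- rewrite bE; apply: (hamiltonian_criterion oU mgt partnerK).
  + by apply: ord4 => //; exact: msmooth_cst.
  + rewrite gtE; apply: ord4 => u Uu.
    * exact: (rgt_selfadj_la B A Q S sv sbe cvb uK Uu).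
    * by have := selfadj1 (rgt g B A N M v) u 1; rewrite scale1r.
    * exact: (rgt_selfadj_mu B A P Rf sv set' cve uK Uu).
    * exact: (rgt_selfadj_vt B A sv uK Uu).
  + by rewrite gtE; apply: ord4.
  + have c1 := la_mu B A P Q Rf S cvb cve ceb uK.
    have c2 := la_vt B A Q S cvb uK.
    have c3 := mu_vt B A P Rf cve uK.
    apply: ord4; apply: ord4 => u Uu; rewrite /a /tnth /= /id ?mulmx1 ?mul1mx//.
    * exact: c1.
    * exact: c2.
    * exact: esym (c1 u Uu).
    * exact: c3.
    * exact: esym (c2 u Uu).
    * exact: esym (c3 u Uu).
  (* The Gauss equation in paired form: each of the two pairs of tails, in both orders, gives four
     of the eight curvature terms. *)
  + move=> k l u Uu; apply/matrixP => i j.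
    rewrite -(curvatureE mgt) // gtE curv// summxE sum_ord4 /a /partner /tnth /=.
    have e (X Y Z W : 'M[R]_n) : (X *m ecol k *m (Y *m ecol l)^T - Z *m ecol l *m (W *m ecol k)^T) i j =
        X i k * Y j l - Z i l * W j k by rewrite mxE [X in _ + X]mxE !outer_ecol.
    by rewrite !e -laE -muE -vtE; move: (la u) (mu u) (vt u) => La Mu Vt; rewrite !mxE; ring.
- exists (rht B A N M h f); split; first exact: smooth_rht.
  (* The primitives follow the order of [b], that is 1, [la], [vt], [mu]. *)
  apply: (@hamiltonian_system_of R n U gt 4 a b vt (rht B A N M h f)
    (fun al => tnth [tuple rht B A N M h f; rF1 g B A N M P Q gb nu h f gh; rft B A N M h f;
                           rF3 g B A N M Rf S gb nu h f gh] al) oU mgt).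
  + exact: smooth_rht.
  + apply: ord4.
    * exact: smooth_rht.
    * exact: smooth_rF1.
    * exact: smooth_rft.
    * exact: smooth_rF3.
  + move=> u Uu; rewrite sum_ord4 gtE /a /tnth /=.
    exact: (hess_rht oU mg P Q Rf S sB sA sN sM ssv sb snu sv cvb cve clv covb covnu
      pdB pdN pdA pdM nzD uK sh sf sgh covgh pdh pdf Uu).
  + apply: ord4 => u k Uu; rewrite /b /tnth /=.
    * exact: (pd_rF0 oU sB sA sN sM pdB pdN pdA pdM nzD uK sh sf pdh pdf k Uu).
    * exact: (pd_rF1 oU mg sB sA sN sM sP sQ sb snu cvb covb covnu pdB pdN pdA pdM pdP pdQ nzD uK
        QE PSE sh sf sgh covgh pdh pdf k Uu).
    * exact: (pd_rF2 oU sB sA sN sM pdB pdN pdA pdM nzD uK sh sf pdh pdf k Uu).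
    * exact: (pd_rF3 oU mg sB sA sN sM sR sS sb snu cve covb covnu pdB pdN pdA pdM pdR pdS nzD uK
        RE PSE sh sf sgh covgh pdh pdf k Uu).
- by move=> u Uu i j k l d; rewrite gtE curv.
Qed.
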